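(* Let $X_1,X_2,\ldots$ be i.i.d. random vectors in $\mathbb{R}^q$ with distribution $P$, let $Q=Q(P)=\mathcal{L}(X_1-X_2)$, and suppose that $\boldsymbol{\Sigma}$ is as in case (a) or case (b) of the context, with $Q\in\mathcal{Q}$. Let $J=J_Q$ and define, for $x,y\in\mathbb{R}^q$, \[ H_1(x):=\mathbb{E}\,J(x-X_1),\qquad H_2(x,y):=J(x-y)-H_1(x)-H_1(y). \] Let $\boldsymbol{G}_1,\boldsymbol{G}_2$ be stochastically independent centered Gaussian random matrices in $\mathbb{R}^{q\times q}_{\rm sym}$ such that for all $A\in\mathbb{R}^{q\times q}_{\rm sym}$, \[ \mathbb{E}\langle A,\boldsymbol{G}_1\rangle^2=\mathbb{E}\langle A,H_1(X_1)\rangle^2,\qquad \mathbb{E}\langle A,\boldsymbol{G}_2\rangle^2=\mathbb{E}\langle A,H_2(X_1,X_2)\rangle^2 . \] Then: (i) If $d(n)$ are integers with $1\le d(n)\le (n-1)/2$ and $d(n)\to\infty$, then both $\boldsymbol{\Sigma}(\hat Q_n)$ and $\boldsymbol{\Sigma}(\hat Q_{n,d(n)})$ equal $\boldsymbol{\Sigma}(Q)+2\int H_1\,d\hat P_n+o_p(n^{-1/2})$. (ii) For each fixed integer $d\ge1$, $\boldsymbol{\Sigma}(\hat Q_{n,d})=\boldsymbol{\Sigma}(\hat Q_n)+\boldsymbol{M}_{n,d}+o_p(n^{-1/2})$, where $\boldsymbol{M}_{n,d}:=(nd)^{-1}\sum_{i=1}^n\sum_{j=i+1}^{i+d}H_2(X_i,X_j)$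 (with $X_{n+s}:=X_s$). (iii) For each fixed $d\ge1$, $\bigl(\sqrt n\int H_1\,d\hat P_n,\ \sqrt{nd}\,\boldsymbol{M}_{n,d}\bigr)\to_{\mathcal L}(\boldsymbol{G}_1,\boldsymbol{G}_2)$. (iv) In particular, if $d(n)\to\infty$ as in (i), then $\sqrt n(\boldsymbol{\Sigma}(\hat Q_n)-\boldsymbol{\Sigma}(Q))\to_{\mathcal L}2\boldsymbol{G}_1$ and $\sqrt n(\boldsymbol{\Sigma}(\hat Q_{n,d(n)})-\boldsymbol{\Sigma}(Q))\to_{\mathcal L}2\boldsymbol{G}_1$, whereas for each fixed integer $d\ge1$, $\sqrt n(\boldsymbol{\Sigma}(\hat Q_{n,d})-\boldsymbol{\Sigma}(Q))\to_{\mathcal L}2\boldsymbol{G}_1+d^{-1/2}\boldsymbol{G}_2$. All limits are as $n\to\infty$.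
   Context: Notation: $\mathbb{R}^{q\times q}_{\rm sym}$ is the space of symmetric $q\times q$ matrices, $\mathbb{R}^{q\times q}_{\rm sym,+}$ its subset of positive definite matrices; $\langle M,N\rangle=\mathrm{tr}(M^\top N)$ and $\|M\|$ is the Frobenius norm. $\delta_z$ is the Dirac measure at $z$ and $\delta^{\rm s}_z:=\frac12(\delta_z+\delta_{-z})$. For i.i.d. $X_1,\dots,X_n\sim P$ on $\mathbb{R}^q$: $\hat P_n:=n^{-1}\sum_{i=1}^n\delta_{X_i}$; $\hat Q_n:=\binom n2^{-1}\sum_{1\le i<j\le n}\delta^{\rm s}_{X_j-X_i}$; and for an integer $1\le d\le (n-1)/2$, $\hat Q_{n,d}:=(nd)^{-1}\sum_{i=1}^n\sum_{j=i+1}^{i+d}\delta^{\rm s}_{X_j-X_i}$ with the cyclic convention $X_{n+s}:=X_s$ for $1\le s\le n$. $\mathcal L(\cdot)$ denotes distribution, $\to_{\mathcal L}$ convergence in distribution, $o_p(a_n)$ a term $R_n$ with $R_n/a_n\to0$ in probability. Estimators $\boldsymbol{\Sigma}(\hat Q)$ are defined on the event $\hat Q\in\mathcal{Q}$ (and arbitrarily, e.g. as $I_q$, otherwise). Case (a): $\mathcal{Q}$ is a family of probability distributions on $\mathbb{R}^q$ which is open in the topology of weak convergence, and $\boldsymbol{\Sigma}:\mathcal{Q}\to\mathbb{R}^{q\times q}_{\rm sym,+}$ satisfies: (linear equivariance) for every nonsingular $B\in\mathbb{R}^{q\times q}$ and $Q\in\mathcal{Q}$, the law $Q^B$ of $BY$,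 $Y\sim Q$, lies in $\mathcal{Q}$ and $\boldsymbol{\Sigma}(Q^B)=B\boldsymbol{\Sigma}(Q)B^\top$; (differentiability) for each $Q\in\mathcal{Q}$ there is a bounded, measurable, even function $J=J_Q:\mathbb{R}^q\to\mathbb{R}^{q\times q}_{\rm sym}$ with $\int J\,dQ=0$ such that for $\check Q\in\mathcal{Q}$, $\boldsymbol{\Sigma}(\check Q)=\boldsymbol{\Sigma}(Q)+\int J\,d\check Q+o(\|\int J\,d\check Q\|)$ as $\check Q\to Q$ weakly. Case (b) (Tyler's functional): $P$ has no atoms; $\mathcal{Q}=\mathcal{Q}_0$ is the set of distributions $Q$ on $\mathbb{R}^q$ with $Q(\{0\})=0$ and $Q(\mathbb{W})<\dim(\mathbb{W})/q$ for every linear subspace $\mathbb{W}$ with $1\le\dim\mathbb{W}<q$; $\boldsymbol{\Sigma}(Q)=\boldsymbol{\Sigma}_0(Q)$ is the unique minimizer over $\{\Sigma\in\mathbb{R}^{q\times q}_{\rm sym,+}:\det\Sigma=1\}$ of $L_0(\Sigma,Q)=q\int\log\bigl(y^\top\Sigma^{-1}y/y^\top y\bigr)Q(dy)+\log\det\Sigma$; it has the differentiability property that for each $Q\in\mathcal{Q}_0$ there is a bounded, continuous, even $J=J_Q:\mathbb{R}^q\setminus\{0\}\to\mathbb{R}^{q\times q}_{\rm sym}$ with $\int J\,dQ=0$ and $\boldsymbol{\Sigma}_0(\check Q)=\boldsymbol{\Sigma}_0(Q)+\int J\,d\check Q+o(\|\int J\,d\check Q\|)$ as $\check Q\to Q$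 weakly, $\check Q\in\mathcal{Q}_0$; one sets $J(0):=0$. *)

(* Defs.v *)
(* R : realType; R^q is represented by row vectors
   'rV[R]_q, q x q matrices by 'M[R]_q.  Borel sigma-algebras are generated by
   the open sets of the (product) topology. *)
From mathcomp Require Import all_boot all_order all_algebra.
From mathcomp Require Import all_classical all_reals all_analysis.
Import Order.TTheory GRing.Theory Num.Theory numFieldTopology.Exports
  numFieldNormedType.Exports.
Set Implicit Arguments.
Unset Strict Implicit.
Unset Printing Implicit Defensive.
Local Open Scope classical_set_scope.
Local Open Scope ring_scope.

Definition borelT (T : topologicalType) := g_sigma_algebraType (@open T).

Definition Vb (R : realType) (q : nat) := borelT 'rV[R]_q.
Definition Mb (R : realType) (q : nat) := borelT 'M[R]_q.

(** A (candidate) distribution on R^q, as a set function on subsets of R^q. *)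
Definition Dist (R : realType) (q : nat) := set (Vb R q) -> \bar R.

Definition is_prob (R : realType) (q : nat) (mu : Dist R q) : Prop :=
  exists p : probability (Vb R q) R, forall A, p A = mu A.

Definition mx_inner (R : realType) (q : nat) (A B : 'M[R]_q) : R :=
  \tr (A^T *m B).

Definition frob (R : realType) (q : nat) (A : 'M[R]_q) : R :=
  Num.sqrt (mx_inner A A).

Definition symmx (R : realType) (q : nat) (A : 'M[R]_q) : Prop := A^T = A.

Definition posdef (R : realType) (q : nat) (A : 'M[R]_q) : Prop :=
  symmx A /\ forall v : 'rV[R]_q, v != 0 -> 0 < (v *m A *m v^T) 0 0.

Definition rint (d : measure_display) (T : measurableType d) (R : realType)
  (mu : set T -> \bar R) (f : T -> R) : R :=
  fine (integral mu setT (fun x => (f x)%:E)).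

Definition mint (d : measure_display) (T : measurableType d) (R : realType)
  (q : nat) (mu : set T -> \bar R) (F : T -> 'M[R]_q) : 'M[R]_q :=
  \matrix_(i, j) rint mu (fun x => F x i j).

(** image of Q under y |-> B y (column-vector convention; with row vectors
    this is y |-> y B^T) *)
Definition push_lin (R : realType) (q : nat) (B : 'M[R]_q) (Q : Dist R q)
  : Dist R q := fun A => Q ((fun y : 'rV[R]_q => y *m B^T) @^-1` A).

Definition bounded_fun (T : Type) (R : realType) (f : T -> R) : Prop :=
  exists M : R, forall x, `|f x| <= M.

(** N is a neighbourhood of Q in the topology of weak convergence
    (generated by mu |-> \int f dmu, f bounded continuous) on the set of
    probability distributions on R^q. *)
Definition weak_nbhs (R : realType) (q : nat) (Q : Dist R q)
    (N : set (Dist R q)) : Prop :=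
  exists (m : nat) (f : 'I_m -> 'rV[R]_q -> R) (e : R), 0 < e /\
    (forall k, continuous (f k) /\ bounded_fun (f k)) /\
    forall mu, is_prob mu ->
      (forall k, `| rint mu (f k) - rint Q (f k) | < e) -> N mu.

Definition weak_open (R : realType) (q : nat) (S : set (Dist R q)) : Prop :=
  (forall mu, S mu -> is_prob mu) /\ (forall mu, S mu -> weak_nbhs mu S).

Definition diff_at (R : realType) (q : nat) (S : set (Dist R q))
    (Sig : Dist R q -> 'M[R]_q) (Q : Dist R q) (J : 'rV[R]_q -> 'M[R]_q)
    : Prop :=
  forall e : R, 0 < e -> exists N, weak_nbhs Q N /\
    forall Qc, S Qc -> N Qc ->
      frob (Sig Qc - Sig Q - mint Qc J) <= e * frob (mint Qc J).

Definition J_props_a (R : realType) (q : nat) (Q : Dist R q)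
    (J : 'rV[R]_q -> 'M[R]_q) : Prop :=
  (exists M : R, forall x i j, `|J x i j| <= M) /\
  (forall i j, measurable_fun setT (fun x : Vb R q => J x i j)) /\
  (forall x, J (- x) = J x) /\
  (forall x, symmx (J x)) /\
  mint Q J = 0.

Definition J_props_b (R : realType) (q : nat) (Q : Dist R q)
    (J : 'rV[R]_q -> 'M[R]_q) : Prop :=
  (exists M : R, forall x i j, `|J x i j| <= M) /\
  {within ~` [set 0], continuous J} /\
  (forall x, J (- x) = J x) /\
  (forall x, symmx (J x)) /\
  J 0 = 0 /\
  mint Q J = 0.

Definition case_a (R : realType) (q : nat) (S : set (Dist R q))
    (Sig : Dist R q -> 'M[R]_q) : Prop :=
  weak_open S /\
  (forall Q, S Q -> posdef (Sig Q)) /\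
  (forall (B : 'M[R]_q) Q, B \in unitmx -> S Q ->
      S (push_lin B Q) /\ Sig (push_lin B Q) = B *m Sig Q *m B^T) /\
  (forall Q, S Q -> exists J, J_props_a Q J /\ diff_at S Sig Q J).

Definition Q0 (R : realType) (q : nat) : set (Dist R q) :=
  fun Q => is_prob Q /\ Q [set 0] = 0%E /\
    forall W : 'M[R]_q, (1 <= \rank W < q)%N ->
      (Q [set v | (v <= W)%MS] < ((\rank W)%:R / q%:R)%:E)%E.

Definition L0 (R : realType) (q : nat) (S : 'M[R]_q) (Q : Dist R q) : R :=
  q%:R * rint Q (fun y : 'rV[R]_q =>
                   ln ((y *m invmx S *m y^T) 0 0 / (y *m y^T) 0 0))
  + ln (\det S).

Definition case_b (R : realType) (q : nat) (P : Dist R q)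
    (S : set (Dist R q)) (Sig : Dist R q -> 'M[R]_q) : Prop :=
  (forall x, P [set x] = 0%E) /\
  S = @Q0 R q /\
  (forall Q, @Q0 R q Q ->
     posdef (Sig Q) /\ \det (Sig Q) = 1 /\
     forall S' : 'M[R]_q, posdef S' -> \det S' = 1 -> S' != Sig Q ->
       L0 (Sig Q) Q < L0 S' Q).

Definition iid (d : measure_display) (Omega : measurableType d)
    (R : realType) (q : nat) (Pr : probability Omega R)
    (X : nat -> Omega -> 'rV[R]_q) : Prop :=
  (forall i, measurable_fun setT (X i : Omega -> Vb R q)) /\
  forall (s : seq nat) (B : nat -> set (Vb R q)), uniq s ->
    (forall i, measurable (B i)) ->
    Pr (\bigcap_(i in [set i | i \in s]) (X i @^-1` B i)) =
    (\prod_(i <- s) Pr (X 0%N @^-1` B i))%E.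

Definition law (d : measure_display) (Omega : measurableType d)
    (R : realType) (q : nat) (Pr : probability Omega R)
    (Y : Omega -> 'rV[R]_q) : Dist R q := fun A => Pr (Y @^-1` A).

Definition dsym (R : realType) (q : nat) (z : 'rV[R]_q) : Dist R q :=
  fun A => (((2 : R)^-1)%:E * (@dirac _ (Vb R q) z R A + @dirac _ (Vb R q) (- z)%R R A))%E.

(** \hat Q_n (0-based indices: X_0, ..., X_{n-1}) *)
Definition Qhat (R : realType) (q : nat) (T : Type) (X : nat -> T -> 'rV[R]_q)
    (n : nat) (w : T) : Dist R q :=
  fun A => ((('C(n, 2)%:R : R)^-1)%:E *
    (\sum_(0 <= j < n) \sum_(0 <= i < j) dsym (X j w - X i w)%R A))%E.

(** \hat Q_{n,d}, with the cyclic convention X_{n+s} = X_s *)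
Definition Qhatd (R : realType) (q : nat) (T : Type) (X : nat -> T -> 'rV[R]_q)
    (n d : nat) (w : T) : Dist R q :=
  fun A => ((((n * d)%N%:R : R)^-1)%:E *
    (\sum_(0 <= i < n) \sum_(i.+1 <= j < (i + d).+1)
        dsym (X (j %% n)%N w - X i w)%R A))%E.

Definition outer_prob (d : measure_display) (Omega : measurableType d)
    (R : realType) (Pr : probability Omega R) (A : set Omega) : \bar R :=
  ereal_inf [set Pr B | B in [set B | measurable B /\ A `<=` B]].

Definition op_sqrt (d : measure_display) (Omega : measurableType d)
    (R : realType) (q : nat) (Pr : probability Omega R)
    (Rn : nat -> Omega -> 'M[R]_q) : Prop :=
  forall e : R, 0 < e ->
    (fun n => outer_prob Pr [set w | e < Num.sqrt (n%:R) * frob (Rn n w)])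
      @ \oo --> 0%E.

Definition outer_exp (d : measure_display) (Omega : measurableType d)
    (R : realType) (Pr : probability Omega R) (h : Omega -> R) : \bar R :=
  ereal_inf [set (\int[Pr]_w (g w)%:E)%E | g in
    [set g : Omega -> R | measurable_fun setT g /\ bounded_fun g /\
                          forall w, h w <= g w]].

(** convergence in distribution (Hoffmann-Jorgensen sense, which is the usual
    one when the Z_n are measurable) of Z_n to the random element G *)
Definition cvg_dist (d : measure_display) (Omega : measurableType d)
    (d' : measure_display) (Omega' : measurableType d')
    (R : realType) (E : topologicalType) (Pr : probability Omega R)
    (Z : nat -> Omega -> E) (Pr' : probability Omega' R) (G : Omega' -> E)
    : Prop :=
  forall f : E -> R, continuous f -> bounded_fun f ->
    (fun n => outer_exp Pr (fun w => f (Z n w))) @ \oo -->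
      (\int[Pr']_w (f (G w))%:E)%E.

Definition cnormal (R : realType) (v : R) : set R -> \bar R :=
  if v == 0 then \d_(0 : R) else normal_prob 0 (Num.sqrt v).

Definition cgauss_mx (d : measure_display) (Omega : measurableType d)
    (R : realType) (q : nat) (Pr : probability Omega R)
    (G : Omega -> 'M[R]_q) : Prop :=
  measurable_fun setT (G : Omega -> Mb R q) /\
  forall A : 'M[R]_q, exists v : R, 0 <= v /\
    forall B : set R, measurable B ->
      Pr ((fun w => mx_inner A (G w)) @^-1` B) = cnormal v B.

Definition indep_mx (d : measure_display) (Omega : measurableType d)
    (R : realType) (q : nat) (Pr : probability Omega R)
    (G1 G2 : Omega -> 'M[R]_q) : Prop :=
  forall B1 B2 : set (Mb R q), measurable B1 -> measurable B2 ->
    Pr (G1 @^-1` B1 `&` G2 @^-1` B2) =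
    (Pr (G1 @^-1` B1) * Pr (G2 @^-1` B2))%E.

Definition H1 (d : measure_display) (Omega : measurableType d)
    (R : realType) (q : nat) (Pr : probability Omega R)
    (X : nat -> Omega -> 'rV[R]_q) (J : 'rV[R]_q -> 'M[R]_q)
    (x : 'rV[R]_q) : 'M[R]_q :=
  mint Pr (fun w => J (x - X 0%N w)).

Definition H2 (d : measure_display) (Omega : measurableType d)
    (R : realType) (q : nat) (Pr : probability Omega R)
    (X : nat -> Omega -> 'rV[R]_q) (J : 'rV[R]_q -> 'M[R]_q)
    (x y : 'rV[R]_q) : 'M[R]_q :=
  J (x - y) - H1 Pr X J x - H1 Pr X J y.

Definition H1bar (d : measure_display) (Omega : measurableType d)
    (R : realType) (q : nat) (Pr : probability Omega R)
    (X : nat -> Omega -> 'rV[R]_q) (J : 'rV[R]_q -> 'M[R]_q)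
    (n : nat) (w : Omega) : 'M[R]_q :=
  (n%:R)^-1 *: \sum_(0 <= i < n) H1 Pr X J (X i w).

Definition Mnd (d : measure_display) (Omega : measurableType d)
    (R : realType) (q : nat) (Pr : probability Omega R)
    (X : nat -> Omega -> 'rV[R]_q) (J : 'rV[R]_q -> 'M[R]_q)
    (n dd : nat) (w : Omega) : 'M[R]_q :=
  (((n * dd)%N)%:R)^-1 *:
    \sum_(0 <= i < n) \sum_(i.+1 <= j < (i + dd).+1)
       H2 Pr X J (X i w) (X (j %% n)%N w).

(* Main.v *)
(**
Both estimators average delta^s over a regular design of index pairs, so the
integral of J against them splits exactly as 2 * mean(H1) plus an average of the
degenerate kernel H2 over the design.  Orthogonality of the H2 terms bounds its
second moment by a constant over the number of pairs; applied to bounded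
continuous functions the same decomposition shows that the estimators fall in any
weak neighbourhood of Q with probability tending to 1, and differentiability then
gives the expansions.  For Tyler's functional the domain is a weak neighbourhood
of Q among the distributions without mass at 0, by compactness of the orthogonal
projections of given rank.

The joint limit comes from characteristic functions: the cyclic sum is, up to
O(n^(-1/2)), a sum of dd-dependent martingale differences D_k, and conditioning
gives E cos(S_k + th) = (1 - s^2/(2n)) E cos(S_(k-1) + th) + O(n^(-3/2)).
Convergence in distribution follows from tightness and approximation of bounded
continuous functions by trigonometric polynomials, the non-measurable remainders
being handled with outer probability.
*)
Require Import Defs.
From HB Require Import structures.
From mathcomp Require Import all_boot all_order all_algebra.
From mathcomp Require Import all_classical all_reals all_analysis.
From mathcomp Require Import measurable_realfun ring lra zify.
Import Order.TTheory GRing.Theory Num.Theory numFieldTopology.Exports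
  numFieldNormedType.Exports.
Set Implicit Arguments.
Unset Strict Implicit.
Unset Printing Implicit Defensive.
Local Open Scope classical_set_scope.
Local Open Scope ring_scope.

(** * Bounded measurable functions and outer probability *)

(** Nothing makes [Sig (Qhat X n w)] measurable in w. All moments are therefore computed for bounded
    measurable functions of finitely many X i, and they reach the estimators only through inclusions
    of events, measured by outer probability. Fubini's theorem on disjoint blocks of indices
    ([decouple]) takes the place of conditional expectation. The decisive fact is that integrating
    out either argument annihilates [h2]. It yields the orthogonality behind the second-moment
    bounds and the martingale property behind the limit theorem, and it makes the linear and the
    degenerate part uncorrelated: the limiting variance has no cross term, which is how the
    independence of G1 and G2 appears. Weak consistency alone would not give the expansions. The
    remainder in the differentiability property is small only relative to the integral of J, so this
    integral must be shown to be of order n^(-1/2), and this too comes from the second moments. *)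

Section BoundedMeasurable.
Context {d : measure_display} {T : measurableType d} {R : realType}.
Implicit Types (f g : T -> R) (mu : probability T R).

Definition bmf f := measurable_fun setT f /\ exists M : R, forall x, `|f x| <= M.

Lemma bmf_cst (c : R) : bmf (fun=> c).
Proof. by split; [exact: measurable_cst|exists `|c|]. Qed.

Lemma bmfD f g : bmf f -> bmf g -> bmf (fun x => f x + g x).
Proof.
move=> [mf [M fM]] [mg [N gN]]; split; first exact: measurable_funD.
by exists (M + N) => x; rewrite (le_trans (ler_normD _ _))// lerD.
Qed.

Lemma bmfN f : bmf f -> bmf (fun x => - f x).
Proof.
move=> [mf [M fM]]; split; first exact: measurableT_comp.
by exists M => x; rewrite normrN.
Qed.

Lemma bmfB f g : bmf f -> bmf g -> bmf (fun x => f x - g x).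
Proof. by move=> bf bg; apply: bmfD => //; exact: bmfN. Qed.

Lemma bmfM f g : bmf f -> bmf g -> bmf (fun x => f x * g x).
Proof.
move=> [mf [M fM]] [mg [N gN]]; split; first exact: measurable_funM.
by exists (M * N) => x; rewrite normrM ler_pM.
Qed.

Lemma bmfZ (c : R) f : bmf f -> bmf (fun x => c * f x).
Proof. by move=> bf; apply: bmfM => //; exact: bmf_cst. Qed.

Lemma bmfX f n : bmf f -> bmf (fun x => f x ^+ n).
Proof.
move=> bf; elim: n => [|n IH]; first exact: bmf_cst.
by under eq_fun do rewrite exprS; exact: bmfM.
Qed.

Lemma bmf_sum (I : Type) (s : seq I) (P : pred I) (F : I -> T -> R) :
  (forall i, P i -> bmf (F i)) -> bmf (fun x => \sum_(i <- s | P i) F i x).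
Proof.
move=> bF; elim: s => [|i s IH].
  by under eq_fun do rewrite big_nil; exact: bmf_cst.
under eq_fun do rewrite big_cons.
by case Pi: (P i) => //; apply: bmfD => //; exact: bF.
Qed.

Lemma bmf_cos f : measurable_fun setT f -> bmf (fun x => cos (f x)).
Proof.
move=> mf; split; last by exists 1 => x; exact: cos_max.
apply: measurableT_comp mf; apply: continuous_measurable_fun.
exact: continuous_cos.
Qed.

Lemma bmf_sin f : measurable_fun setT f -> bmf (fun x => sin (f x)).
Proof.
move=> mf; split; last by exists 1 => x; exact: sin_max.
apply: measurableT_comp mf; apply: continuous_measurable_fun.
exact: continuous_sin.
Qed.

Lemma bmf_indic (A : set T) : measurable A -> bmf (\1_A : T -> R).
Proof.
move=> mA; split; first exact: measurable_indic.
by exists 1 => x; rewrite indicE; case: (_ \in _); rewrite ?normr1 ?normr0.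
Qed.

Lemma bmf_measurable_ge (c : R) f : bmf f -> measurable [set x | c <= f x].
Proof.
move=> bf; rewrite -[X in measurable X]setTI.
have -> : [set x | c <= f x] = f @^-1` `[c, +oo[%classic.
  by apply/seteqP; split => x /=; rewrite in_itv/= andbT.
by apply: bf.1 => //; exact: measurable_itv.
Qed.

Lemma bmf_integrable mu f : bmf f -> mu.-integrable setT (EFin \o f).
Proof.
move=> [mf [M fM]]; apply: measurable_bounded_integrable => //.
  by rewrite [X in (X < _)%E](probability_setT mu) ltry.
exists M; split; first exact: num_real.
by move=> N MN x _ /=; rewrite (le_trans (fM _))// ltW.
Qed.

Lemma integral_bmf mu f : bmf f ->
  (\int[mu]_x (f x)%:E)%E = (rint mu f)%:E.
Proof.
by move=> bf; rewrite fineK//; apply: integrable_fin_num => //; exact: bmf_integrable.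
Qed.

Lemma rint_cst mu (c : R) : rint mu (fun=> c) = c.
Proof.
by rewrite /rint integral_cst// [X in (_ * X)%E](probability_setT mu) mule1.
Qed.

Lemma rintD mu f g : bmf f -> bmf g ->
  rint mu (fun x => f x + g x) = rint mu f + rint mu g.
Proof. by move=> bf bg; apply: RintegralD => //; exact: bmf_integrable. Qed.

Lemma rintB mu f g : bmf f -> bmf g ->
  rint mu (fun x => f x - g x) = rint mu f - rint mu g.
Proof. by move=> bf bg; apply: RintegralB => //; exact: bmf_integrable. Qed.

Lemma rintZ mu (c : R) f : bmf f -> rint mu (fun x => c * f x) = c * rint mu f.
Proof. by move=> bf; apply: RintegralZl => //; exact: bmf_integrable. Qed.

Lemma rintN mu f : bmf f -> rint mu (fun x => - f x) = - rint mu f.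
Proof.
move=> bf; rewrite -mulN1r -rintZ//; congr (rint mu).
by apply/funext => x; rewrite mulN1r.
Qed.

Lemma rint_sum mu (I : Type) (s : seq I) (P : pred I) (F : I -> T -> R) :
  (forall i, P i -> bmf (F i)) ->
  rint mu (fun x => \sum_(i <- s | P i) F i x) = \sum_(i <- s | P i) rint mu (F i).
Proof.
move=> bF; elim: s => [|i s IH].
  by under eq_fun do rewrite big_nil; rewrite rint_cst big_nil.
under eq_fun do rewrite big_cons; rewrite big_cons.
case Pi: (P i) => //; rewrite rintD ?IH//; first exact: bF.
exact: bmf_sum.
Qed.

Lemma rint_le mu f g : bmf f -> bmf g -> (forall x, f x <= g x) ->
  rint mu f <= rint mu g.
Proof. by move=> bf bg fg; apply: le_Rintegral => //; exact: bmf_integrable. Qed.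

Lemma rint_ge0 mu f : (forall x, 0 <= f x) -> 0 <= rint mu f.
Proof. by move=> f0; apply: Rintegral_ge0. Qed.

Lemma rint_norm_le mu f (M : R) : bmf f -> (forall x, `|f x| <= M) ->
  `|rint mu f| <= M.
Proof.
move=> bf fM; rewrite ler_norml; apply/andP; split.
  rewrite -[leLHS](rint_cst mu); apply: rint_le => //; first exact: bmf_cst.
  by move=> x; have := fM x; rewrite ler_norml => /andP[].
rewrite -[leRHS](rint_cst mu); apply: rint_le => //; first exact: bmf_cst.
by move=> x; have := fM x; rewrite ler_norml => /andP[].
Qed.

Lemma rint_indic mu (A : set T) : measurable A -> rint mu (\1_A) = fine (mu A).
Proof. by move=> mA; rewrite /rint integral_indic// setIT. Qed.

Lemma markov_rint mu f (c : R) : 0 < c -> bmf f -> (forall x, 0 <= f x) ->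
  (mu [set x | (c <= f x)%R] <= (rint mu f / c)%:E)%E.
Proof.
move=> c0 bf f0.
have mA := bmf_measurable_ge c bf.
rewrite -[leLHS]fineK ?fin_num_measure// -rint_indic// lee_fin ler_pdivlMr//.
rewrite mulrC -rintZ; last exact: bmf_indic.
apply: rint_le => //; first by apply: bmfZ; exact: bmf_indic.
move=> x; rewrite indicE; have [|_] := boolP (x \in _); last by rewrite mulr0.
by rewrite inE /= mulr1.
Qed.

End BoundedMeasurable.

Lemma bmf_comp d (T : measurableType d) d' (T' : measurableType d') (R : realType)
    (f : T' -> R) (Y : T -> T') :
  measurable_fun setT Y -> bmf f -> bmf (fun x => f (Y x)).
Proof.
move=> mY [mf [M fM]]; split; first exact: measurableT_comp mf mY.
by exists M.
Qed.

Lemma rint_pushforward d (T : measurableType d) d' (T' : measurableType d')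
    (R : realType) (mu : probability T R) (f : T' -> R) (Y : T -> T') :
  measurable_fun setT Y -> bmf f ->
  rint (pushforward mu Y) f = rint mu (fun x => f (Y x)).
Proof.
move=> mY bf; rewrite /rint; congr fine.
rewrite integral_pushforward//; first by move/measurable_EFinP: bf.1.
by rewrite preimage_setT; apply: bmf_integrable; exact: bmf_comp mY bf.
Qed.

Section OuterProbability.
Context {d : measure_display} {Omega : measurableType d} {R : realType}.
Variable Pr : probability Omega R.
Implicit Types (A B : set Omega) (C D : nat -> set Omega).

Lemma outer_prob_le A B : measurable B -> A `<=` B -> (outer_prob Pr A <= Pr B)%E.
Proof. by move=> mB AB; apply: ereal_inf_lbound; exists B. Qed.

Lemma outer_prob_ge0 A : (0 <= outer_prob Pr A)%E.
Proof. by apply: le_ereal_inf_tmp => _ [B [mB _] <-]. Qed.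

Lemma outer_probS A B : A `<=` B -> (outer_prob Pr A <= outer_prob Pr B)%E.
Proof.
move=> AB; apply: le_ereal_inf => _ [D [mD BD] <-]; exists D => //.
by split => //; exact: subset_trans BD.
Qed.

Lemma outer_prob_lt A (e : R) : (outer_prob Pr A < e%:E)%E ->
  exists B, [/\ measurable B, A `<=` B & (Pr B < e%:E)%E].
Proof. by move=> /ereal_inf_lt[_ [B [mB AB] <-] PB]; exists B. Qed.

Lemma outer_probU A B :
  (outer_prob Pr (A `|` B) <= outer_prob Pr A + outer_prob Pr B)%E.
Proof.
apply/lee_addgt0Pr => e e0.
have fin (D : set Omega) : outer_prob Pr D \is a fin_num.
  rewrite ge0_fin_numE ?outer_prob_ge0// (@le_lt_trans _ _ 1%E) ?ltry//.
  by rewrite -(probability_setT Pr); exact: outer_prob_le.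
have e2 : 0 < e / 2 by rewrite divr_gt0.
have aux (D : set Omega) : exists B, [/\ measurable B, D `<=` B &
    (Pr B <= outer_prob Pr D + (e / 2)%:E)%E].
  have /outer_prob_lt[B' [mB' DB' h]] :
      (outer_prob Pr D < (fine (outer_prob Pr D) + e / 2)%:E)%E.
    by rewrite EFinD fineK// lteDl.
  by exists B'; split => //; rewrite (le_trans (ltW h))// EFinD fineK.
have [A' [mA AA' hA]] := aux A; have [B' [mB BB' hB]] := aux B.
apply: (@le_trans _ _ (Pr (A' `|` B'))).
  by apply: outer_prob_le; [exact: measurableU|exact: setUSS].
apply: (le_trans (measureU2 _ mA mB)).
apply: (le_trans (leeD hA hB)).
by rewrite addeACA -EFinD -splitr.
Qed.

Definition vanishing C := (fun n => outer_prob Pr (C n)) @ \oo --> 0%E.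

Lemma vanishingP C : vanishing C <->
  forall e : R, 0 < e -> \forall n \near \oo, (outer_prob Pr (C n) < e%:E)%E.
Proof.
split.
  move=> /fine_cvgP[fC cC] e e0.
  move/cvgrPdist_lt : cC => /(_ _ e0) cC.
  near=> n.
  have fn : outer_prob Pr (C n) \is a fin_num by near: n.
  rewrite -(fineK fn) lte_fin.
  have : `|0 - fine (outer_prob Pr (C n))| < e by near: n.
  by rewrite sub0r normrN ger0_norm// fine_ge0// outer_prob_ge0.
move=> H; apply/fine_cvgP; split.
  near=> n; rewrite ge0_fin_numE ?outer_prob_ge0//.
  by rewrite (@lt_trans _ _ 1%:E) ?ltry//; near: n; exact: H.
apply/cvgrPdist_lt => e e0; near=> n.
rewrite sub0r normrN ger0_norm; last by rewrite fine_ge0// outer_prob_ge0.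
have h : (outer_prob Pr (C n) < e%:E)%E by near: n; exact: H.
rewrite -lte_fin fineK// ge0_fin_numE ?outer_prob_ge0//.
by rewrite (lt_trans h)// ltry.
Unshelve. all: by end_near. Qed.

Lemma vanishingS C D : (\forall n \near \oo, C n `<=` D n) ->
  vanishing D -> vanishing C.
Proof.
move=> CD /vanishingP vD; apply/vanishingP => e e0; near=> n.
apply: (@le_lt_trans _ _ (outer_prob Pr (D n))).
  by apply: outer_probS; near: n.
by near: n; exact: vD.
Unshelve. all: by end_near. Qed.

Lemma vanishingU C D : vanishing C -> vanishing D ->
  vanishing (fun n => C n `|` D n).
Proof.
move=> /vanishingP vC /vanishingP vD; apply/vanishingP => e e0.
have e2 : 0 < e / 2 by rewrite divr_gt0.
near=> n; apply: (le_lt_trans (outer_probU _ _)).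
rewrite (splitr e) EFinD; apply: lteD; near: n; [exact: vC|exact: vD].
Unshelve. all: by end_near. Qed.

Lemma vanishing0 : vanishing (fun=> set0).
Proof.
apply/vanishingP => e e0; near=> n.
by rewrite (le_lt_trans (outer_prob_le measurable0 _))// measure0 lte_fin.
Unshelve. all: by end_near. Qed.

Lemma vanishing_bigU (I : eqType) (s : seq I) (C : I -> nat -> set Omega) :
  (forall i, vanishing (C i)) ->
  vanishing (fun n => [set w | exists2 i, i \in s & C i n w]).
Proof.
move=> vC; elim: s => [|i s IH].
  by apply: vanishingS vanishing0; near=> n => w [].
apply: (vanishingS _ (vanishingU (vC i) IH)); near=> n.
move=> w [j]; rewrite inE => /predU1P[-> Cj|js Cj]; first by left.
by right; exists j.
Unshelve. all: by end_near. Qed.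

Lemma vanishing_markov C (f : nat -> Omega -> R) (c : R) (u : nat -> R) :
  0 < c ->
  (\forall n \near \oo, [/\ bmf (f n), (forall w, 0 <= f n w),
     C n `<=` [set w | c <= f n w] & rint Pr (f n) <= u n]) ->
  u @ \oo --> (0 : R) -> vanishing C.
Proof.
move=> c0 H u0; apply/vanishingP => e e0.
have ec : 0 < e * c by rewrite mulr_gt0.
move/cvgrPdist_lt : u0 => /(_ _ ec) u0; near=> n.
have [bf f0 Cf fu] : [/\ bmf (f n), (forall w, 0 <= f n w),
     C n `<=` [set w | c <= f n w] & rint Pr (f n) <= u n] by near: n.
have mf := bmf_measurable_ge c bf.
apply: (le_lt_trans (outer_prob_le mf Cf)).
apply: (le_lt_trans (markov_rint Pr c0 bf f0)).
rewrite lte_fin ltr_pdivrMr//; apply: (le_lt_trans fu).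
have : `|0 - u n| < e * c by near: n.
by rewrite sub0r normrN; apply: le_lt_trans; exact: ler_norm.
Unshelve. all: by end_near. Qed.

End OuterProbability.

(** * Borel measurability and independence *)

Section BorelMeasurability.
Context {d : measure_display} {T : measurableType d} {R : realType}.

(** By density of the countable family c, an open set is the union of those balls of radius 1/(k+1)
    around some [c i] that it contains, and this union is countable. *)
Lemma preimage_open_measurable (E : pseudoMetricType R) (I : countType)
    (c : I -> E) (h : T -> E) (U : set E) :
  (forall x (e : R), 0 < e -> exists i, ball x e (c i)) ->
  (forall i (e : R), measurable (h @^-1` ball (c i) e)) ->
  open U -> measurable (h @^-1` U).
Proof.
move=> dc mh oU.
pose D : set (I * nat) := [set ik | ball (c ik.1) (ik.2.+1%:R^-1) `<=` U].
have -> : h @^-1` U = \bigcup_(ik in D) (h @^-1` ball (c ik.1) (ik.2.+1%:R^-1)).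
  apply/seteqP; split => [w /= Uw|w [[i k]] /= Dik]; last exact: Dik.
  have /nbhs_ballP[e /= e0 eU] : nbhs (h w) U by exact: open_nbhs_nbhs.
  have [k ke] : exists k : nat, k.+1%:R^-1 < e / 2.
    have e2 : 0 < e / 2 by rewrite divr_gt0.
    have := near_infty_natSinv_lt (PosNum e2).
    by case=> k _ /(_ k (leqnn k)) /= ?; exists k.
  have k0 : 0 < k.+1%:R^-1 :> R by rewrite invr_gt0.
  have [i hi] := dc (h w) _ k0.
  exists (i, k) => /=; last exact: ball_sym.
  move=> y /= ciy; apply: eU; rewrite (splitr e).
  by apply: (@ball_triangle _ _ (c i)); apply: le_ball (ltW ke) _ _.
rewrite bigcup_mkcond; apply: countable_bigcupT_measurable.
  exact: countableP.
by move=> [i k]; case: ifP => // _; exact: mh.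
Qed.

Lemma measurable_fun_borelT (E : ptopologicalType) (h : T -> E) :
  (forall U, open U -> measurable (h @^-1` U)) ->
  measurable_fun setT (h : T -> borelT E).
Proof.
move=> mh; apply: (@measurability _ _ T (borelT E) setT h (@open E)) => //.
by move=> _ [U oU <-]; rewrite setTI; exact: mh.
Qed.

(** Rational matrices are dense, and a ball around one of them is a finite intersection of
    conditions on single entries. *)
Lemma measurable_fun_mx m n (h : T -> 'M[R]_(m, n)) :
  (forall i j, measurable_fun setT (fun w => h w i j)) ->
  measurable_fun setT (h : T -> borelT 'M[R]_(m, n)).
Proof.
move=> mh; apply: measurable_fun_borelT => U.
apply: (@preimage_open_measurable 'M[R]_(m, n) 'M[rat]_(m, n) (fun A => map_mx ratr A)).
  move=> x e e0.
  have ex i j : exists r : rat, `|x i j - ratr r| < e.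
    have [|y [/= yb [r _ ry]]] :=
        @dense_rat R (ball (x i j) e) _ (ball_open _ _).
      by exists (x i j); exact: ballxx.
    by exists r; rewrite ry.
  have /choice[f fP] i : exists f : 'I_n -> rat, forall j, `|x i j - ratr (f j)| < e.
    by have /choice[f] := ex i; exists f.
  by exists (\matrix_(i, j) f i j); split => // i j; rewrite !mxE; exact: fP.
move=> A e.
have [e0|e0] := ltP 0 e; last first.
  rewrite [X in measurable X](_ : _ = set0)//.
  by rewrite -subset0 => w [+ _]; rewrite ltNge e0.
rewrite [X in measurable X](_ : _ =
    \bigcap_(k in [set: 'I_m * 'I_n]) [set w | `|ratr (A k.1 k.2) - h w k.1 k.2| < e]); last first.
  apply/seteqP; split => [w [_ H] [i j] _ /=|w H].
    by have := H i j; rewrite mxE.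
  by split => // i j; rewrite mxE; exact: (H (i, j)).
apply: fin_bigcap_measurable; first exact: finite_finset.
move=> [i j] _ /=; rewrite -[X in measurable X]setTI.
have -> : [set w | `|ratr (A i j) - h w i j| < e] =
    (fun w => h w i j) @^-1` (ball (ratr (A i j) : R) e) by [].
by apply: mh => //; apply: open_measurable; by apply: ball_open.
Qed.

End BorelMeasurability.

Lemma continuous_borel_measurable (R : realType) (E : ptopologicalType) (f : E -> R) :
  continuous f -> measurable_fun setT (f : borelT E -> R).
Proof.
move=> /continuousP cf.
apply: (@measurability _ _ (borelT E) _ setT f _ (RGenOpens.measurableE R)).
move=> _ [_ [a [b ->]] <-]; rewrite setTI; apply: sub_sigma_algebra.
by apply: cf; exact: interval_open.
Qed.

Lemma measurable_coord (R : realType) m n (i : 'I_m) (j : 'I_n) :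
  measurable_fun setT (fun x : borelT 'M[R]_(m, n) => x i j).
Proof.
by apply: (@continuous_borel_measurable R 'M[R]_(m, n)); exact: coord_continuous.
Qed.

Section LawProbability.
Context {d : measure_display} {T : measurableType d} {d' : measure_display}
  {T' : measurableType d'} {R : realType}.
Variables (P : probability T R) (Y : T -> T') (mY : measurable_fun setT Y).

Let Y' : {mfun T >-> T'} := HB.pack Y (isMeasurableFun.Build _ _ _ _ _ mY).

Definition law_prob : probability T' R := distribution P Y'.

Lemma law_probE A : law_prob A = P (Y @^-1` A).
Proof. by []. Qed.

Lemma rint_law_prob f : bmf f -> rint law_prob f = rint P (fun x => f (Y x)).
Proof. by move=> bf; exact: rint_pushforward. Qed.

End LawProbability.

Section Sections.
Context {d1 d2 : measure_display} {T1 : measurableType d1} {T2 : measurableType d2}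
  {R : realType}.
Variables (P1 : probability T1 R) (P2 : probability T2 R).
Variables (F : T1 * T2 -> R) (bF : bmf F).

Lemma bmf_section x : bmf (fun y => F (x, y)).
Proof.
have [M FM] := bF.2; split; last by exists M.
by apply: measurableT_comp bF.1 _; exact: measurable_pair1.
Qed.

Lemma prod_integrable : (P1 \x P2)%E.-integrable setT (EFin \o F).
Proof.
apply: measurable_bounded_integrable => //; last 2 first.
- exact: bF.1.
- have [M FM] := bF.2; exists M; split; first exact: num_real.
  by move=> N MN x _ /=; rewrite (le_trans (FM _))// ltW.
apply: (@le_lt_trans _ _ (P1 setT * P2 setT)%E).
  by rewrite -product_measure1E// setXTT.
rewrite [X in (X * _)%E](probability_setT P1).
by rewrite [X in (_ * X)%E](probability_setT P2) mule1 ltry.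
Qed.

Lemma bmf_rint_section : bmf (fun x => rint P2 (fun y => F (x, y))).
Proof.
split; last first.
  have [M FM] := bF.2; exists M => x.
  by apply: rint_norm_le => //; exact: bmf_section.
apply/measurable_EFinP; rewrite (_ : EFin \o _ = fubini_F P2 (EFin \o F)).
  exact: (measurable_fubini_F prod_integrable).
by apply/funext => x /=; rewrite -integral_bmf//; exact: bmf_section.
Qed.

End Sections.

(** Independence identifies the joint law with the product of the marginals, since a measure is
    determined by its values on rectangles; Fubini's theorem then gives the iterated integral. *)
Lemma rint_indep d (Omega : measurableType d) d1 (T1 : measurableType d1)
    d2 (T2 : measurableType d2) (R : realType) (Pr : probability Omega R)
    (Y1 : Omega -> T1) (Y2 : Omega -> T2) (F : T1 * T2 -> R) :
  measurable_fun setT Y1 -> measurable_fun setT Y2 ->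
  (forall A B, measurable A -> measurable B ->
    Pr (Y1 @^-1` A `&` Y2 @^-1` B) = (Pr (Y1 @^-1` A) * Pr (Y2 @^-1` B))%E) ->
  bmf F ->
  rint Pr (fun w => F (Y1 w, Y2 w)) =
  rint Pr (fun w => rint Pr (fun w' => F (Y1 w, Y2 w'))).
Proof.
move=> m1 m2 ind bF.
have m12 := measurable_fun_pair m1 m2.
pose P1 := law_prob Pr m1; pose P2 := law_prob Pr m2; pose P12 := law_prob Pr m12.
have -> : rint Pr (fun w => F (Y1 w, Y2 w)) = rint P12 F.
  exact: esym (rint_law_prob Pr m12 bF).
have E1 : (\int[P12]_z (F z)%:E = \int[P1 \x P2]_z (F z)%:E)%E.
  apply: eq_measure_integral => A mA _.
  by rewrite /= -(@product_measure_unique _ _ _ _ _ P1 P2 P12).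
have iF := prod_integrable P1 P2 bF.
rewrite /rint E1 -(integral12_prod_meas1 iF).
have FE w : fubini_F P2 (EFin \o F) w = (rint P2 (fun w' => F (w, w')))%:E.
  by rewrite -integral_bmf//; exact: (bmf_section bF).
have bG := bmf_rint_section P1 P2 bF.
under eq_integral do rewrite FE.
rewrite -/(rint _ _) rint_law_prob//; congr (rint Pr); apply/funext => w.
by rewrite rint_law_prob//; exact: (bmf_section bF).
Qed.

(** * Independence of disjoint blocks of the sample *)

Section Independence.
Context {d : measure_display} {Omega : measurableType d} {R : realType} {q : nat}.
Variables (Pr : probability Omega R) (X : nat -> Omega -> 'rV[R]_q).
Hypothesis iidX : iid Pr X.

(** A pi-system generating the sigma-algebra of the X i with i in I. The bound n makes every member
    a finite intersection, to which the product formula of [iid] applies. *)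
Definition cyl (I : set nat) : set (set Omega) :=
  [set A | exists (n : nat) (B : nat -> set (Vb R q)),
    [/\ forall i, measurable (B i), forall i, ~ I i -> B i = setT,
        forall i, (n <= i)%N -> B i = setT & A = \bigcap_i (X i @^-1` B i)]].

(* Being measurable on [past I] means depending on the X i with i in I only. *)
Definition past (I : set nat) := g_sigma_algebraType (cyl I).

Lemma prob_cyl (n : nat) (B : nat -> set (Vb R q)) :
  (forall i, measurable (B i)) -> (forall i, (n <= i)%N -> B i = setT) ->
  Pr (\bigcap_i (X i @^-1` B i)) = (\prod_(i <- iota 0 n) Pr (X 0%N @^-1` B i))%E.
Proof.
move=> mB Bn; rewrite -(iidX.2 _ _ (iota_uniq 0 n) mB); congr (Pr _).
apply/seteqP; split => [w H i _|w H i _]; first exact: H.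
have [ni|ni] := leqP n i; first by rewrite /= Bn.
by apply: H; rewrite /= mem_iota/= add0n.
Qed.

Lemma measurable_cyl I : cyl I `<=` measurable.
Proof.
move=> _ [n [B [mB _ _ ->]]]; apply: bigcap_measurable => [|i _].
  by exists 0%N.
by rewrite -[X in measurable X]setTI; exact: iidX.1.
Qed.

Lemma cyl_setI_closed I : setI_closed (cyl I).
Proof.
move=> _ _ [n [B [mB BI Bn ->]]] [m [C [mC CI Cm ->]]].
exists (maxn n m), (fun i => B i `&` C i); split.
- by move=> i; exact: measurableI.
- by move=> i Ii; rewrite BI// CI// setIT.
- by move=> i; rewrite geq_max => /andP[? ?]; rewrite Bn// Cm// setIT.
- apply/seteqP; split => [w [H1 H2] i _|w H]; first by split; [exact: H1|exact: H2].
  by split => i _; have [] := H i Logic.I.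
Qed.

Lemma cyl_setT I : cyl I setT.
Proof.
exists 0%N, (fun=> setT); split => //.
by apply/seteqP; split.
Qed.

Lemma indep_cyl (I J : set nat) A B : (forall i, I i -> J i -> False) ->
  cyl I A -> cyl J B -> Pr (A `&` B) = (Pr A * Pr B)%E.
Proof.
move=> IJ [n [B1 [mB1 B1I B1n ->]]] [m [B2 [mB2 B2I B2m ->]]].
have -> : (\bigcap_i X i @^-1` B1 i) `&` (\bigcap_i X i @^-1` B2 i) =
    \bigcap_i X i @^-1` (B1 i `&` B2 i).
  apply/seteqP; split => [w [H1 H2] i _|w H]; first by split; [exact: H1|exact: H2].
  by split => i _; have [] := H i Logic.I.
rewrite (@prob_cyl (maxn n m)); last 2 first.
- by move=> i; exact: measurableI.
- by move=> i; rewrite geq_max => /andP[? ?]; rewrite B1n// B2m// setIT.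
rewrite (@prob_cyl (maxn n m) B1)//; last first.
  by move=> i; rewrite geq_max => /andP[? ?]; rewrite B1n.
rewrite (@prob_cyl (maxn n m) B2)//; last first.
  by move=> i; rewrite geq_max => /andP[? ?]; rewrite B2m.
rewrite -big_split/=; apply: eq_bigr => i _.
have [Ii|Ii] := pselect (I i).
  rewrite (B2I i) ?setIT ?preimage_setT; last by move=> /(IJ i Ii).
  by rewrite [X in (_ * X)%E](probability_setT Pr) mule1.
by rewrite B1I// setTI preimage_setT [X in (X * _)%E](probability_setT Pr) mul1e.
Qed.

Lemma indep_past (I J : set nat) A B : (forall i, I i -> J i -> False) ->
  measurable (A : set (past I)) -> measurable (B : set (past J)) ->
  Pr (A `&` B) = (Pr A * Pr B)%E.
Proof.
move=> IJ.
(* Independence passes from cylinders to the generated sigma-algebras one argument at a time: for a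
   fixed event C, the finite measures sending D to the probability of its intersection with C and to
   [Pr C * Pr D] agree on a pi-system. *)
have step (K L : set nat) (C D : set Omega) : measurable C ->
    (forall D', cyl L D' -> Pr (D' `&` C) = (Pr C * Pr D')%E) ->
    measurable (D : set (past L)) -> Pr (D `&` C) = (Pr C * Pr D)%E.
  move=> mC H mD.
  have C0 : 0 <= fine (Pr C) by rewrite fine_ge0.
  rewrite -(fineK (fin_num_measure Pr C mC)).
  apply: (@g_sigma_algebra_measure_unique _ R _ (cyl L) _ (fun=> setT) _ _
     (mrestr Pr mC) (mscale (NngNum C0) Pr)) => //.
  - exact: measurable_cyl.
  - by move=> _; exact: cyl_setT.
  - by apply/seteqP; split => // x _; exists 0%N.
  - exact: cyl_setI_closed.
  - move=> E cE; transitivity (Pr C * Pr E)%E; first exact: H.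
    by rewrite -{1}(fineK (fin_num_measure Pr C mC)).
  - move=> _; apply: (@le_lt_trans _ _ 1%E); last exact: ltry.
    by apply: probability_le1; exact: measurableI.
move=> mA mB.
have sub K : <<s cyl K >> `<=` measurable.
  by apply: smallest_sub; [exact: sigma_algebra_measurable|exact: measurable_cyl].
rewrite muleC; apply: (step J I) => //; first exact: (sub J).
move=> A' cA'; rewrite setIC muleC; apply: (step I J) => //.
  exact: measurable_cyl cA'.
by move=> B' cB'; rewrite setIC (indep_cyl IJ)//.
Qed.

Lemma measurable_past_id I : measurable_fun setT (idfun : Omega -> past I).
Proof.
apply: (@measurability _ _ Omega (past I) setT idfun (cyl I)) => //.
by move=> _ [A cA <-]; rewrite setTI; exact: measurable_cyl cA.
Qed.

Lemma measurable_past I i : I i ->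
  measurable_fun setT (X i : past I -> Vb R q).
Proof.
move=> Ii _ B mB; rewrite setTI; apply: sub_sigma_algebra.
exists i.+1, (fun j => if j == i then B else setT); split.
- by move=> j; case: eqP.
- by move=> j Ij; case: eqP => // ji; rewrite ji in Ij.
- by move=> j; case: eqP => // ->; rewrite ltnn.
- apply/seteqP; split => [w Bw j _ /=|w /(_ i Logic.I)/=]; last by rewrite eqxx.
  by case: eqP => // ->.
Qed.

(** The substitute for conditioning on the block I: two parts of a function that depend on disjoint
    blocks may be evaluated at independent sample points w and w'. *)
Lemma decouple (I J : set nat) (F : past I * past J -> R) :
  (forall i, I i -> J i -> False) -> bmf F ->
  rint Pr (fun w => F (w, w)) = rint Pr (fun w => rint Pr (fun w' => F (w, w'))).
Proof.
move=> IJ bF.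
have mI := @measurable_past_id I; have mJ := @measurable_past_id J.
by apply: (rint_indep mI mJ _ bF) => A B; exact: indep_past.
Qed.

Lemma rint_ident (f : Vb R q -> R) i : bmf f ->
  rint Pr (fun w => f (X i w)) = rint Pr (fun w => f (X 0%N w)).
Proof.
move=> bf; rewrite -(rint_law_prob Pr (iidX.1 i))// -(rint_law_prob Pr (iidX.1 0%N))//.
rewrite /rint; congr fine; apply: eq_measure_integral => A mA _.
have := iidX.2 [:: i] (fun=> A) isT (fun=> mA); rewrite big_seq1 => iA.
change (Pr (X i @^-1` A) = Pr (X 0%N @^-1` A)).
rewrite -[RHS]iA; congr (Pr _); apply/seteqP; split => [w Aw j /=|w H].
  by rewrite inE => /eqP ->.
by apply: (H i); rewrite /= inE.
Qed.

End Independence.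

(** * Trigonometric estimates and Gaussian moments *)

Section TrigBounds.
Context {R : realType}.
Implicit Types x y h : R.

(** M may depend on x. This makes the lemma a ladder: bounding the derivative by one Taylor estimate
    gives the next estimate with its order raised by one. *)
Lemma mvt_norm (f df : R -> R) (M : R) x :
  (forall y, is_derive y 1 f (df y)) -> f 0 = 0 ->
  (forall y, `|y| <= `|x| -> `|df y| <= M) -> `|f x| <= M * `|x|.
Proof.
move=> Df f0 dfM.
have cf : continuous f by move=> y; apply/differentiable_continuous/derivable1_diffP.
have [x0|x0] := leP 0 x.
  have [|c] := @MVT_segment _ f df _ _ x0 => //.
    exact: continuous_subspaceT.
  rewrite in_itv/= => /andP[c0 cx]; rewrite f0 !subr0 => ->.
  by rewrite normrM ler_wpM2r// dfM// !ger0_norm// (le_trans c0).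
have [|c] := @MVT_segment _ f df _ _ (ltW x0) => //.
  exact: continuous_subspaceT.
rewrite in_itv/= => /andP[cx c0]; rewrite f0 !sub0r => fx.
rewrite -normrN fx normrM normrN ler_wpM2r// dfM// !ler0_norm ?lerN2//.
by rewrite ltW.
Qed.

Lemma norm_sin_le x : `|sin x| <= `|x|.
Proof.
rewrite -[leRHS]mul1r; apply: (@mvt_norm sin cos); rewrite ?sin0//.
by move=> y _; exact: cos_max.
Qed.

Lemma cos_lip x y : `|cos x - cos y| <= `|x - y|.
Proof.
rewrite -[leRHS]mul1r.
have := @mvt_norm (fun z => cos (y + z) - cos y) (fun z => - sin (y + z)) 1 (x - y).
rewrite subrKC; apply.
- move=> z; have -> : (fun z => cos (y + z) - cos y) =
    (cos \o ((cst y : R -> R) + id)) - cst (cos y) by [].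
  by apply: is_derive_eq; rewrite /= add0r mulr1 subr0.
- by rewrite addr0 subrr.
- by move=> z _; rewrite normrN sin_max.
Qed.

Lemma norm_1Bcos_le x : `|1 - cos x| <= `|x|.
Proof. by have := cos_lip 0 x; rewrite cos0 sub0r normrN. Qed.

Lemma norm_1Bcos_le2 x : `|1 - cos x| <= x ^+ 2.
Proof.
have -> : 1 - cos x = 2 * sin (x / 2) ^+ 2.
  rewrite {1}(_ : x = (x / 2) *+ 2); last by rewrite -mulr_natr divfK.
  by rewrite cos_mulr2n cos2sin2; ring.
rewrite ger0_norm; last by rewrite mulr_ge0 ?sqr_ge0.
have h : sin (x / 2) ^+ 2 <= (x / 2) ^+ 2.
  by rewrite -ler_sqrt ?sqr_ge0// !sqrtr_sqr norm_sin_le.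
by rewrite (le_trans (ler_wpM2l _ h))//; have := sqr_ge0 x; nra.
Qed.

Lemma norm_Bsin_le2 x : `|x - sin x| <= x ^+ 2.
Proof.
rewrite -(real_normK (num_real x)) expr2.
apply: (@mvt_norm (fun y => y - sin y) (fun y => 1 - cos y)).
- by rewrite sin0 subrr.
- by move=> y yx; rewrite (le_trans (norm_1Bcos_le _)).
Qed.

Lemma norm_Bsin_le3 x : `|x - sin x| <= `|x| ^+ 3.
Proof.
rewrite exprSr.
apply: (@mvt_norm (fun y => y - sin y) (fun y => 1 - cos y)).
- by rewrite sin0 subrr.
- move=> y yx; rewrite (le_trans (norm_1Bcos_le2 _))//.
  by rewrite -(real_normK (num_real y)) ler_pXn2r ?nnegrE.
Qed.

Lemma cos_taylor2 x h : `|cos (x + h) - cos x + h * sin x| <= 2 * h ^+ 2.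
Proof.
have -> : cos (x + h) - cos x + h * sin x =
    - (cos x * (1 - cos h)) + sin x * (h - sin h) by rewrite cosD; ring.
rewrite (le_trans (ler_normD _ _))// normrN !normrM.
have := norm_1Bcos_le2 h; have := norm_Bsin_le2 h.
have := cos_max x; have := sin_max x.
have := normr_ge0 (cos x); have := normr_ge0 (sin x).
have := normr_ge0 (1 - cos h); have := normr_ge0 (h - sin h).
nra.
Qed.

(** Caratheodory's criterion: the difference quotient, completed by a at x, is continuous there. A
    quadratic bound survives integration, so this form allows differentiation under the integral
    sign. *)
Lemma is_derive_quadratic (f : R -> R) x (a C : R) :
  (forall h, `|f (x + h) - f x - h * a| <= C * h ^+ 2) -> is_derive x 1 f a.
Proof.
move=> H; apply/is_derive1_caratheodory.
exists (fun z => if z == x then a else (f z - f x) / (z - x)); split.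
- move=> z; case: eqP => [->|/eqP zx]; first by rewrite !subrr mulr0.
  by rewrite divfK// subr_eq0.
- have C0 : 0 <= C.
    by have := H 1; rewrite expr1n mulr1; apply: le_trans.
  apply/cvgrPdist_lt => e e0; rewrite eqxx; near=> z.
  have [_|zx] := eqVneq z x; first by rewrite subrr normr0.
  have zx0 : 0 < `|z - x| by rewrite normr_gt0 subr_eq0.
  have := H (z - x); rewrite subrKC => Hz.
  rewrite -(ltr_pM2r zx0) -normrM mulrBl divfK ?subr_eq0//.
  rewrite distrC (mulrC a) (le_lt_trans Hz)//.
  rewrite -(real_normK (num_real (z - x))) expr2 mulrA mulrC (mulrC e).
  rewrite ltr_pM2l// (@le_lt_trans _ _ ((C + 1) * `|z - x|))//.
    by rewrite ler_wpM2r// lerDl.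
  rewrite mulrC -ltr_pdivlMr ?ltr_wpDl// distrC.
  near: z; apply/nbhs_ballP; exists (e / (C + 1)) => //=.
  by rewrite divr_gt0// ltr_wpDl.
- by rewrite eqxx.
Unshelve. all: by end_near. Qed.

Lemma norm_cos_le3 x : `|cos x - 1 + x ^+ 2 / 2| <= `|x| ^+ 3.
Proof.
rewrite [leRHS]exprSr.
apply: (@mvt_norm (fun y => cos y - 1 + y ^+ 2 / 2) (fun y => y - sin y)).
- move=> y; apply: (@is_derive_quadratic _ _ _ 3) => h.
  rewrite (_ : _ - _ - _ = (cos (y + h) - cos y + h * sin y) + h ^+ 2 / 2); last by field.
  rewrite (le_trans (ler_normD _ _))// (ger0_norm (_ : 0 <= h ^+ 2 / 2)).
    by have := cos_taylor2 y h; have := sqr_ge0 h; lra.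
  by rewrite divr_ge0 ?sqr_ge0.
- by rewrite cos0 subrr expr0n/= mul0r addr0.
- move=> y yx; rewrite (le_trans (norm_Bsin_le2 _))//.
  by rewrite -(real_normK (num_real y)) ler_pXn2r ?nnegrE.
Qed.

Lemma cos_taylor3 x h :
  `|cos (x + h) - cos x + h * sin x + h ^+ 2 / 2 * cos x| <= 2 * `|h| ^+ 3.
Proof.
have -> : cos (x + h) - cos x + h * sin x + h ^+ 2 / 2 * cos x =
    cos x * (cos h - 1 + h ^+ 2 / 2) + sin x * (h - sin h) by rewrite cosD; ring.
rewrite (le_trans (ler_normD _ _))// !normrM.
have := norm_cos_le3 h; have := norm_Bsin_le3 h.
have := cos_max x; have := sin_max x.
have := normr_ge0 (cos x); have := normr_ge0 (sin x).
have := normr_ge0 (cos h - 1 + h ^+ 2 / 2); have := normr_ge0 (h - sin h).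
nra.
Qed.

End TrigBounds.

Lemma cvg_divn0 (R : realType) (C : R) : C / n%:R @[n --> \oo] --> (0 : R).
Proof.
apply/cvgrPdist_lt => e e0; near=> n.
have n0 : 0 < n%:R :> R by rewrite ltr0n; near: n; exact: nbhs_infty_gt.
rewrite sub0r normrN normrM normfV (ger0_norm (ltW n0)) ltr_pdivrMr// mulrC.
by rewrite -ltr_pdivrMr//; near: n; exact: nbhs_infty_gtr.
Unshelve. all: by end_near. Qed.

Section LinearCombination.
Context d (T : measurableType d) (R : realType) (mu : {measure set T -> \bar R}).
Variables (f g : T -> R) (a b : R).
Hypotheses (intf : mu.-integrable setT (EFin \o f))
  (intg : mu.-integrable setT (EFin \o g)).

Lemma integrable_lincomb :
  mu.-integrable setT (EFin \o (fun x => a * f x + b * g x)).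
Proof.
rewrite (_ : EFin \o _ = ((fun x => a%:E * (EFin \o f) x) \+
   (fun x => b%:E * (EFin \o g) x))%E).
  by apply: integrableD => //; exact: integrableZl.
by apply/funext.
Qed.

Lemma rint_lincomb :
  rint mu (fun x => a * f x + b * g x) = a * rint mu f + b * rint mu g.
Proof.
rewrite [LHS]RintegralD//; first by rewrite !RintegralZl.
- exact: (integrableZl measurableT a intf).
- exact: (integrableZl measurableT b intg).
Qed.

End LinearCombination.

(** * Second moment and characteristic function of the normal law *)

Section NormalMoments.
Context {R : realType}.
Local Notation mu := (@lebesgue_measure R).
Implicit Types x : R.

(** The fundamental theorem of calculus on [-n, n], with dominated convergence for the truncated
    integrals; it serves as integration by parts on the whole line. *)
Lemma integral_derive0 (F f : R -> R) :
  (forall x, is_derive x 1 F (f x)) -> continuous f ->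
  mu.-integrable setT (EFin \o f) ->
  F n%:R @[n --> \oo] --> (0 : R) -> F (- n%:R) @[n --> \oo] --> (0 : R) ->
  (\int[mu]_x (f x)%:E = 0)%E.
Proof.
move=> DF cf intf Fp Fm.
have cF : continuous F.
  by move=> y; apply/differentiable_continuous/derivable1_diffP.
pose I n : set R := `[- n%:R, n%:R]%classic.
pose f_ n := (EFin \o f) \_ (I n).
have mf : measurable_fun setT (EFin \o f) by exact: measurable_int intf.
have mI n : measurable (I n) by exact: measurable_itv.
have [_ _ cvf] : [/\ mu.-integrable setT (EFin \o f),
    [sequence (\int[mu]_x (fun n x => `|f_ n x - (EFin \o f) x|) n x)%E]_n
      @ \oo --> 0%E &
    [sequence (\int[mu]_x f_ n x)%E]_n @ \oo --> (\int[mu]_x (EFin \o f) x)%E].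
  apply: (@dominated_convergence _ _ _ mu setT measurableT f_ _
      (fun x => `|(EFin \o f) x|%E)) => //.
  - move=> n; apply/(measurable_restrictT _ (mI n)).
    exact: measurable_funTS.
  - apply: aeW => x _; apply: cvg_near_cst.
    near=> n; have xI : I n x.
      by rewrite /I/= in_itv/= -ler_norml; near: n; exact: nbhs_infty_ger.
    by rewrite /f_ patchE mem_set.
  - exact: integrable_abse.
  - apply: aeW => x n _; rewrite /f_ patchE; case: ifP => // _.
    by rewrite abse0.
have {}cvf : (\int[mu]_x f_ n x)%E @[n --> \oo] --> (\int[mu]_x (f x)%:E)%E by [].
apply: (cvg_unique _ cvf) => //.
have Fn : (F n%:R - F (- n%:R))%:E @[n --> \oo] --> (0 : R)%:E.
  by apply: cvg_EFin; [exact: nearW|rewrite -[0](subr0 0); exact: cvgB].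
apply: cvg_trans Fn; apply: near_eq_cvg; near=> n.
have n0 : (0 < n)%N by near: n; exact: nbhs_infty_gt.
rewrite /f_ -integral_mkcond (@continuous_FTC2 _ f F)//.
- by rewrite ltrNl (@le_lt_trans _ _ 0) ?ltr0n// oppr_le0.
- exact: continuous_subspaceT.
- split => [x _|| ]; first by [].
    by apply: cvg_at_right_filter; exact: cF.
  by apply: cvg_at_left_filter; exact: cF.
- by move=> x _; rewrite derive1E derive_val.
Unshelve. all: by end_near. Qed.

Variable s : R.
Hypothesis s0 : s != 0.
Local Notation p := (normal_pdf 0 s).
Local Notation nu := (normal_prob 0 s).

Let ppos : 0 < s ^+ 2 *+ 2.
Proof. by rewrite pmulrn_lgt0// exprn_even_gt0. Qed.

Lemma is_derive_normal_pdf x : is_derive x 1 p (- (x / s ^+ 2) * p x).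
Proof.
have -> : p = cst (normal_peak s) * (expR \o (cst (- (s ^+ 2 *+ 2)^-1) * id ^+ 2)).
  rewrite normal_pdfE//; apply/funext => y; rewrite /normal_fun !fctE subr0.
  by congr (_ * expR _); rewrite !mulNr mulrC.
apply: is_derive_eq; rewrite /GRing.scale/= !fctE.
have s20 : s ^+ 2 != 0 by rewrite sqrf_eq0.
by rewrite -mulr_natr; field.
Qed.

(** With y = x^2 / (2 s^2) this is y exp(-y) <= 1. Quadratic decay is enough for the boundary terms
    x p(x) to vanish at infinity. *)
Lemma normal_pdf_decay x : p x * x ^+ 2 <= normal_peak s * (s ^+ 2 *+ 2).
Proof.
rewrite normal_pdfE// -mulrA ler_wpM2l ?normal_peak_ge0//.
rewrite /normal_fun subr0; set y := x ^+ 2 / (s ^+ 2 *+ 2).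
have xy : x ^+ 2 = y * (s ^+ 2 *+ 2) by rewrite divfK// gt_eqF.
rewrite mulNr -/y xy mulrA ler_piMl ?(ltW ppos)//.
have y0 : 0 <= y by rewrite divr_ge0 ?sqr_ge0// ltW.
rewrite expRN mulrC ler_pdivrMr ?expR_gt0// mul1r.
by rewrite (le_trans _ (expR_ge1Dx _))// lerDr.
Qed.

Lemma normal_pdf_cvg0 (e : nat -> R) : (forall n, `|e n| = n%:R) ->
  e n * p (e n) @[n --> \oo] --> (0 : R).
Proof.
move=> en; pose C := normal_peak s * (s ^+ 2 *+ 2).
apply: norm_cvg0; apply: (squeeze_cvgr _ (cvg_cst 0) (cvg_divn0 C)).
near=> n; rewrite normr_ge0/=.
have n0 : 0 < n%:R :> R by rewrite ltr0n; near: n; exact: nbhs_infty_gt.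
rewrite ler_pdivlMr// normrM en (ger0_norm (normal_pdf_ge0 _ _ _)).
have := normal_pdf_decay (e n); rewrite -(real_normK (num_real _)) en.
by rewrite (_ : n%:R * p (e n) * n%:R = p (e n) * n%:R ^+ 2)//; ring.
Unshelve. all: by end_near. Qed.

Lemma ge0_integral_normal (f : R -> \bar R) : measurable_fun setT f ->
  (forall x, 0 <= f x)%E ->
  (\int[nu]_x f x = \int[mu]_x (f x * (p x)%:E))%E.
Proof.
move=> mf f0.
have dom : nu `<< mu by exact: normal_prob_dominates.
rewrite -(Radon_Nikodym_SigmaFinite.change_of_variables dom)//.
apply: ae_eq_integral => //.
- apply: emeasurable_funM => //.
  exact: measurable_int (Radon_Nikodym_SigmaFinite.f_integrable dom).
- apply: emeasurable_funM => //; apply/measurable_EFinP.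
  exact: measurable_normal_pdf.
- apply: ae_eqe_mul2l; apply: integral_ae_eq => //.
  + exact: Radon_Nikodym_SigmaFinite.f_integrable.
  + by apply/measurable_EFinP; exact: measurable_normal_pdf.
  + by move=> E _ mE; rewrite -Radon_Nikodym_SigmaFinite.f_integral.
Qed.

Lemma integrable_normalE (f : R -> R) : measurable_fun setT f ->
  nu.-integrable setT (EFin \o f) ->
  mu.-integrable setT (EFin \o (fun x => f x * p x)).
Proof.
move=> mf /integrableP[_ fi]; apply/integrableP; split.
  apply/measurable_EFinP; apply: measurable_funM => //.
  exact: measurable_normal_pdf.
move: fi; rewrite ge0_integral_normal//; last first.
  by apply: measurableT_comp => //; exact/measurable_EFinP.
congr (_ < _)%E; apply: eq_integral => x _ /=.
by rewrite normrM (ger0_norm (normal_pdf_ge0 _ _ _)) EFinM.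
Qed.

Lemma integral_normal (f : R -> R) : measurable_fun setT f ->
  nu.-integrable setT (EFin \o f) ->
  (\int[nu]_x (f x)%:E = \int[mu]_x (f x * p x)%:E)%E.
Proof.
move=> mf intf; rewrite [LHS]integralE [RHS]integralE.
rewrite !ge0_integral_normal//.
- congr (_ - _)%E; apply: eq_integral => x _.
    rewrite !funeposE -!EFin_max -EFinM maxr_pMl ?normal_pdf_ge0//.
    by rewrite mul0r.
  rewrite !funenegE -!EFinN -!EFin_max -EFinM maxr_pMl ?normal_pdf_ge0//.
  by rewrite mul0r mulNr.
- by apply: measurable_funeneg; exact/measurable_EFinP.
- by apply: measurable_funepos; exact/measurable_EFinP.
Qed.

Section SecondMoment.
(** Supplied in [cnormal_var] by the finite second moments of the Gaussian matrices. *)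
Hypothesis int2 : nu.-integrable setT (EFin \o (fun x : R => x ^+ 2)).

Let bounded_integrable (f : R -> R) : continuous f -> (exists M, forall x, `|f x| <= M) ->
  nu.-integrable setT (EFin \o f).
Proof.
move=> cf bf; apply: (@bmf_integrable _ _ _ nu); split => //.
exact: continuous_measurable_fun.
Qed.

Let integrable_xsin t : nu.-integrable setT (EFin \o (fun x : R => x * sin (t * x))).
Proof.
have cmt : continuous (fun x : R => sin (t * x)).
  by move=> x; apply: continuous_comp; [exact: mulrl_continuous|exact: continuous_sin].
apply: (@le_integrable _ _ _ nu setT measurableT _
   (EFin \o (fun x => 1 + x ^+ 2))).
- apply/measurable_EFinP; apply: measurable_funM => //.
  exact: continuous_measurable_fun.
- move=> x _ /=; rewrite lee_fin normrM (@ger0_norm _ (1 + _)) ?addr_ge0 ?sqr_ge0//.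
  rewrite (@le_trans _ _ `|x|)//; first by rewrite ler_piMr ?sin_max.
  by rewrite -(real_normK (num_real x)); have := sqr_ge0 (`|x| - 1); nra.
- rewrite (_ : EFin \o _ = (EFin \o cst 1) \+ (EFin \o (fun x => x ^+ 2)))//.
  apply: integrableD => //; apply: bounded_integrable; last by exists `|1|.
  by move=> x; exact: cvg_cst.
Qed.

(** The function x p(x) has derivative p(x) - x^2 p(x) / s^2, whose integral over the line is 0. *)
Lemma normal_second_moment : rint nu (fun x => x ^+ 2) = s ^+ 2.
Proof.
have s20 : s ^+ 2 != 0 by rewrite sqrf_eq0.
have i1 : mu.-integrable setT (EFin \o p) by exact: integrable_normal_pdf.
have i2 : mu.-integrable setT (EFin \o (fun x => x ^+ 2 * p x)).
  by apply: integrable_normalE => //; exact: measurable_funX.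
have cp : continuous p by exact: continuous_normal_pdf.
have D x : is_derive x 1 (fun x => x * p x)
    (1 * p x + - (s ^+ 2)^-1 * (x ^+ 2 * p x)).
  have -> : (fun x => x * p x) = id * p by [].
  have := is_derive_normal_pdf x => Dp.
  by apply: is_derive_eq; rewrite /GRing.scale/=; field.
have : rint mu (fun x => 1 * p x + - (s ^+ 2)^-1 * (x ^+ 2 * p x)) = 0.
  rewrite /rint (integral_derive0 D)//.
  - move=> x; apply: cvgD; apply: cvgM; try exact: cvg_cst; first exact: cp.
    by apply: cvgM; [exact: exprn_continuous|exact: cp].
  - exact: integrable_lincomb.
  - by apply: (@normal_pdf_cvg0 (fun n => n%:R)) => n; rewrite normr_nat.
  - by apply: (@normal_pdf_cvg0 (fun n => - n%:R)) => n; rewrite normrN normr_nat.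
rewrite rint_lincomb// {1}/rint integral_normal_pdf/= mulr1 mulNr => /eqP.
rewrite subr_eq0 => /eqP e.
rewrite {1}/rint integral_normal//.
by rewrite -/(rint mu (fun x => x ^+ 2 * p x)) -[RHS]mulr1 e mulVKf.
Qed.

(** Stein's identity, obtained by integrating the derivative of sin(t x) p(x). *)
Lemma normal_stein t : rint nu (fun x => x * sin (t * x)) =
  s ^+ 2 * t * rint nu (fun x => cos (t * x)).
Proof.
have s20 : s ^+ 2 != 0 by rewrite sqrf_eq0.
have ccos : continuous (fun x : R => cos (t * x)).
  by move=> x; apply: continuous_comp; [exact: mulrl_continuous|exact: continuous_cos].
have csin : continuous (fun x : R => sin (t * x)).
  by move=> x; apply: continuous_comp; [exact: mulrl_continuous|exact: continuous_sin].
have icos : nu.-integrable setT (EFin \o (fun x => cos (t * x))).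
  by apply: bounded_integrable => //; exists 1 => x; exact: cos_max.
have msin : measurable_fun setT (fun x => x * sin (t * x)).
  by apply: measurable_funM => //; exact: continuous_measurable_fun.
have mcos : measurable_fun setT (fun x => cos (t * x)).
  exact: continuous_measurable_fun.
have i1 := integrable_normalE msin (integrable_xsin t).
have i2 := integrable_normalE mcos icos.
have cp : continuous p by exact: continuous_normal_pdf.
have D x : is_derive x 1 (fun x => sin (t * x) * p x)
    (t * (cos (t * x) * p x) + - (s ^+ 2)^-1 * (x * sin (t * x) * p x)).
  have -> : (fun x => sin (t * x) * p x) = (sin \o (cst t * id)) * p by [].
  have := is_derive_normal_pdf x => Dp.
  by apply: is_derive_eq; rewrite /GRing.scale/=; field.
have bnd (e : nat -> R) : (forall n, `|e n| = n%:R) ->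
    sin (t * e n) * p (e n) @[n --> \oo] --> (0 : R).
  move=> en; apply: norm_cvg0.
  have := normal_pdf_cvg0 en => /cvg_norm; rewrite normr0 => h.
  apply: (squeeze_cvgr _ (cvg_cst 0) h); near=> n; rewrite normr_ge0/=.
  rewrite !normrM ler_wpM2r// en (le_trans (sin_max _))// ler1n.
  by near: n; exact: nbhs_infty_gt.
have : rint mu (fun x => t * (cos (t * x) * p x)
    + - (s ^+ 2)^-1 * (x * sin (t * x) * p x)) = 0.
  rewrite /rint (integral_derive0 D)//.
  - move=> x; apply: cvgD; apply: cvgM; try exact: cvg_cst.
      by apply: cvgM; [exact: ccos|exact: cp].
    by apply: cvgM; [apply: cvgM; [exact: cvg_id|exact: csin]|exact: cp].
  - exact: integrable_lincomb.
  - by apply: (bnd (fun n => n%:R)) => n; rewrite normr_nat.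
  - by apply: (bnd (fun n => - n%:R)) => n; rewrite normrN normr_nat.
rewrite rint_lincomb// mulNr => /eqP; rewrite subr_eq0 => /eqP e.
rewrite {1}/rint integral_normal// {1}/rint integral_normal//.
by rewrite -/(rint mu _) -/(rint mu _) -mulrA e mulVKf.
Unshelve. all: by end_near. Qed.

(** Differentiation under the integral and Stein's identity give phi'(t) = - s^2 t phi(t), so that
    phi(t) exp(s^2 t^2 / 2) is constant. *)
Lemma normal_cos t : rint nu (fun x => cos (t * x)) = expR (- (s ^+ 2 * t ^+ 2 / 2)).
Proof.
pose phi t := rint nu (fun x => cos (t * x)).
have bcos u : bmf (fun x : R => cos (u * x)).
  by apply: bmf_cos; exact: measurable_funM.
have Dphi (u : R) : is_derive u 1 phi (- (s ^+ 2 * u * phi u)).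
  apply: (@is_derive_quadratic _ _ _ _ (2 * s ^+ 2)) => h.
  rewrite -normal_stein mulrN opprK -normal_second_moment.
  have i1 := bmf_integrable nu (bcos (u + h)).
  have i2 := bmf_integrable nu (bcos u).
  have i3 := integrable_xsin u.
  have -> : phi (u + h) - phi u + h * rint nu (fun x => x * sin (u * x)) =
      rint nu (fun x => 1 * (1 * cos ((u + h) * x) + -1 * cos (u * x))
                        + h * (x * sin (u * x))).
    by rewrite rint_lincomb ?rint_lincomb ?integrable_lincomb// !mul1r mulN1r.
  have iT := integrable_lincomb 1 h (integrable_lincomb 1 (-1) i1 i2) i3.
  rewrite (le_trans (le_normr_Rintegral _ iT))//.
  rewrite mulrAC -RintegralZl//; apply: le_Rintegral => //.
  - exact: integrable_norm.
  - exact: (integrableZl measurableT _ int2).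
  - move=> x _; rewrite (_ : 1 * _ + _ = cos (u * x + h * x) - cos (u * x)
       + (h * x) * sin (u * x)); last by rewrite mulrDl; ring.
    by rewrite (le_trans (cos_taylor2 _ _))// exprMn mulrA.
have D0 (u : R) : is_derive u (1 : R) (phi * (expR \o (cst (s ^+ 2 / 2) * id ^+ 2))) 0.
  have := Dphi u => ?; apply: is_derive_eq; rewrite /GRing.scale/= !fctE.
  by field.
have := is_derive_0_is_cst t 0 D0; rewrite !fctE /= expr0n/= mulr0 expR0 mulr1.
rewrite {2}/phi; under [X in rint nu X]eq_fun do rewrite mul0r cos0.
rewrite rint_cst => e; rewrite -/(phi t) expRN.
rewrite -[LHS](mulfK (lt0r_neq0 (expR_gt0 (s ^+ 2 / 2 * t ^+ 2)))) e mul1r.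
by rewrite mulrAC.
Qed.

End SecondMoment.
End NormalMoments.

(** * Approximation by trigonometric polynomials *)

Section Bernstein.
Context {R : realType}.

Definition bernstein (m k : nat) (t : R) : R :=
  'C(m, k)%:R * (t ^+ k * (1 - t) ^+ (m - k)).

Lemma bernstein_ge0 m k t : 0 <= t <= 1 -> 0 <= bernstein m k t.
Proof.
by move=> /andP[t0 t1]; rewrite !mulr_ge0// exprn_ge0// subr_ge0.
Qed.

Lemma bernstein_sum m t : \sum_(k < m.+1) bernstein m k t = 1.
Proof.
rewrite -[RHS](expr1n _ m) -[X in X ^+ m](subrK t 1) exprDn.
by apply: eq_bigr => k _; rewrite /bernstein mulr_natl (mulrC (t ^+ k)).
Qed.

Lemma bernstein_mean m t : \sum_(k < m.+1) k%:R * bernstein m k t = m%:R * t.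
Proof.
case: m => [|m]; first by rewrite big_ord1 !mul0r.
rewrite big_ord_recl mul0r add0r -[RHS]mulr1 -[X in _ = _ * X](bernstein_sum m t).
rewrite mulr_sumr; apply: eq_bigr => k _; rewrite lift0 /bernstein subSS exprS.
rewrite mulrA -[_ * 'C(_, _)%:R]natrM -mul_bin_diag natrM; ring.
Qed.

(** Second factorial moment of the binomial law; with the mean it gives the variance t (1 - t) / m
    of k / m. *)
Lemma bernstein_fact2 m t :
  \sum_(k < m.+1) k%:R * (k%:R - 1) * bernstein m k t = m%:R * (m%:R - 1) * t ^+ 2.
Proof.
case: m => [|m]; first by rewrite big_ord1 !mul0r.
rewrite big_ord_recl !mul0r add0r.
rewrite (_ : m.+1%:R - 1 = m%:R); last by rewrite -natr1 addrK.
rewrite [RHS](_ : _ = m.+1%:R * t * (m%:R * t)); last by ring.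
rewrite -(bernstein_mean m t) mulr_sumr; apply: eq_bigr => k _.
rewrite lift0 /bernstein subSS exprS.
rewrite (_ : k.+1%:R - 1 = k%:R); last by rewrite -natr1 addrK.
rewrite (mulrAC k.+1%:R).
by rewrite (mulrA k.+1%:R) -[k.+1%:R * 'C(_, _)%:R]natrM -mul_bin_diag natrM; ring.
Qed.

Lemma bernstein_var m t : (0 < m)%N -> 0 <= t <= 1 ->
  \sum_(k < m.+1) (k%:R / m%:R - t) ^+ 2 * bernstein m k t <= m%:R^-1.
Proof.
move=> m0 /andP[t0 t1]; have mR : 0 < m%:R :> R by rewrite ltr0n.
have mn : m%:R != 0 :> R by rewrite gt_eqF.
rewrite (_ : \sum_(k < m.+1) _ = m%:R^-1 * (t * (1 - t))); last first.
  transitivity (\sum_(k < m.+1) (m%:R ^- 2 * (k%:R * (k%:R - 1) * bernstein m k t)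
     + (m%:R ^- 2 - 2 * t / m%:R) * (k%:R * bernstein m k t)
     + t ^+ 2 * bernstein m k t)).
    by apply: eq_bigr => k _; field.
  rewrite !big_split/= -!mulr_sumr bernstein_fact2 bernstein_mean bernstein_sum.
  by field.
rewrite ler_piMr ?invr_ge0 ?ltW//; nra.
Qed.

Variables (N m : nat).
Hypothesis m0 : (0 < m)%N.
Implicit Types (k : {ffun 'I_N -> 'I_m.+1}) (t : 'I_N -> R).

(** Probability of the grid point k under N independent binomial laws with parameters m and [t i];
    sums over k therefore factorise over the coordinates. *)
Definition bernsteinN k t : R := \prod_i bernstein m (k i) (t i).

Lemma bernsteinN_ge0 k t : (forall i, 0 <= t i <= 1) -> 0 <= bernsteinN k t.
Proof. by move=> t01; apply: prodr_ge0 => i _; exact: bernstein_ge0. Qed.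

Lemma bernsteinN_sum t : \sum_(k : {ffun 'I_N -> 'I_m.+1}) bernsteinN k t = 1.
Proof.
rewrite /bernsteinN -(bigA_distr_bigA (fun i (j : 'I_m.+1) => bernstein m j (t i))).
by apply: big1 => i _; exact: bernstein_sum.
Qed.

Lemma bernsteinN_var t i : (forall i, 0 <= t i <= 1) ->
  \sum_(k : {ffun 'I_N -> 'I_m.+1}) ((k i)%:R / m%:R - t i) ^+ 2 * bernsteinN k t <= m%:R^-1.
Proof.
move=> t01.
pose G i' (j : 'I_m.+1) := (if i' == i then (j%:R / m%:R - t i) ^+ 2 else 1) *
  bernstein m j (t i').
rewrite (_ : \sum_k _ = \sum_(k : {ffun 'I_N -> 'I_m.+1}) \prod_i' G i' (k i')); last first.
  apply: eq_bigr => k _; rewrite /bernsteinN /G [RHS]big_split/=; congr (_ * _).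
  by rewrite (bigD1 i)//= eqxx big1 ?mulr1// => i' /negPf ->.
rewrite -bigA_distr_bigA (bigD1 i)//= [X in _ * X]big1 ?mulr1; last first.
  move=> i' ii'; rewrite -[RHS](bernstein_sum m (t i')).
  by apply: eq_bigr => j _; rewrite /G (negPf ii') mul1r.
rewrite /G eqxx; exact: bernstein_var.
Qed.

End Bernstein.

(** * Approximation on boxes by globally bounded trigonometric polynomials *)

Section TrigPolynomials.
Context {R : realType} {N : nat}.
Implicit Types (x y a : 'rV[R]_N) (h : 'rV[R]_N -> R).

Definition dotr a x : R := \sum_i a 0 i * x 0 i.

(** Entries are (coefficient, frequency, phase). The phases make sines special cases, and the
    product-to-sum formula keeps products inside the class. *)
Definition trig (l : seq (R * 'rV[R]_N * R)) x : R :=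
  \sum_(z <- l) z.1.1 * cos (dotr z.1.2 x + z.2).

Definition is_trig h := exists l, forall x, h x = trig l x.

Lemma dotrDl a b x : dotr (a + b) x = dotr a x + dotr b x.
Proof. by rewrite -big_split/=; apply: eq_bigr => i _; rewrite mxE mulrDl. Qed.

Lemma dotrNl a x : dotr (- a) x = - dotr a x.
Proof. by rewrite -sumrN; apply: eq_bigr => i _; rewrite mxE mulNr. Qed.

Lemma is_trig_ext h h' : (forall x, h x = h' x) -> is_trig h -> is_trig h'.
Proof. by move=> hh' [l hl]; exists l => x; rewrite -hh'. Qed.

Lemma is_trig_cst (c : R) : is_trig (fun=> c).
Proof.
exists [:: (c, 0, 0)] => x; rewrite /trig big_seq1/= addr0 /dotr big1 ?cos0 ?mulr1//.
by move=> i _; rewrite mxE mul0r.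
Qed.

Lemma is_trig_sin (c : R) i : is_trig (fun x => sin (c * x 0 i)).
Proof.
exists [:: (1, \row_j (c *+ (j == i)), - (pi / 2))] => x.
rewrite /trig big_seq1/= mul1r /dotr (bigD1 i)//= mxE eqxx mulr1n big1 ?addr0.
  by rewrite cosBpihalf.
by move=> j /negPf ji; rewrite mxE ji mulr0n mul0r.
Qed.

Lemma is_trigD h h' : is_trig h -> is_trig h' -> is_trig (fun x => h x + h' x).
Proof.
by move=> [l hl] [l' hl']; exists (l ++ l') => x; rewrite /trig big_cat hl hl'.
Qed.

Lemma is_trigM h h' : is_trig h -> is_trig h' -> is_trig (fun x => h x * h' x).
Proof.
move=> [l hl] [l' hl'].
exists ([seq (z.1.1 * z'.1.1 / 2, z.1.2 + z'.1.2, z.2 + z'.2) | z <- l, z' <- l'] ++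
        [seq (z.1.1 * z'.1.1 / 2, z.1.2 - z'.1.2, z.2 - z'.2) | z <- l, z' <- l']) => x.
rewrite /trig big_cat/= !big_allpairs_dep/= -big_split hl hl' /trig mulr_suml.
apply: eq_bigr => z _; rewrite -big_split mulr_sumr; apply: eq_bigr => z' _ /=.
rewrite !dotrDl dotrNl.
rewrite (_ : _ + _ + (z.2 + z'.2) = (dotr z.1.2 x + z.2) + (dotr z'.1.2 x + z'.2)); last by ring.
rewrite (_ : _ - _ + (z.2 - z'.2) = (dotr z.1.2 x + z.2) - (dotr z'.1.2 x + z'.2)); last by ring.
move: (_ + z.2) (_ + z'.2) => u v; rewrite cosD cosB; by field.
Qed.

Lemma is_trig_sum (I : Type) (s : seq I) (P : pred I) (F : I -> 'rV[R]_N -> R) :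
  (forall i, is_trig (F i)) -> is_trig (fun x => \sum_(i <- s | P i) F i x).
Proof.
move=> HF; elim: s => [|i s IH].
  by apply: is_trig_ext (is_trig_cst 0) => x; rewrite big_nil.
case Pi : (P i).
  by apply: is_trig_ext (is_trigD (HF i) IH) => x; rewrite big_cons Pi.
by apply: is_trig_ext IH => x; rewrite big_cons Pi.
Qed.

Lemma is_trig_prod (I : Type) (s : seq I) (F : I -> 'rV[R]_N -> R) :
  (forall i, is_trig (F i)) -> is_trig (fun x => \prod_(i <- s) F i x).
Proof.
move=> HF; elim: s => [|i s IH].
  by apply: is_trig_ext (is_trig_cst 1) => x; rewrite big_nil.
by apply: is_trig_ext (is_trigM (HF i) IH) => x; rewrite big_cons.
Qed.

Lemma is_trigX h n : is_trig h -> is_trig (fun x => h x ^+ n).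
Proof.
move=> Hh; elim: n => [|n IH]; first exact: is_trig_cst.
by apply: is_trig_ext (is_trigM Hh IH) => x; rewrite exprS.
Qed.

Lemma trig_lip h : is_trig h -> exists2 C, 0 <= C &
  forall x y (d : R), (forall i, `|x 0 i - y 0 i| <= d) -> `|h x - h y| <= C * d.
Proof.
move=> [l hl]; exists (\sum_(z <- l) `|z.1.1| * \sum_i `|z.1.2 0 i|).
  by apply: sumr_ge0 => z _; rewrite mulr_ge0// sumr_ge0.
move=> x y d xyd; rewrite !hl /trig -sumrB mulr_suml.
apply: (le_trans (ler_norm_sum _ _ _)); apply: ler_sum => z _.
rewrite -mulrBr normrM -mulrA ler_wpM2l//.
apply: (le_trans (cos_lip _ _)); rewrite opprD addrACA subrr addr0 /dotr -sumrB.
rewrite mulr_suml; apply: (le_trans (ler_norm_sum _ _ _)); apply: ler_sum => i _.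
by rewrite -mulrBr normrM ler_wpM2l.
Qed.

(** Only x is confined to the box, because the nodes with which it is compared in [trig_approx] may
    lie outside. *)
Lemma box_unif_continuous (f : 'rV[R]_N -> R) (L e : R) : continuous f -> 0 < e ->
  exists2 d : R, 0 < d & forall x y, (forall i, `|x 0 i| <= L) ->
    (forall i, `|x 0 i - y 0 i| < d) -> `|f x - f y| < e.
Proof.
move=> cf e0.
pose A := [set x : 'rV[R]_N | forall i, `[(- L), L]%classic (x ord0 i)].
have cA : compact A.
  by apply: (@rV_compact R N (fun=> `[(- L), L]%classic)) => _; exact: segment_compact.
have /compact_near_coveringP nc := cA.
have loc x : A x -> \forall x' \near x & d \near 0^'+,
    forall y, ball x' d y -> `|f x' - f y| < e.
  move=> Ax.
  have e2 : 0 < e / 2 by rewrite divr_gt0.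
  have /cvgrPdist_lt/(_ _ e2)/nbhs_ballP[r /= r0 Hr] := cf x.
  exists (ball x (r / 2), [set d | d < r / 2]).
    split => /=; first by apply: nbhsx_ballx; rewrite divr_gt0.
    by apply: nbhs_right_lt; rewrite divr_gt0.
  move=> [x' d] /= [xx' dr] y x'y.
  rewrite (splitr e) -(subrKA (f x)) (le_lt_trans (ler_normD _ _))// ltrD//.
    rewrite distrC; apply: Hr; apply: le_ball xx'.
    by move: r0; lra.
  apply: Hr; rewrite (splitr r); apply: ball_triangle xx' _.
  by apply: le_ball x'y; exact: ltW.
have [d /= d0 H] := nc _ _ _ _ loc.
exists (d / 2); first by rewrite divr_gt0.
  move=> x y xL xy; apply: (H (d / 2)) => //=.
  + by rewrite /ball_ /= sub0r normrN gtr0_norm ?divr_gt0// ltr_pdivrMr// ltr_pMr// ltr1n.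
  + by rewrite divr_gt0.
  + by move=> i /=; rewrite in_itv/= -ler_norml.
  + by split => [|i j]; rewrite ?divr_gt0// ord1; exact: xy.
Qed.

(** In [trig_approx] a is the angle of a node and b that of a point of the box. Keeping b within 1/2
    of 0 keeps (a + b) / 2 away from the points +-pi/2, where the cosine factor of sin a - sin b
    vanishes. *)
Lemma sin_separated (d : R) : 0 < d -> exists2 c, 0 < c &
  forall a b : R, - (pi / 2) <= a <= pi / 2 -> `|b| <= 1 / 2 -> d <= `|a - b| ->
    c <= `|sin a - sin b|.
Proof.
move=> d0.
(* The cap 1 keeps [d'] in the range where sin increases; u is the largest possible |a + b| / 2 and
   lies below pi/2. *)
pose d' := Num.min (d / 2) 1.
pose u := (pi / 2 + 1 / 2) / 2 : R.
have ph : 1 <= pi / 2 :> R := pihalf_ge1 R.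
have d'0 : 0 < d' by rewrite lt_min divr_gt0//=.
have d'1 : d' <= 1 by rewrite ge_min lexx orbT.
have cu : 0 < cos u by apply: cos_gt0_pihalf; rewrite /u; lra.
have sd : 0 < sin d' by apply: sin_gt0_pi; apply/andP; split; lra.
exists (2 * cos u * sin d'); first by rewrite !mulr_gt0.
move=> a b /andP[a1 a2]; rewrite ler_norml => /andP[b1 b2] dab.
have -> : sin a - sin b = 2 * cos ((a + b) / 2) * sin ((a - b) / 2).
  pose p := (a + b) / 2; pose r := (a - b) / 2; rewrite -/p -/r.
  have ea : a = p + r by rewrite /p /r; field.
  have eb : b = p - r by rewrite /p /r; field.
  by rewrite [X in sin X - _]ea [X in _ - sin X]eb sinD sinB; ring.
rewrite !normrM ger0_norm//; apply: ler_pM.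
- by rewrite mulr_ge0// ltW.
- exact: ltW.
- rewrite ler_wpM2l// ger0_norm; last first.
    by apply: cos_ge0_pihalf; apply/andP; split; lra.
  rewrite -[leRHS]cos_norm.
  set v := `|_|; have v1 : v <= u by rewrite /v/u ler_norml; apply/andP; split; lra.
  have v0 : 0 <= v by rewrite /v.
  have [uv|] := ltP v u; last by move=> uv; rewrite (le_anti (_ : v <= u <= v)) ?v1.
  have up : u <= pi by rewrite /u; lra.
  by apply: ltW; rewrite ltr_cos ?in_itv//= ?v0 ?(le_trans v1)// up (le_trans v0).
- set v := (a - b) / 2.
  have -> : `|sin v| = sin `|v|.
    have [v0|v0] := leP 0 v.
      rewrite (ger0_norm v0) ger0_norm//; apply: sin_ge0_pi.
      by rewrite /v in v0 *; apply/andP; split; lra.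
    rewrite (ltr0_norm v0) sinN ler0_norm//.
    rewrite -oppr_ge0 -sinN; apply: sin_ge0_pi.
    by rewrite /v in v0 *; apply/andP; split; lra.
  have dv : d' <= `|v|.
    by rewrite /v normrM (@ger0_norm _ 2^-1)// /d' ge_min; apply/orP; left; lra.
  have v2 : `|v| <= pi / 2 by rewrite /v ler_norml; apply/andP; split; lra.
  have [lt|] := ltP d' `|v|; last by move=> h; rewrite (le_anti (_ : d' <= `|v| <= d')) ?dv.
  by apply: ltW; rewrite ltr_sin ?in_itv//=; apply/andP; split => //; lra.
Qed.

(** Bernstein's proof of the Weierstrass theorem after the substitution t = (1 + sin(x / (2L))) / 2,
    which turns polynomials in t into trigonometric polynomials. The weights are non-negative with
    sum 1 at every x, so the bound K holds on the whole space. The scale 2L maps the box to angles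
    of size at most 1/2, where the substitution is injective with margin. *)
Lemma trig_approx (f : 'rV[R]_N -> R) (K L e : R) : continuous f ->
  (forall x, `|f x| <= K) -> 0 < L -> 0 < e ->
  exists h, [/\ is_trig h, forall x, `|h x| <= K &
    forall x, (forall i, `|x 0 i| <= L) -> `|h x - f x| <= e].
Proof.
move=> cf fK L0 e0.
have K0 : 0 <= K by apply: le_trans (fK 0).
have e2 : 0 < e / 2 by rewrite divr_gt0.
have [d d0 Hd] := box_unif_continuous L cf e2.
have L2 : 0 < 2 * L by rewrite mulr_gt0.
have [c c0 Hc] := @sin_separated (d / (2 * L)) (divr_gt0 d0 L2).
(* Chebyshev's inequality: the nodes at distance at least d in some coordinate contribute at most 2K
   (2/c)^2 times the sum of N variances, each at most 1/m. *)
pose C := 2 * K * (2 / c) ^+ 2 * N%:R.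
have C'0 : 0 <= 2 * K * (2 / c) ^+ 2 by apply: mulr_ge0; [exact: mulr_ge0|exact: sqr_ge0].
have C0 : 0 <= C by exact: mulr_ge0.
have [m m0 Cm] : exists2 m : nat, (0 < m)%N & C / m%:R <= e / 2.
  have := cvg_divn0 C => /cvgrPdist_lt/(_ _ e2) [m _ H].
  exists m.+1 => //; have := H m.+1 (leqnSn m).
  by rewrite sub0r normrN => /ltW; apply: le_trans; exact: ler_norm.
have mR : 0 < m%:R :> R by rewrite ltr0n.
pose t x i : R := (1 + sin ((2 * L)^-1 * x 0 i)) / 2.
have t01 x i : 0 <= t x i <= 1.
  have := sin_geN1 ((2 * L)^-1 * x 0 i); have := sin_le1 ((2 * L)^-1 * x 0 i).
  by rewrite /t => ? ?; apply/andP; split; lra.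
(* The point at which the substitution takes the value [k i / m] in coordinate i. *)
pose y (k : {ffun 'I_N -> 'I_m.+1}) : 'rV[R]_N :=
  \row_i (2 * L * asin (2 * (k i)%:R / m%:R - 1)).
pose h x := \sum_k f (y k) * bernsteinN k (t x).
exists h; split.
- apply: is_trig_sum => k; apply: is_trigM; first exact: is_trig_cst.
  apply: is_trig_prod => i; apply: is_trigM; first exact: is_trig_cst.
  have tt : is_trig (fun x => t x i).
    apply: is_trigM; last exact: is_trig_cst.
    by apply: is_trigD; [exact: is_trig_cst|exact: is_trig_sin].
  apply: is_trigM; apply: is_trigX => //.
  apply: is_trigD; first exact: is_trig_cst.
  by apply: is_trig_ext (is_trigM (is_trig_cst (-1)) tt) => x; rewrite mulN1r.
- move=> x; rewrite -[leRHS]mulr1 -(bernsteinN_sum m (t x)) mulr_sumr.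
  apply: (le_trans (ler_norm_sum _ _ _)); apply: ler_sum => k _.
  by rewrite normrM [X in _ * X]ger0_norm ?bernsteinN_ge0// ler_wpM2r ?bernsteinN_ge0.
- move=> x xL.
  have -> : h x - f x = \sum_k (f (y k) - f x) * bernsteinN k (t x).
    transitivity (h x - f x * \sum_(k : {ffun 'I_N -> 'I_m.+1}) bernsteinN k (t x)).
      by rewrite (bernsteinN_sum m (t x)) mulr1.
    by rewrite mulr_sumr -sumrB; apply: eq_bigr => k _; rewrite mulrBl.
  have key (k : {ffun 'I_N -> 'I_m.+1}) : `|f (y k) - f x| <= e / 2 +
      2 * K * (2 / c) ^+ 2 * \sum_i ((k i)%:R / m%:R - t x i) ^+ 2.
    have S0 : 0 <= \sum_i ((k i)%:R / m%:R - t x i) ^+ 2.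
      by apply: sumr_ge0 => i _; exact: sqr_ge0.
    have [near|] := pselect (forall i, `|x 0 i - y k 0 i| < d).
      by rewrite distrC (le_trans (ltW (Hd _ _ xL near)))// lerDl mulr_ge0.
    move=> /existsNP[i /negP]; rewrite -leNgt => far.
    have kin : -1 <= (2 * (k i)%:R / m%:R - 1 : R) <= 1.
      have k0 : 0 <= (k i)%:R / m%:R :> R by rewrite divr_ge0.
      have k1 : (k i)%:R / m%:R <= 1 :> R.
        by rewrite ler_pdivrMr// mul1r ler_nat -ltnS.
      by rewrite -mulrA; apply/andP; split; lra.
    have sep : c <= 2 * `|(k i)%:R / m%:R - t x i|.
      have -> : 2 * `|(k i)%:R / m%:R - t x i| = `|sin (asin (2 * (k i)%:R / m%:R - 1))
          - sin ((2 * L)^-1 * x 0 i)|.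
        rewrite asinK ?in_itv//= -[X in X * _](@ger0_norm _ 2)// -normrM; congr `|_|.
        by rewrite /t; field; rewrite gt_eqF.
      apply: Hc.
      - by apply/andP; split; [exact: asin_geNpi2|exact: asin_lepi2].
      - rewrite normrM normfV (gtr0_norm L2) ler_pdivrMl// (le_trans (xL i))//.
        by rewrite (_ : 2 * L * (1 / 2) = L)//; field.
      - rewrite distrC ler_pdivrMr// -[X in _ * X](gtr0_norm L2) -normrM.
        rewrite mulrBl mulrC mulVKf ?gt_eqF// (mulrC (asin _)).
        by move: far; rewrite mxE.
    apply: (@le_trans _ _ (2 * K)).
      by rewrite (le_trans (ler_normB _ _))// mulr_natl mulr2n lerD.
    apply: ler_wpDl; first exact: ltW.
    rewrite -(mulrA (2 * K)) ler_peMr ?mulr_ge0//.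
    rewrite (@le_trans _ _ ((2 / c) ^+ 2 * ((k i)%:R / m%:R - t x i) ^+ 2))//.
      rewrite -exprMn -(real_normK (num_real _)) expr_ge1// normrM.
      by rewrite gtr0_norm ?divr_gt0// mulrAC ler_pdivlMr// mul1r.
    rewrite ler_wpM2l ?sqr_ge0// (bigD1 i)//= lerDl.
    by apply: sumr_ge0 => j _; exact: sqr_ge0.
  apply: (le_trans (ler_norm_sum _ _ _)).
  apply: (@le_trans _ _ (\sum_(k : {ffun 'I_N -> 'I_m.+1}) (e / 2 * bernsteinN k (t x) +
      2 * K * (2 / c) ^+ 2 *
      \sum_i ((k i)%:R / m%:R - t x i) ^+ 2 * bernsteinN k (t x)))).
    apply: ler_sum => k _; rewrite normrM (ger0_norm (bernsteinN_ge0 _ _))//.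
    by rewrite -mulr_suml mulrA -mulrDl ler_wpM2r ?bernsteinN_ge0.
  rewrite big_split/= -!mulr_sumr (bernsteinN_sum m (t x)) mulr1.
  rewrite [leRHS]splitr lerD2l (le_trans _ Cm)// /C -(mulrA _ N%:R) ler_wpM2l//.
  rewrite exchange_big/=.
  rewrite (@le_trans _ _ (\sum_(i < N) m%:R^-1))//.
    by apply: ler_sum => i _; exact: bernsteinN_var.
  by rewrite sumr_const card_ord -[leLHS]mulr_natl.
Qed.

End TrigPolynomials.

(** * Convergence in distribution *)

Section OuterExpectation.
Context {d : measure_display} {Omega : measurableType d} {R : realType}.
Variable Pr : probability Omega R.
Implicit Types g h : Omega -> R.

Lemma outer_exp_le g h : bmf g -> (forall w, h w <= g w) ->
  (outer_exp Pr h <= (rint Pr g)%:E)%E.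
Proof.
move=> bg hg; rewrite -integral_bmf//; apply: ereal_inf_lbound; exists g => //.
by split; [exact: bg.1|split => //; exact: bg.2].
Qed.

Lemma outer_exp_ge g h : bmf g -> (forall w, g w <= h w) ->
  ((rint Pr g)%:E <= outer_exp Pr h)%E.
Proof.
move=> bg gh; apply: le_ereal_inf_tmp => _ [k [mk [bk hk]] <-].
have bmk : bmf k by split.
rewrite integral_bmf// lee_fin; apply: rint_le => // w.
exact: le_trans (gh w) (hk w).
Qed.

End OuterExpectation.

Lemma cvgn_sum (R : realType) (I : Type) (l : seq I) (F : nat -> I -> R) (a : I -> R) :
  (forall i, F n i @[n --> \oo] --> a i) ->
  \sum_(i <- l) F n i @[n --> \oo] --> \sum_(i <- l) a i.
Proof.
move=> Fa; elim: l => [|i l IH].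
  by under eq_fun do rewrite big_nil; rewrite big_nil; exact: cvg_cst.
by under eq_fun do rewrite big_cons; rewrite big_cons; exact: cvgD.
Qed.

Section ConvergenceCriterion.
Context {d : measure_display} {Omega : measurableType d} {R : realType}
  {d' : measure_display} {Omega' : measurableType d'} {N : nat}.
Variables (Pr : probability Omega R) (Pr' : probability Omega' R).

Lemma bmf_trig_comp d0 (T : measurableType d0) (Z : T -> 'rV[R]_N) h :
  (forall i, measurable_fun setT (fun w => Z w 0 i)) -> is_trig h ->
  bmf (fun w => h (Z w)).
Proof.
move=> mZ [l hl]; rewrite (_ : (fun w => _) = (fun w => trig l (Z w))).
  apply: bmf_sum => z _; apply: bmfZ; apply: bmf_cos.
  apply: measurable_funD => //; apply: measurable_sum => i.
  by apply: measurable_funM => //; exact: mZ.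
by apply/funext => w.
Qed.

Lemma tail_small (G : Omega' -> 'rV[R]_N) (e : R) : 0 < e ->
  (forall i, measurable_fun setT (fun w => G w 0 i)) ->
  exists k : nat, forall m, (k <= m)%N ->
    measurable [set w | exists i, m%:R < `|G w 0 i|] /\
    fine (Pr' [set w | exists i, m%:R < `|G w 0 i|]) < e.
Proof.
move=> e0 mG; pose A (m : nat) := [set w | exists i, m%:R < `|G w 0 i|].
have mA m : measurable (A m).
  have -> : A m = \bigcup_(i in [set: 'I_N]) [set w | m%:R < `|G w 0 i|].
    by apply/seteqP; split => [w [i] ?|w [i _ ?]]; exists i.
  apply: fin_bigcup_measurable => [|i _]; first exact: finite_finset.
  rewrite -[X in measurable X]setTI.
  have -> : [set w | m%:R < `|G w 0 i|] =
      (fun w => `|G w 0 i|) @^-1` `]m%:R, +oo[%classic.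
    by apply/seteqP; split => w /=; rewrite in_itv/= andbT.
  by apply: (measurableT_comp (@normr_measurable R setT) (mG i)) => //; exact: measurable_itv.
have cvA : Pr' (A m) @[m --> \oo] --> Pr' (\bigcap_m A m).
  apply: nonincreasing_cvg_mu => //.
  - by rewrite (le_lt_trans (probability_le1 Pr' (mA 0%N)))// ltry.
  - exact: bigcap_measurable.
  - move=> m n mn; apply/subsetPset => w [i ni]; exists i.
    by apply: le_lt_trans ni; rewrite ler_nat.
have A0 : \bigcap_m A m = set0.
  rewrite -subset0 => w H.
  pose S := \sum_i `|G w 0 i|.
  have [m _ /(_ m (leqnn m)) Sm] := nbhs_infty_ger S.
  have [i] := H m Logic.I; rewrite ltNge => /negP; apply; apply: le_trans Sm.
  by rewrite /S (bigD1 i)//= lerDl sumr_ge0.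
move: cvA; rewrite A0 measure0 => /fine_cvgP[_ /cvgrPdist_lt/(_ _ e0)[k _ H]].
exists k => m km; split; first exact: mA.
by have := H m km; rewrite sub0r normrN; apply: le_lt_trans; exact: ler_norm.
Qed.

(* The second moments give tightness; on a large box f is uniformly close to a
   trigonometric polynomial that stays bounded by sup |f| outside the box. *)
Lemma cvg_dist_trig (Z Z' : nat -> Omega -> 'rV[R]_N) (G : Omega' -> 'rV[R]_N) (B : R) :
  (forall n i, bmf (fun w => Z n w 0 i)) ->
  (forall i, measurable_fun setT (fun w => G w 0 i)) ->
  (\forall n \near \oo, forall i, rint Pr (fun w => Z n w 0 i ^+ 2) <= B) ->
  (forall a th, rint Pr (fun w => cos (dotr a (Z n w) + th)) @[n --> \oo] -->
     rint Pr' (fun w => cos (dotr a (G w) + th))) ->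
  (forall e, 0 < e ->
     vanishing Pr (fun n => [set w | exists i, e < `|Z' n w 0 i - Z n w 0 i|])) ->
  cvg_dist Pr Z' Pr' G.
Proof.
move=> bZ mG ZB ccos pert f cf [K0 fK0].
pose K := `|K0| + 1.
have fK x : `|f x| <= K by rewrite (le_trans (fK0 x))// /K ler_wpDr// ler_norm.
have K_gt0 : 0 < K by rewrite /K ltr_wpDl.
have bfG : bmf (fun w => f (G w)).
  split; last by exists K.
  have mGB : measurable_fun setT (G : Omega' -> borelT 'rV[R]_N).
    by apply: measurable_fun_mx => i j; rewrite (ord1 i).
  exact: (measurableT_comp (@continuous_borel_measurable R 'rV[R]_N f cf) mGB).
rewrite integral_bmf//.
have mZ n i : measurable_fun setT (fun w => Z n w 0 i) by exact: (bZ n i).1.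
suff H e : 0 < e -> \forall n \near \oo,
    ((rint Pr' (fun w => f (G w)) - e)%:E <= outer_exp Pr (fun w => f (Z' n w)))%E /\
    (outer_exp Pr (fun w => f (Z' n w)) <= (rint Pr' (fun w => f (G w)) + e)%:E)%E.
  apply/fine_cvgP; split.
    near=> n.
    have [h1 h2] : ((rint Pr' (fun w => f (G w)) - 1)%:E <= outer_exp Pr (fun w => f (Z' n w)))%E /\
      (outer_exp Pr (fun w => f (Z' n w)) <= (rint Pr' (fun w => f (G w)) + 1)%:E)%E.
      by near: n; exact: H.
    by rewrite fin_numE -ltNye -ltey (lt_le_trans (ltNyr _) h1) (le_lt_trans h2 (ltry _)).
  apply/cvgrPdist_le => e e0; near=> n.
  have [h1 h2] : ((rint Pr' (fun w => f (G w)) - e)%:E <= outer_exp Pr (fun w => f (Z' n w)))%E /\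
      (outer_exp Pr (fun w => f (Z' n w)) <= (rint Pr' (fun w => f (G w)) + e)%:E)%E.
    by near: n; exact: H.
  have fi : outer_exp Pr (fun w => f (Z' n w)) \is a fin_num.
    by rewrite fin_numE -ltNye -ltey (lt_le_trans (ltNyr _) h1) (le_lt_trans h2 (ltry _)).
  move: h1 h2; rewrite -(fineK fi) !lee_fin /= => h1 h2.
  by rewrite ler_norml; apply/andP; split; lra.
move=> e0.
(* The errors add up to (4 + 6K) ep: sup-norm errors ep, ep and 2 ep from G, from the limit of the
   expectations of h, and from Z', plus 2K ep for each of three bad events, namely large G, large Z
   and a large perturbation. *)
pose ep := e / (4 + 6 * K).
have den : 0 < 4 + 6 * K by rewrite addr_gt0// mulr_gt0.
have ep0 : 0 < ep by rewrite divr_gt0.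
have epE : (4 + 6 * K) * ep = e by rewrite /ep mulrC divfK// gt_eqF.
have [k1 Hk1] := tail_small ep0 mG.
have [k2 k20 Hk2] : exists2 k2 : nat, (0 < k2)%N & forall m, (k2 <= m)%N -> (N%:R * B) / m%:R <= ep.
  have := cvg_divn0 (N%:R * B) => /cvgrPdist_lt/(_ _ ep0) [m _ H].
  exists m.+1 => // p mp; have := H p (ltnW mp).
  by rewrite sub0r normrN => /ltW; apply: le_trans; exact: ler_norm.
pose L := maxn k1 k2.
have L0 : (0 < L)%N by rewrite leq_max k20 orbT.
have L0R : 0 < L%:R :> R by rewrite ltr0n.
have L1R : 1 <= L%:R :> R by rewrite ler1n.
have [mA PA] := Hk1 L (leq_maxl _ _).
have LB := Hk2 L (leq_maxr _ _).
(* The box on which h approximates f is enlarged by 1, so that it still contains [Z' n w] when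
   [Z n w] is bounded by L and the perturbation by [de <= 1]. *)
have L10 : 0 < L%:R + 1 :> R by rewrite addr_gt0.
have [h [ht hK hf]] := trig_approx cf fK L10 ep0.
have [C C0 hC] := trig_lip ht.
pose de := Num.min 1 (ep / (C + 1)).
have C1 : 0 < C + 1 by rewrite ltr_wpDl.
have de0 : 0 < de by rewrite lt_min ltr01 divr_gt0.
have de1 : de <= 1 by rewrite ge_min lexx.
have Cde : C * de <= ep.
  rewrite (@le_trans _ _ ((C + 1) * de))//; first by rewrite ler_wpM2r ?(ltW de0)// lerDl.
  by rewrite mulrC -ler_pdivlMr// ge_min lexx orbT.
(* Chebyshev's bound as a function: [pen] is at least 1 once a coordinate exceeds L, and its
   integral is at most N B / L since L >= 1. *)
pose pen n w := \sum_i Z n w 0 i ^+ 2 / L%:R ^+ 2.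
have bpen n : bmf (pen n).
  apply: bmf_sum => i _; apply: bmfM; last exact: bmf_cst.
  exact: bmfX.
have bhZ n : bmf (fun w => h (Z n w)) by exact: bmf_trig_comp.
have bhG : bmf (fun w => h (G w)) by exact: bmf_trig_comp.
have chG : rint Pr (fun w => h (Z n w)) @[n --> \oo] --> rint Pr' (fun w => h (G w)).
  have [l hl] := ht.
  have E d1 (T : measurableType d1) (P : probability T R) (Y : T -> 'rV[R]_N) :
      (forall i, measurable_fun setT (fun w => Y w 0 i)) ->
      rint P (fun w => h (Y w)) =
      \sum_(z <- l) z.1.1 * rint P (fun w => cos (dotr z.1.2 (Y w) + z.2)).
    move=> mY; under eq_fun do rewrite hl.
    have bc z : bmf (fun w => cos (dotr z.1.2 (Y w) + z.2)).
      apply: bmf_cos; apply: measurable_funD => //; apply: measurable_sum => i.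
      by apply: measurable_funM => //; exact: mY.
    rewrite /trig rint_sum; last by move=> z _; apply: bmfZ; exact: bc.
    by apply: eq_bigr => z _; rewrite rintZ//; exact: bc.
  under eq_fun do rewrite E//.
  rewrite E//; apply: cvgn_sum => z.
  by apply: cvgM; [exact: cvg_cst|exact: ccos].
have Gclose : `|rint Pr' (fun w => h (G w)) - rint Pr' (fun w => f (G w))| <= ep + 2 * K * ep.
  rewrite -rintB//.
  pose A := [set w | exists i, L%:R < `|G w 0 i|].
  have b1 : bmf (fun w => ep + 2 * K * (\1_A : Omega' -> R) w).
    by apply: bmfD; [exact: bmf_cst|apply: bmfZ; exact: bmf_indic].
  have pt w : `|h (G w) - f (G w)| <= ep + 2 * K * (\1_A : Omega' -> R) w.
    rewrite indicE; have [|/negP nA] := boolP (w \in A).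
      rewrite mulr1 => _; rewrite (le_trans (ler_normB _ _))//.
      by have := hK (G w); have := fK (G w); lra.
    rewrite mulr0 addr0; apply: hf => i; rewrite (@le_trans _ _ L%:R)//; last by rewrite lerDl.
    by rewrite leNgt; apply/negP => Li; apply: nA; rewrite inE; exists i.
  rewrite (@le_trans _ _ (rint Pr' (fun w => ep + 2 * K * (\1_A : Omega' -> R) w)))//.
    rewrite ler_norml -rintN//; apply/andP; split; apply: rint_le => //.
    - exact: bmfN.
    - exact: bmfB.
    - by move=> w; have := pt w; rewrite ler_norml => /andP[].
    - exact: bmfB.
    - by move=> w; have := pt w; rewrite ler_norml => /andP[].
  rewrite rintD ?rint_cst; [|exact: bmf_cst|by apply: bmfZ; exact: bmf_indic].
  rewrite lerD2l rintZ; last exact: bmf_indic.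
  by rewrite ler_wpM2l ?mulr_ge0 ?ltW// rint_indic.
have /vanishingP/(_ _ ep0) vp := pert _ de0.
move/cvgrPdist_le : chG => /(_ _ ep0) chG.
near=> n.
have /outer_prob_lt[Bn [mBn subBn PBn]] : (outer_prob Pr
  [set w | exists i, (de < `|Z' n w 0 i - Z n w 0 i|)%R] < ep%:E)%E by near: n.
have cn : `|rint Pr' (fun w => h (G w)) - rint Pr (fun w => h (Z n w))| <= ep by near: n.
have Bnd i : rint Pr (fun w => Z n w 0 i ^+ 2) <= B by move: i; near: n.
pose err w := 2 * ep + 2 * K * ((\1_Bn : Omega -> R) w + pen n w).
have bi : bmf (fun w => (\1_Bn : Omega -> R) w + pen n w).
  by apply: bmfD => //; exact: bmf_indic.
have berr : bmf err by apply: bmfD; [exact: bmf_cst|exact: bmfZ].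
have pen0 w : 0 <= pen n w.
  by apply: sumr_ge0 => i _; rewrite divr_ge0 ?sqr_ge0.
have perr w : `|f (Z' n w) - h (Z n w)| <= err w.
  have i0 : 0 <= (\1_Bn : Omega -> R) w by rewrite indicE.
  have bad : 1 <= (\1_Bn : Omega -> R) w + pen n w -> `|f (Z' n w) - h (Z n w)| <= err w.
    move=> h1; rewrite (le_trans (ler_normB _ _))// /err.
    have := fK (Z' n w); have := hK (Z n w) => ? ?.
    have : 2 * K * 1 <= 2 * K * ((\1_Bn : Omega -> R) w + pen n w).
      by rewrite ler_wpM2l// mulr_ge0// ltW.
    by move: ep0; lra.
  have [wB|nwB] := pselect (Bn w).
    by apply: bad; rewrite indicE mem_set//= lerDl.
  have [big|] := pselect (exists i, L%:R < `|Z n w 0 i|).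
    have [i Li] := big; apply: bad; rewrite ler_wpDl// /pen (bigD1 i)//=.
    rewrite ler_wpDr ?sumr_ge0// => [j _|]; first by rewrite divr_ge0 ?sqr_ge0.
    rewrite ler_pdivlMr ?exprn_gt0// mul1r -(real_normK (num_real (Z n w 0 i))).
    by rewrite ler_pXn2r ?nnegrE// ltW.
  move=> /forallNP small.
  have ZL i : `|Z n w 0 i| <= L%:R by rewrite leNgt; apply/negP; exact: small.
  have close i : `|Z' n w 0 i - Z n w 0 i| <= de.
    by rewrite leNgt; apply/negP => ci; apply: nwB; apply: subBn; exists i.
  have Z'L i : `|Z' n w 0 i| <= L%:R + 1.
    rewrite -(subrK (Z n w 0 i) (Z' n w 0 i)) addrC (le_trans (ler_normD _ _))// lerD//.
    by rewrite (le_trans (close i)).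
  rewrite -(subrKA (h (Z' n w))) (le_trans (ler_normD _ _))// /err.
  have t1 := hf _ Z'L; rewrite distrC in t1.
  have t2 := le_trans (hC _ _ _ close) Cde.
  have : 0 <= 2 * K * ((\1_Bn : Omega -> R) w + pen n w).
    by rewrite mulr_ge0 ?addr_ge0// mulr_ge0// ltW.
  by move: t1 t2; lra.
have Eerr : rint Pr err <= 2 * ep + 2 * K * (ep + ep).
  rewrite rintD ?rint_cst; [|exact: bmf_cst|exact: bmfZ].
  rewrite lerD2l rintZ// ler_wpM2l ?(mulr_ge0 _ (ltW K_gt0))// rintD//; last exact: bmf_indic.
  rewrite lerD// ?rint_indic//.
    by rewrite -lee_fin fineK ?fin_num_measure// ltW.
  rewrite rint_sum; last first.
    by move=> i _; apply: bmfM; [exact: bmfX|exact: bmf_cst].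
  rewrite (le_trans _ LB)//.
  apply: (@le_trans _ _ (\sum_(i < N) B / L%:R)).
    apply: ler_sum => i _; under eq_fun do rewrite mulrC.
    rewrite rintZ; last exact: bmfX.
    rewrite mulrC ler_pM ?invr_ge0 ?exprn_ge0 ?Bnd//.
      by apply: rint_ge0 => w; exact: sqr_ge0.
    by rewrite lef_pV2 ?posrE ?exprn_gt0// expr2 ler_peMr// ltW.
  by rewrite sumr_const card_ord -[leLHS]mulr_natl mulrA.
have Elo : rint Pr (fun w => h (Z n w) - err w) = rint Pr (fun w => h (Z n w)) - rint Pr err.
  by rewrite rintB.
have Ehi : rint Pr (fun w => h (Z n w) + err w) = rint Pr (fun w => h (Z n w)) + rint Pr err.
  by rewrite rintD.
move: cn Gclose; rewrite !ler_norml => /andP[c1 c2] /andP[g1 g2].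
have tot : e = 4 * ep + 6 * K * ep by rewrite -epE mulrDl.
split.
  apply: (@le_trans _ _ (rint Pr (fun w => h (Z n w) - err w))%:E).
    by rewrite lee_fin Elo; move: Eerr tot c1 c2 g1 g2; lra.
  apply: outer_exp_ge => [|w]; first exact: bmfB.
  by have := perr w; rewrite ler_norml => /andP[]; lra.
apply: (@le_trans _ _ (rint Pr (fun w => h (Z n w) + err w))%:E).
  apply: outer_exp_le => [|w]; first exact: bmfD.
  by have := perr w; rewrite ler_norml => /andP[]; lra.
by rewrite lee_fin Ehi; move: Eerr tot c1 c2 g1 g2; lra.
Unshelve. all: by end_near. Qed.

End ConvergenceCriterion.

Lemma cvg_dist_comp d (Omega : measurableType d) d' (Omega' : measurableType d')
    (R : realType) (E F : topologicalType) (Pr : probability Omega R)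
    (Pr' : probability Omega' R) (phi : E -> F) (Z : nat -> Omega -> E)
    (G : Omega' -> E) (Z' : nat -> Omega -> F) (G' : Omega' -> F) :
  continuous phi -> (forall n w, Z' n w = phi (Z n w)) ->
  (forall w, G' w = phi (G w)) -> cvg_dist Pr Z Pr' G -> cvg_dist Pr Z' Pr' G'.
Proof.
move=> cphi Z'E G'E cZ f cf [M fM].
have -> : Z' = fun n w => phi (Z n w) by apply/funext => n; apply/funext => w.
have -> : G' = fun w => phi (G w) by apply/funext => w.
apply: (cZ (f \o phi)) => [x|]; last by exists M => x; exact: fM.
by apply: continuous_comp; [exact: cphi|exact: cf].
Qed.

(** * Hoeffding decomposition over designs *)

Section Kernel.
Context {d : measure_display} {Omega : measurableType d} {R : realType} {q : nat}.
Variables (Pr : probability Omega R) (X : nat -> Omega -> 'rV[R]_q).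
Hypothesis iidX : iid Pr X.

Lemma measurable_mxB d1 (T : measurableType d1) (Y Z : T -> 'rV[R]_q) :
  measurable_fun setT (Y : T -> Vb R q) -> measurable_fun setT (Z : T -> Vb R q) ->
  measurable_fun setT ((fun w => Y w - Z w) : T -> Vb R q).
Proof.
move=> mY mZ; apply: measurable_fun_mx => i j.
under eq_fun do rewrite !mxE.
by apply: measurable_funB; apply: (measurableT_comp (measurable_coord i j)).
Qed.

Lemma rint_pair (F : Vb R q * Vb R q -> R) i j : i != j -> bmf F ->
  rint Pr (fun w => F (X i w, X j w)) =
  rint Pr (fun w => rint Pr (fun w' => F (X 0%N w, X 0%N w'))).
Proof.
move=> ij bF.
pose F' (z : past X [set i] * past X [set j]) := F (X i z.1, X j z.2).
have bF' : bmf F'.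
  have mY : measurable_fun setT ((fun z => (X i z.1, X j z.2)) :
      past X [set i] * past X [set j] -> Vb R q * Vb R q).
    apply: measurable_fun_pair.
      by apply: (measurableT_comp _ measurable_fst); exact: measurable_past.
    by apply: (measurableT_comp _ measurable_snd); exact: measurable_past.
  exact: (bmf_comp mY bF).
rewrite (decouple iidX _ bF'); last by move=> k -> ji; rewrite ji eqxx in ij.
rewrite /F' /=.
pose G (x : Vb R q) := rint Pr (fun w' => F (x, X 0%N w')).
have bG : bmf G.
  apply: (@bmf_rint_section _ _ _ _ _ (law_prob Pr (iidX.1 0%N)) Pr
    (fun z => F (z.1, X 0%N z.2))).
  have mY : measurable_fun setT ((fun z => (z.1, X 0%N z.2)) :
      Vb R q * Omega -> Vb R q * Vb R q).
    apply: measurable_fun_pair; first exact: measurable_fst.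
    by apply: (measurableT_comp _ measurable_snd); exact: iidX.1.
  exact: (bmf_comp mY bF).
transitivity (rint Pr (fun w => G (X i w))); last exact: rint_ident.
congr (rint Pr); apply/funext => w.
exact: (rint_ident iidX j (bmf_section bF (X i w))).
Qed.

Variable g : 'rV[R]_q -> R.
Hypothesis bg : bmf (g : Vb R q -> R).
Hypothesis geven : forall x, g (- x) = g x.
Hypothesis gcentered : rint Pr (fun w => g (X 0%N w - X 1%N w)) = 0.

(** Scalar forms of [H1] and [H2]. The kernel g will be an entry of J in the second-moment bounds,
    and the inner product of J with a fixed matrix in the characteristic functions. *)
Definition h1 (x : 'rV[R]_q) : R := rint Pr (fun w => g (x - X 0%N w)).
Definition h2 (x y : 'rV[R]_q) : R := g (x - y) - h1 x - h1 y.

Lemma bmf_kernelB : bmf (fun z : Vb R q * Vb R q => g (z.1 - z.2)).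
Proof.
have mB : measurable_fun setT ((fun z => z.1 - z.2) : Vb R q * Vb R q -> Vb R q).
  by apply: measurable_mxB; [exact: measurable_fst|exact: measurable_snd].
exact: (bmf_comp mB bg).
Qed.

Lemma bmf_h1 : bmf (h1 : Vb R q -> R).
Proof.
apply: (@bmf_rint_section _ _ _ _ _ (law_prob Pr (iidX.1 0%N)) Pr
    (fun z : Vb R q * Omega => g (z.1 - X 0%N z.2))).
apply: (@bmf_comp _ _ _ _ _ _ (fun z : Vb R q * Omega => (z.1, X 0%N z.2) : Vb R q * Vb R q) _ bmf_kernelB).
apply: measurable_fun_pair; first exact: measurable_fst.
by apply: (measurableT_comp _ measurable_snd); exact: iidX.1.
Qed.

Lemma bmf_h2 : bmf (fun z : Vb R q * Vb R q => h2 z.1 z.2).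
Proof.
apply: bmfB; last first.
  exact: (@bmf_comp _ _ _ _ _ (h1 : Vb R q -> R) _ measurable_snd bmf_h1).
apply: bmfB; first exact: bmf_kernelB.
exact: (@bmf_comp _ _ _ _ _ (h1 : Vb R q -> R) _ measurable_fst bmf_h1).
Qed.

Lemma h2C x y : h2 x y = h2 y x.
Proof. by rewrite /h2 -geven opprB addrAC. Qed.

Lemma bmf_h1_comp d1 (T : measurableType d1) (Y : T -> 'rV[R]_q) :
  measurable_fun setT (Y : T -> Vb R q) -> bmf (fun w => h1 (Y w)).
Proof. by move=> mY; exact: (@bmf_comp _ _ _ _ _ (h1 : Vb R q -> R) _ mY bmf_h1). Qed.

Lemma bmf_h2_comp d1 (T : measurableType d1) (Y Z : T -> 'rV[R]_q) :
  measurable_fun setT (Y : T -> Vb R q) -> measurable_fun setT (Z : T -> Vb R q) ->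
  bmf (fun w => h2 (Y w) (Z w)).
Proof.
move=> mY mZ.
exact: (@bmf_comp _ _ _ _ _ _ (fun w => (Y w, Z w) : Vb R q * Vb R q)
  (measurable_fun_pair mY mZ) bmf_h2).
Qed.

Lemma rint_h1 i : rint Pr (fun w => h1 (X i w)) = 0.
Proof.
rewrite (rint_ident iidX i bmf_h1) -[RHS]gcentered.
by rewrite (@rint_pair (fun z => g (z.1 - z.2)) 0%N 1%N) //; exact: bmf_kernelB.
Qed.

Lemma rint_h2 x j : rint Pr (fun w => h2 x (X j w)) = 0.
Proof.
have b1 : bmf (fun y : Vb R q => g (x - y)) by exact: (bmf_section bmf_kernelB x).
have b2 : bmf (fun w => g (x - X j w)).
  exact: (@bmf_comp _ _ _ _ _ _ _ (iidX.1 j) b1).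
have b3 := bmf_h1_comp (iidX.1 j).
rewrite /h2 rintB//; last by apply: bmfB => //; exact: bmf_cst.
rewrite rintB//; last exact: bmf_cst.
rewrite rint_cst rint_h1 subr0 (rint_ident iidX j b1).
by rewrite /h1 subrr.
Qed.

Lemma rint_mul_h1 (I : set nat) (k : past X I -> R) j : ~ I j -> bmf k ->
  rint Pr (fun w => k w * h1 (X j w)) = 0.
Proof.
move=> Ij bk.
have bF : bmf (fun z : past X I * past X [set j] => k z.1 * h1 (X j z.2)).
  apply: bmfM; first exact: (@bmf_comp _ _ _ _ _ k _ measurable_fst bk).
  apply: bmf_h1_comp; apply: (measurableT_comp _ measurable_snd).
  exact: measurable_past.
rewrite (decouple iidX _ bF); last by move=> i Ii ij; apply: Ij; rewrite -ij.
rewrite -[RHS](rint_cst Pr); congr (rint Pr); apply/funext => w /=.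
rewrite rintZ ?rint_h1 ?mulr0//; exact: bmf_h1_comp (iidX.1 j).
Qed.

Lemma rint_mul_h2 (I : set nat) (k : past X I -> R) i j : I i -> ~ I j -> bmf k ->
  rint Pr (fun w => k w * h2 (X i w) (X j w)) = 0.
Proof.
move=> Ii Ij bk.
have bF : bmf (fun z : past X I * past X [set j] => k z.1 * h2 (X i z.1) (X j z.2)).
  apply: bmfM; first exact: (@bmf_comp _ _ _ _ _ k _ measurable_fst bk).
  apply: bmf_h2_comp.
    by apply: (measurableT_comp _ measurable_fst); exact: measurable_past.
  by apply: (measurableT_comp _ measurable_snd); exact: measurable_past.
rewrite (decouple iidX _ bF); last by move=> i' Ii' ij; apply: Ij; rewrite -ij.
rewrite -[RHS](rint_cst Pr); congr (rint Pr); apply/funext => w /=.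
rewrite rintZ ?rint_h2 ?mulr0//.
apply: bmf_h2_comp; last exact: iidX.1.
exact: measurable_cst.
Qed.

Lemma rint_h1_sqr i :
  rint Pr (fun w => h1 (X i w) ^+ 2) = rint Pr (fun w => h1 (X 0%N w) ^+ 2).
Proof. by apply: (rint_ident iidX (f := fun x => h1 x ^+ 2)); apply: bmfX; exact: bmf_h1. Qed.

Lemma rint_h2_sqr i j : i != j -> rint Pr (fun w => h2 (X i w) (X j w) ^+ 2) =
  rint Pr (fun w => h2 (X 0%N w) (X 1%N w) ^+ 2).
Proof.
move=> ij; have b : bmf (fun z : Vb R q * Vb R q => h2 z.1 z.2 ^+ 2).
  by apply: bmfX; exact: bmf_h2.
by rewrite (rint_pair ij b); apply/esym; exact: (@rint_pair _ 0%N 1%N isT b).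
Qed.

(** As unordered pairs p and p' differ, so some index of p' is absent from p; integrating out that
    variable first annihilates the product. *)
Lemma rint_h2_h2 (p p' : nat * nat) : p.1 != p.2 -> p'.1 != p'.2 ->
  p != p' -> p != (p'.2, p'.1) ->
  rint Pr (fun w => h2 (X p.1 w) (X p.2 w) * h2 (X p'.1 w) (X p'.2 w)) = 0.
Proof.
case: p p' => [i j] [k l] /= ij kl p1 p2.
have mI a (e : nat) : a != e -> measurable_fun setT (X a : past X [set b | b != e] -> Vb R q).
  by move=> ae; exact: measurable_past.
have bk (e : nat) : i != e -> j != e ->
    bmf (fun w : past X [set b | b != e] => h2 (X i w) (X j w)).
  by move=> ie je; apply: bmf_h2_comp; exact: mI.
have [il|il] := eqVneq i l; [have [jk|jk] := eqVneq j k|have [jl|jl] := eqVneq j l].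
- by move: p2; rewrite il jk eqxx.
- have ik : i != k by rewrite il eq_sym.
  under eq_fun do rewrite (h2C (X k _)).
  apply: (@rint_mul_h2 [set b | b != k]); last exact: bk.
    by rewrite /= eq_sym.
  by rewrite /= eqxx.
- have [ik|ik] := eqVneq i k; first by move: p1; rewrite ik jl eqxx.
  have jk : j != k by rewrite jl eq_sym.
  under eq_fun do rewrite (h2C (X k _)).
  apply: (@rint_mul_h2 [set b | b != k]); last exact: bk.
    by rewrite /= eq_sym.
  by rewrite /= eqxx.
- apply: (@rint_mul_h2 [set b | b != l]); last exact: bk; first by [].
  by rewrite /= eqxx.
Qed.

Lemma rint_h1_h1 i j : i != j ->
  rint Pr (fun w => h1 (X i w) * h1 (X j w)) = 0.
Proof.
move=> ij; apply: (@rint_mul_h1 [set i]); first by move=> /esym/eqP; rewrite (negPf ij).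
by apply: bmf_h1_comp; exact: measurable_past.
Qed.

Lemma rint_sqr_sum (I : eqType) (s : seq I) (F : I -> Omega -> R) (v : R) :
  uniq s -> (forall i, i \in s -> bmf (F i)) ->
  (forall i, i \in s -> rint Pr (fun w => F i w ^+ 2) = v) ->
  (forall i j, i \in s -> j \in s -> i != j -> rint Pr (fun w => F i w * F j w) = 0) ->
  rint Pr (fun w => (\sum_(i <- s) F i w) ^+ 2) = (size s)%:R * v.
Proof.
elim: s => [|i s IH] /=.
  move=> _ _ _ _; under eq_fun do rewrite big_nil expr0n/=.
  by rewrite rint_cst mul0r.
move=> /andP[si us] bF Fv FF.
have bi : bmf (F i) by apply: bF; rewrite mem_head.
have bs : bmf (fun w => \sum_(i <- s) F i w).
  under eq_fun do rewrite big_seq.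
  by apply: bmf_sum => j js; apply: bF; rewrite inE js orbT.
under eq_fun do rewrite big_cons sqrrD.
rewrite rintD; [|apply: bmfD; first exact: bmfX|exact: bmfX]; last first.
  by under eq_fun do rewrite mulr2n; apply: bmfD; exact: bmfM.
rewrite rintD; [|exact: bmfX|]; last first.
  by under eq_fun do rewrite mulr2n; apply: bmfD; exact: bmfM.
rewrite Fv ?mem_head// IH//; last 3 first.
- by move=> j js; apply: bF; rewrite inE js orbT.
- by move=> j js; apply: Fv; rewrite inE js orbT.
- by move=> j k js ks; apply: FF; rewrite inE ?js ?ks orbT.
have -> : rint Pr (fun w => (F i w * \sum_(j <- s) F j w) *+ 2) = 0.
  under eq_fun do rewrite -mulr_natl.
  rewrite rintZ; last exact: bmfM.
  under eq_fun do rewrite big_seq mulr_sumr.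
  rewrite rint_sum; last by move=> j js; apply: bmfM => //; apply: bF; rewrite inE js orbT.
  rewrite big1 ?mulr0// => j js; apply: FF; rewrite ?mem_head// ?inE ?js ?orbT//.
  by apply: contraNneq si => ->.
by rewrite addr0 -addn1 natrD mulrDl mul1r addrC.
Qed.

(* The last clause says that every index below n occurs equally often: it makes
   the linear part of the Hoeffding decomposition equal to [2 * avg_h1]. *)
Definition design (n : nat) (s : seq (nat * nat)) : Prop :=
  [/\ uniq s, forall p, p \in s -> p.1 != p.2 /\ (p.2, p.1) \notin s &
    forall u : nat -> R, n%:R * \sum_(p <- s) (u p.1 + u p.2) =
      2 * (size s)%:R * \sum_(0 <= i < n) u i].

Definition avg_h1 n w : R := n%:R^-1 * \sum_(0 <= i < n) h1 (X i w).

Definition avg_h2 (s : seq (nat * nat)) w : R :=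
  (size s)%:R^-1 * \sum_(p <- s) h2 (X p.1 w) (X p.2 w).

Lemma bmf_avg_h1 n : bmf (avg_h1 n).
Proof.
apply: bmfZ; apply: bmf_sum => i _; apply: bmf_h1_comp; exact: iidX.1.
Qed.

Lemma bmf_avg_h2 s : bmf (avg_h2 s).
Proof.
by apply: bmfZ; apply: bmf_sum => p _; apply: bmf_h2_comp; exact: iidX.1.
Qed.

Lemma design_decomp n s w : (0 < n)%N -> (0 < size s)%N -> design n s ->
  (size s)%:R^-1 * \sum_(p <- s) g (X p.2 w - X p.1 w) =
  2 * avg_h1 n w + avg_h2 s w.
Proof.
move=> n0 s0 [_ _ reg].
have nR : n%:R != 0 :> R by rewrite pnatr_eq0 -lt0n.
have sR : (size s)%:R != 0 :> R by rewrite pnatr_eq0 -lt0n.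
have -> : \sum_(p <- s) g (X p.2 w - X p.1 w) =
    \sum_(p <- s) h2 (X p.1 w) (X p.2 w) +
    \sum_(p <- s) (h1 (X p.1 w) + h1 (X p.2 w)).
  rewrite -big_split/=; apply: eq_bigr => p _.
  by rewrite -geven opprB /h2; ring.
rewrite mulrDr addrC /avg_h2; congr (_ + _); rewrite /avg_h1.
apply: (mulfI nR); rewrite mulrCA (reg (fun i => h1 (X i w))).
by move: (\sum_(0 <= i < n) _) => S; field; rewrite nR sR.
Qed.

Lemma rint_sqr_avg_h1 n : (0 < n)%N ->
  rint Pr (fun w => avg_h1 n w ^+ 2) = n%:R^-1 * rint Pr (fun w => h1 (X 0%N w) ^+ 2).
Proof.
move=> n0; rewrite /avg_h1.
have nR : n%:R != 0 :> R by rewrite pnatr_eq0 -lt0n.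
have b i : bmf (fun w => h1 (X i w)) by apply: bmf_h1_comp; exact: iidX.1.
under eq_fun do rewrite exprMn.
rewrite rintZ; last by apply: bmfX; apply: bmf_sum.
rewrite (@rint_sqr_sum _ _ _ (rint Pr (fun w => h1 (X 0%N w) ^+ 2))).
- by rewrite size_iota subn0; field.
- exact: iota_uniq.
- by [].
- by move=> i _; exact: rint_h1_sqr.
- by move=> i j _ _; exact: rint_h1_h1.
Qed.

Lemma rint_sqr_avg_h2 n s : (0 < size s)%N -> design n s ->
  rint Pr (fun w => avg_h2 s w ^+ 2) =
  (size s)%:R^-1 * rint Pr (fun w => h2 (X 0%N w) (X 1%N w) ^+ 2).
Proof.
move=> s0 [us ds _]; rewrite /avg_h2.
have sR : (size s)%:R != 0 :> R by rewrite pnatr_eq0 -lt0n.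
have b p : bmf (fun w => h2 (X p.1 w) (X p.2 w)).
  by apply: bmf_h2_comp; exact: iidX.1.
under eq_fun do rewrite exprMn.
rewrite rintZ; last by apply: bmfX; apply: bmf_sum.
rewrite (@rint_sqr_sum _ s (fun p w => h2 (X p.1 w) (X p.2 w))
  (rint Pr (fun w => h2 (X 0%N w) (X 1%N w) ^+ 2)) us).
- by field.
- by move=> p _; exact: b.
- by move=> p /ds[p12 _]; exact: rint_h2_sqr.
- move=> p p' ps p's pp'; have [p1 _] := ds _ ps; have [p'1 p'2] := ds _ p's.
  apply: rint_h2_h2 => //; apply: contraNneq p'2 => <-; exact: ps.
Qed.

Lemma rint_sqr_design n s : (0 < n)%N -> (0 < size s)%N -> design n s ->
  rint Pr (fun w => ((size s)%:R^-1 * \sum_(p <- s) g (X p.2 w - X p.1 w)) ^+ 2) <=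
  8 * rint Pr (fun w => h1 (X 0%N w) ^+ 2) / n%:R +
  2 * rint Pr (fun w => h2 (X 0%N w) (X 1%N w) ^+ 2) / (size s)%:R.
Proof.
move=> n0 s0 ds; under eq_fun do rewrite (design_decomp _ n0 s0 ds).
have b1 := bmf_avg_h1 n; have b2 := bmf_avg_h2 s.
(* By (2x + y)^2 <= 8 x^2 + 2 y^2 no mixed moment of the two averages has to be computed. *)
apply: (@le_trans _ _ (rint Pr (fun w => 8 * avg_h1 n w ^+ 2 + 2 * avg_h2 s w ^+ 2))).
  apply: rint_le.
  - by apply: bmfX; apply: bmfD => //; exact: bmfZ.
  - by apply: bmfD; apply: bmfZ; exact: bmfX.
  - move=> w; move: (avg_h1 n w) (avg_h2 s w) => x y.
    by have := sqr_ge0 (2 * x - y); rewrite !expr2; lra.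
rewrite rintD; try (by apply: bmfZ; exact: bmfX).
rewrite !rintZ; try exact: bmfX.
by rewrite rint_sqr_avg_h1// (rint_sqr_avg_h2 s0 ds); lra.
Qed.

End Kernel.

(** * Central limit theorem for cyclic sums *)

Section Clt.
Context {d : measure_display} {Omega : measurableType d} {R : realType} {q : nat}.
Variables (Pr : probability Omega R) (X : nat -> Omega -> 'rV[R]_q).
Hypothesis iidX : iid Pr X.
Variables (g g' : 'rV[R]_q -> R).
Hypotheses (bg : bmf (g : Vb R q -> R)) (bg' : bmf (g' : Vb R q -> R)).
Hypothesis geven' : forall x, g' (- x) = g' x.
Hypothesis gcentered : rint Pr (fun w => g (X 0%N w - X 1%N w)) = 0.
Hypothesis gcentered' : rint Pr (fun w => g' (X 0%N w - X 1%N w)) = 0.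
Local Notation a := (h1 Pr X g).
Local Notation b := (h2 Pr X g').
Variable dd : nat.
Hypothesis dd0 : (0 < dd)%N.
Variable M : R.
Hypotheses (aM : forall x, `|a x| <= M) (bM : forall x y, `|b x y| <= M).

Let c : R := (Num.sqrt dd%:R)^-1.
Let ddR : 0 < dd%:R :> R. Proof. by rewrite ltr0n. Qed.
Let c0 : 0 <= c. Proof. by rewrite invr_ge0 sqrtr_ge0. Qed.
Let c2 : c ^+ 2 = dd%:R^-1. Proof. by rewrite exprVn sqr_sqrtr ?ltW. Qed.
Let c1 : c <= 1.
Proof. by rewrite invf_le1 ?sqrtr_gt0// -[leLHS]sqrtr1 ler_sqrt// ler1n. Qed.
Let M0 : 0 <= M. Proof. exact: le_trans (aM 0). Qed.

(** The pairs are grouped by their later index, which makes this the increment brought by X l given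
    the earlier variables. The condition s < l leaves out the pairs that wrap around;
    [cyclic_sum_close] bounds their total. *)
Definition mdiff l w : R :=
  a (X l w) + c * \sum_(0 <= s < dd | (s < l)%N) b (X (l - s.+1)%N w) (X l w).
Definition psum k w : R := \sum_(0 <= l < k) mdiff l w.
(** The variance of a full increment: the dd orthogonal degenerate terms each carry the factor c^2 =
    1/dd, so dd cancels. *)
Definition cltvar : R := rint Pr (fun w => a (X 0%N w) ^+ 2) +
  rint Pr (fun w => b (X 0%N w) (X 1%N w) ^+ 2).

Let MD : R := M * (1 + dd%:R).
Let MD0 : 0 <= MD. Proof. by rewrite mulr_ge0// addr_ge0. Qed.

Lemma mdiff_le l w : `|mdiff l w| <= MD.
Proof.
rewrite (le_trans (ler_normD _ _))// /MD mulrDr mulr1 lerD//.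
rewrite normrM (ger0_norm c0) mulrC -[leRHS]mulr1 ler_pM//.
apply: (le_trans (ler_norm_sum _ _ _)).
rewrite mulr_natr -[X in M *+ X]subn0 -sumr_const_nat big_mkcond/=.
by apply: ler_sum => s _; case: ifP.
Qed.

Lemma bmf_mdiff (I : set nat) l : (forall i, (l - dd <= i <= l)%N -> I i) ->
  bmf (mdiff l : past X I -> R).
Proof.
move=> H.
have mi i : (l - dd <= i <= l)%N -> measurable_fun setT (X i : past X I -> Vb R q).
  by move=> /H Ii; exact: measurable_past.
have ml := mi l; rewrite leq_subr leqnn in ml.
apply: bmfD; first by apply: (bmf_h1_comp iidX) => //; exact: ml.
apply: bmfZ; rewrite [X in bmf X](_ : _ = (fun w => \sum_(0 <= s < dd | (s < dd)%N && (s < l)%N)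
    b (X (l - s.+1)%N w) (X l w))); last first.
  apply/funext => w; rewrite big_nat_cond [RHS]big_nat_cond; apply: eq_bigl => s.
  by case: ltnP => //=; rewrite ?andbF// andbT.
apply: bmf_sum => s /andP[sd sl]; apply: (bmf_h2_comp iidX) => //; last exact: ml.
by apply: mi; rewrite leq_sub2l// leq_subr.
Qed.

Lemma bmf_psum (I : set nat) k : (forall i, (i < k)%N -> I i) ->
  bmf (psum k : past X I -> R).
Proof.
move=> H; rewrite /psum; under eq_fun do rewrite big_nat.
apply: bmf_sum => l /= lk; apply: bmf_mdiff => i /andP[_ il]; apply: H.
exact: leq_ltn_trans il lk.
Qed.

Lemma bmf_past (I : set nat) (f : Omega -> R) : bmf (f : past X I -> R) -> bmf f.
Proof. by move=> bf; exact: (bmf_comp (measurable_past_id iidX (I := I)) bf). Qed.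

Lemma rint_mdiff_sqr l : (dd <= l)%N ->
  rint Pr (fun w => mdiff l w ^+ 2) = cltvar.
Proof.
move=> dl.
pose B s w := b (X (l - s.+1)%N w) (X l w).
have lt s : (s < dd)%N -> (l - s.+1 < l)%N by move=> sd; lia.
have bB s : bmf (B s) by apply: (bmf_h2_comp iidX) => //; exact: iidX.1.
have bA : bmf (fun w => a (X l w)) by apply: (bmf_h1_comp iidX) => //; exact: iidX.1.
have E w : mdiff l w = a (X l w) + c * \sum_(s <- index_iota 0 dd) B s w.
  rewrite /mdiff; congr (_ + _ * _); rewrite big_nat_cond [RHS]big_nat_cond.
  by apply: eq_bigl => s; rewrite andbT; apply: andb_idr; lia.
have bS : bmf (fun w => \sum_(s <- index_iota 0 dd) B s w) by apply: bmf_sum.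
under eq_fun do rewrite E sqrrD.
have bcr : bmf (fun w => a (X l w) * (c * \sum_(s <- index_iota 0 dd) B s w) *+ 2).
  by under eq_fun do rewrite -mulr_natl; apply: bmfZ; apply: bmfM => //; exact: bmfZ.
rewrite rintD; [|apply: bmfD => //; exact: bmfX|by apply: bmfX; exact: bmfZ].
rewrite rintD//; last exact: bmfX.
rewrite (rint_h1_sqr iidX bg) /cltvar -addrA; congr (_ + _).
(* The cross term vanishes by integrating out the earlier variable of each pair, on which the linear
   part does not depend. *)
have -> : rint Pr (fun w => a (X l w) * (c * \sum_(s <- index_iota 0 dd) B s w) *+ 2) = 0.
  have -> : (fun w => a (X l w) * (c * \sum_(s <- index_iota 0 dd) B s w) *+ 2) =
      (fun w => 2 * c * (a (X l w) * \sum_(s <- index_iota 0 dd) B s w)).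
    by apply/funext => w; rewrite -mulr_natl; ring.
  rewrite rintZ; last exact: bmfM.
  under eq_fun do rewrite big_nat mulr_sumr.
  rewrite rint_sum; last by move=> s _; exact: bmfM.
  rewrite big1 ?mulr0// => s /= sd; rewrite /B.
  under eq_fun do rewrite (h2C Pr X geven').
  apply: (@rint_mul_h2 _ _ _ _ _ _ iidX _ bg' gcentered' [set l]) => //.
    by move=> /= e; have := lt s sd; rewrite e ltnn.
  by apply: (bmf_h1_comp iidX) => //; exact: measurable_past.
rewrite add0r.
under eq_fun do rewrite exprMn.
rewrite rintZ; last exact: bmfX.
have us : uniq (index_iota 0 dd) by exact: iota_uniq.
rewrite (rint_sqr_sum us (v := rint Pr (fun w => b (X 0%N w) (X 1%N w) ^+ 2))).
- by rewrite size_iota subn0 c2 mulrA mulVf ?mul1r// gt_eqF.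
- by move=> s _; exact: bB.
- move=> s; rewrite mem_index_iota => /andP[_ sd].
  by apply: (rint_h2_sqr iidX bg'); rewrite neq_ltn lt.
- move=> s t; rewrite !mem_index_iota => /andP[_ sd] /andP[_ td] st.
  apply: (rint_h2_h2 iidX bg' geven' gcentered' (p := (_, _)) (p' := (_, _))) => /=.
  + by rewrite neq_ltn lt.
  + by rewrite neq_ltn lt.
  + by rewrite xpair_eqE eqxx andbT; lia.
  + by rewrite xpair_eqE; have := lt s sd; lia.
Qed.

Lemma cltvar_ge0 : 0 <= cltvar.
Proof. by rewrite addr_ge0//; apply: rint_ge0 => w; exact: sqr_ge0. Qed.

Variables (r th : R).
Hypothesis r0 : 0 <= r.
Let phi k := rint Pr (fun w => cos (r * psum k w + th)).

Let bps k : bmf (psum k).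
Proof. by apply: (@bmf_past setT); exact: bmf_psum. Qed.

Let bmd k : bmf (mdiff k).
Proof. by apply: (@bmf_past setT); exact: bmf_mdiff. Qed.

Let bcos k : bmf (fun w => cos (r * psum k w + th)).
Proof. by apply: bmf_cos; apply: measurable_funD => //; apply: measurable_funM => //; exact: (bps k).1. Qed.

Let bsin k : bmf (fun w => sin (r * psum k w + th)).
Proof. by apply: bmf_sin; apply: measurable_funD => //; apply: measurable_funM => //; exact: (bps k).1. Qed.

Lemma psum_cos_lip k l w : (k <= l)%N ->
  `|cos (r * psum l w + th) - cos (r * psum k w + th)| <= r * (l - k)%:R * MD.
Proof.
move=> kl; rewrite (le_trans (cos_lip _ _))//.
rewrite opprD addrACA subrr addr0 -mulrBr normrM (ger0_norm r0) -mulrA ler_wpM2l//.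
rewrite /psum (big_cat_nat (n := k))//= addrAC subrr add0r.
apply: (le_trans (ler_norm_sum _ _ _)).
rewrite mulr_natl -sumr_const_nat; apply: ler_sum => i _; exact: mdiff_le.
Qed.

(* [mdiff k] is independent of [psum (k - dd)]; passing to this partial sum
   costs only a third-order error. *)
Lemma phi_step k : (dd <= k)%N ->
  `|phi k.+1 - (1 - r ^+ 2 * cltvar / 2) * phi k| <= (2 + dd%:R) * MD ^+ 3 * r ^+ 3.
Proof.
move=> dk.
(* The third-order Taylor remainder of cos for the increment [r * mdiff k w]. *)
pose Rm w := cos (r * psum k.+1 w + th) - cos (r * psum k w + th)
  + r * (mdiff k w * sin (r * psum k w + th))
  + r ^+ 2 / 2 * (mdiff k w ^+ 2 * cos (r * psum k w + th)).
have bds : bmf (fun w => mdiff k w * sin (r * psum k w + th)) by exact: bmfM.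
have bdc l : bmf (fun w => mdiff k w ^+ 2 * cos (r * psum l w + th)).
  by apply: bmfM => //; exact: bmfX.
have bRm : bmf Rm.
  by apply: bmfD; [apply: bmfD; [exact: bmfB|exact: bmfZ]|exact: bmfZ].
have Rm_le w : `|Rm w| <= 2 * (MD ^+ 3 * r ^+ 3).
  have := cos_taylor3 (r * psum k w + th) (r * mdiff k w).
  have -> : r * psum k w + th + r * mdiff k w = r * psum k.+1 w + th.
    by rewrite /psum big_nat_recr//=; ring.
  rewrite (_ : _ + _ + _ = Rm w); last by rewrite /Rm; field.
  move=> /le_trans; apply; rewrite ler_wpM2l// normrM exprMn (ger0_norm r0) mulrC.
  by rewrite ler_wpM2r ?exprn_ge0// lerXn2r ?nnegrE// mdiff_le.
have ERm : rint Pr Rm = phi k.+1 - phi k +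
    r * rint Pr (fun w => mdiff k w * sin (r * psum k w + th)) +
    r ^+ 2 / 2 * rint Pr (fun w => mdiff k w ^+ 2 * cos (r * psum k w + th)).
  rewrite /Rm rintD; [|by apply: bmfD; [exact: bmfB|exact: bmfZ]|exact: bmfZ].
  by rewrite rintD; [rewrite rintB// !rintZ|exact: bmfB|exact: bmfZ].
(* The first-order term vanishes: the sine depends on the X i with i < k only, and integrating out X
   k annihilates every term of [mdiff k]. *)
have E0 : rint Pr (fun w => mdiff k w * sin (r * psum k w + th)) = 0.
  have bs : bmf ((fun w => sin (r * psum k w + th)) : past X [set i | (i < k)%N] -> R).
    apply: bmf_sin; apply: measurable_funD => //; apply: measurable_funM => //.
    exact: (@bmf_psum [set i | (i < k)%N] k (fun i ik => ik)).1.
  have bA : bmf (fun w => a (X k w)) by apply: (bmf_h1_comp iidX) => //; exact: iidX.1.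
  have bB s : bmf (fun w => b (X (k - s.+1)%N w) (X k w)).
    by apply: (bmf_h2_comp iidX) => //; exact: iidX.1.
  have -> : (fun w => mdiff k w * sin (r * psum k w + th)) =
      (fun w => sin (r * psum k w + th) * a (X k w) + c * \sum_(0 <= s < dd | (s < k)%N)
        sin (r * psum k w + th) * b (X (k - s.+1)%N w) (X k w)).
    apply/funext => w; rewrite mulrC /mdiff mulrDr mulrCA; congr (_ + _ * _).
    by rewrite mulr_sumr.
  rewrite rintD; [|exact: bmfM|]; last first.
    by apply: bmfZ; apply: bmf_sum => s _; exact: bmfM.
  rewrite (@rint_mul_h1 _ _ _ _ _ _ iidX _ bg gcentered [set i | (i < k)%N])//; last first.
    by rewrite /= ltnn.
  rewrite add0r rintZ; last by apply: bmf_sum => s _; exact: bmfM.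
  rewrite rint_sum; last by move=> s _; exact: bmfM.
  rewrite big1 ?mulr0// => s sk.
  apply: (@rint_mul_h2 _ _ _ _ _ _ iidX _ bg' gcentered' [set i | (i < k)%N]) => //=.
    by lia.
  by rewrite ltnn.
have Eprod : rint Pr (fun w => mdiff k w ^+ 2 * cos (r * psum (k - dd)%N w + th)) =
    cltvar * phi (k - dd)%N.
  pose I : set nat := [set i | (k - dd <= i)%N].
  pose J : set nat := [set i | (i < k - dd)%N].
  have bF : bmf (fun z : past X I * past X J =>
      mdiff k z.1 ^+ 2 * cos (r * psum (k - dd)%N z.2 + th)).
    apply: bmfM.
      apply: bmfX; apply: (bmf_comp measurable_fst (f := (mdiff k : past X I -> R))).
      by apply: bmf_mdiff => i /andP[].
    apply: bmf_cos; apply: measurable_funD => //; apply: measurable_funM => //.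
    apply: (bmf_comp measurable_snd (f := (psum (k - dd)%N : past X J -> R)) _).1.
    exact: bmf_psum.
  rewrite (decouple iidX _ bF); last by rewrite /I /J => i /=; lia.
  rewrite /=; under eq_fun do rewrite rintZ// mulrC.
  by rewrite rintZ; [rewrite rint_mdiff_sqr// mulrC|exact: bmfX].
(* The factor 2 counts two changes of partial sum: from k to k - dd inside the product, and back to
   k in [phi] once the product has split. *)
have close : `|rint Pr (fun w => mdiff k w ^+ 2 * cos (r * psum k w + th)) - cltvar * phi k|
    <= 2 * (MD ^+ 3 * (r * dd%:R)).
  have kd : (k - (k - dd))%N = dd by lia.
  have l1 : `|phi k - phi (k - dd)%N| <= r * dd%:R * MD.
    rewrite /phi -rintB//; apply: rint_norm_le => [|w]; first exact: bmfB.
    by have := psum_cos_lip w (leq_subr dd k); rewrite kd.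
  have sD w : `|mdiff k w ^+ 2| <= MD ^+ 2.
    by rewrite normrX lerXn2r ?nnegrE// mdiff_le.
  have l2 : `|rint Pr (fun w => mdiff k w ^+ 2 * cos (r * psum k w + th)) -
      cltvar * phi (k - dd)%N| <= MD ^+ 2 * (r * dd%:R * MD).
    rewrite -Eprod -rintB//; apply: rint_norm_le => [|w]; first exact: bmfB.
    rewrite -mulrBr normrM ler_pM//.
    by have := psum_cos_lip w (leq_subr dd k); rewrite kd.
  have vle : cltvar <= MD ^+ 2.
    rewrite -(rint_mdiff_sqr dk) (le_trans (ler_norm _))//.
    by apply: rint_norm_le => //; exact: bmfX.
  have l3 : `|cltvar * phi (k - dd)%N - cltvar * phi k| <= MD ^+ 2 * (r * dd%:R * MD).
    by rewrite -mulrBr normrM distrC ler_pM// ger0_norm ?cltvar_ge0.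
  rewrite -(subrKA (cltvar * phi (k - dd)%N)) (le_trans (ler_normD _ _))//.
  rewrite (_ : 2 * _ = MD ^+ 2 * (r * dd%:R * MD) + MD ^+ 2 * (r * dd%:R * MD)); last by ring.
  exact: lerD.
rewrite E0 mulr0 addr0 in ERm.
rewrite (_ : _ - _ = rint Pr Rm - r ^+ 2 / 2 *
   (rint Pr (fun w => mdiff k w ^+ 2 * cos (r * psum k w + th)) - cltvar * phi k)); last first.
  by rewrite ERm; field.
rewrite (le_trans (ler_normB _ _))// (_ : _ * r ^+ 3 = 2 * (MD ^+ 3 * r ^+ 3) +
   r ^+ 2 / 2 * (2 * (MD ^+ 3 * (r * dd%:R)))); last by field.
apply: lerD; first exact: rint_norm_le.
by rewrite normrM ger0_norm ?divr_ge0 ?exprn_ge0// ler_wpM2l// divr_ge0// exprn_ge0.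
Qed.

(** The upper bound follows from exp y >= 1 + y and (1 - y + y^2)(1 + y) = 1 + y^3 >= 1. *)
Lemma expRN_taylor (y : R) : 0 <= y -> `|expR (- y) - (1 - y)| <= y ^+ 2.
Proof.
move=> y0.
have lo : 1 - y <= expR (- y) by exact: expR_ge1Dx.
have hi : expR (- y) <= 1 - y + y ^+ 2.
  have y1 : 0 < 1 + y by rewrite ltr_wpDr.
  rewrite expRN (@le_trans _ _ (1 + y)^-1)//.
    by rewrite lef_pV2 ?posrE ?expR_gt0//; exact: expR_ge1Dx.
  rewrite -[leLHS]mul1r ler_pdivrMr//.
  by have := exprn_ge0 3 y0; rewrite !exprS expr0; lra.
by rewrite ger0_norm ?subr_ge0//; lra.
Qed.

(** Here r = n^(-1/2). Of the constant, the first and third terms are the accumulated step errors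
    (Taylor remainder, and exp(-y) in place of 1 - y), the second is the cost of starting at dd,
    where [phi_step] becomes available, and the last corrects the exponent for the dd missing
    steps. *)
Lemma phi_limit n : (dd <= n)%N -> r ^+ 2 * n%:R = 1 -> r <= 1 ->
  `|phi n - expR (- (cltvar / 2)) * cos th| <=
  ((2 + dd%:R) * MD ^+ 3 + dd%:R * MD + cltvar ^+ 2 + cltvar * dd%:R) * r.
Proof.
move=> dn rn r1; pose v := cltvar; have v0 : 0 <= v := cltvar_ge0.
pose y := r ^+ 2 * v / 2.
have y0 : 0 <= y by rewrite divr_ge0// mulr_ge0// exprn_ge0.
pose er := (2 + dd%:R) * MD ^+ 3 * r ^+ 3 + y ^+ 2.
have phi1 k : `|phi k| <= 1 by apply: rint_norm_le => // w; exact: cos_max.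
have step k : (dd <= k)%N -> `|phi k.+1 - expR (- y) * phi k| <= er.
  move=> dk; rewrite (_ : _ - _ = (phi k.+1 - (1 - y) * phi k) -
     (expR (- y) - (1 - y)) * phi k); last by ring.
  rewrite (le_trans (ler_normB _ _))// lerD//; first exact: phi_step.
  by rewrite normrM -[leRHS]mulr1 ler_pM//; exact: expRN_taylor.
have iterate m : `|phi (dd + m)%N - expR (- y) ^+ m * phi dd| <= m%:R * er.
  elim: m => [|m IH]; first by rewrite addn0 expr0 mul1r subrr normr0 mul0r.
  rewrite addnS (_ : _ - _ = (phi (dd + m).+1 - expR (- y) * phi (dd + m)%N) +
     expR (- y) * (phi (dd + m)%N - expR (- y) ^+ m * phi dd)); last by rewrite exprS; ring.
  rewrite (le_trans (ler_normD _ _))// -natr1 mulrDl mul1r addrC lerD//.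
    rewrite normrM -[leRHS]mul1r ler_pM// ger0_norm ?expR_ge0//.
    by rewrite -[leRHS]expR0 ler_expR oppr_le0.
  by apply: step; rewrite leq_addr.
have := iterate (n - dd)%N; rewrite subnKC//.
rewrite -expRM_natr => It.
have phid : `|phi dd - cos th| <= r * dd%:R * MD.
  rewrite -[cos th](rint_cst Pr) -rintB//; last exact: bmf_cst.
  apply: rint_norm_le => [|w]; first by apply: bmfB => //; exact: bmf_cst.
  have p0 : psum 0 w = 0 by rewrite /psum big_geq.
  by have := psum_cos_lip w (leq0n dd); rewrite subn0 p0 mulr0 add0r.
have ny : n%:R * y = v / 2.
  rewrite /y (_ : _ * _ = r ^+ 2 * n%:R * v / 2); last by ring.
  by rewrite rn mul1r.
(* Only n - dd steps are made, whereas n steps would give the exponent -v/2 exactly. *)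
have ex : `|expR (- y * (n - dd)%:R) - expR (- (v / 2))| <= dd%:R * y.
  have -> : - y * (n - dd)%:R = - (v / 2) + y * dd%:R by rewrite natrB// -ny; ring.
  rewrite expRD -[X in _ - X]mulr1 -mulrBr.
  rewrite normrM ger0_norm ?expR_ge0//.
  have e1 : 1 <= expR (y * dd%:R) by rewrite -[leLHS]expR0 ler_expR mulr_ge0.
  rewrite ger0_norm ?subr_ge0//.
  have dny : dd%:R * y <= v / 2 by rewrite -ny ler_wpM2r// ler_nat.
  have -> : expR (- (v / 2)) * (expR (y * dd%:R) - 1) =
      expR (- (v / 2) + y * dd%:R) * (1 - expR (- (y * dd%:R))).
    by rewrite mulrBr mulrBr !mulr1 -!expRD addrK.
  rewrite -[leRHS]mul1r ler_pM ?expR_ge0//.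
  - by rewrite subr_ge0 -[leRHS]expR0 ler_expR oppr_le0 mulr_ge0.
  - by rewrite -[leRHS]expR0 ler_expR; move: dny; rewrite mulrC; lra.
  - by have := expR_ge1Dx (- (y * dd%:R)); rewrite mulrC; lra.
have E1 : expR (- y * (n - dd)%:R) <= 1.
  by rewrite -[leRHS]expR0 ler_expR mulNr oppr_le0 mulr_ge0.
rewrite (_ : _ - _ = (phi n - expR (- y * (n - dd)%:R) * phi dd) +
   expR (- y * (n - dd)%:R) * (phi dd - cos th) +
   (expR (- y * (n - dd)%:R) - expR (- (v / 2))) * cos th); last by rewrite /v; ring.
have t2 : `|expR (- y * (n - dd)%:R) * (phi dd - cos th)| <= r * dd%:R * MD.
  by rewrite normrM -[leRHS]mul1r ler_pM// ger0_norm ?expR_ge0.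
have t3 : `|(expR (- y * (n - dd)%:R) - expR (- (v / 2))) * cos th| <= dd%:R * y.
  by rewrite normrM -[leRHS]mulr1 ler_pM// cos_max.
rewrite (le_trans (ler_normD _ _))// (le_trans (lerD (ler_normD _ _) t3))//.
have er0 : 0 <= er by rewrite addr_ge0 ?sqr_ge0// mulr_ge0 ?exprn_ge0// mulr_ge0 ?exprn_ge0// addr_ge0.
have t1 : (n - dd)%:R * er <= (2 + dd%:R) * MD ^+ 3 * r + v ^+ 2 * r.
  apply: (@le_trans _ _ (n%:R * er)); first by rewrite ler_wpM2r// ler_nat leq_subr.
  have -> : n%:R * er = (2 + dd%:R) * MD ^+ 3 * r * (r ^+ 2 * n%:R) +
     v ^+ 2 * r ^+ 2 / 4 * (r ^+ 2 * n%:R) by rewrite /er /y; field.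
  rewrite rn !mulr1 lerD2l.
  have := sqr_ge0 v; set v2 := v ^+ 2 => v20.
  have r2 : r ^+ 2 <= r by rewrite expr2 ler_piMr.
  have : v2 * r ^+ 2 <= v2 * r by rewrite ler_wpM2l.
  have : 0 <= v2 * r ^+ 2 by rewrite mulr_ge0 ?exprn_ge0.
  by lra.
have t4 : dd%:R * y <= v * dd%:R * r.
  have r2 : r ^+ 2 <= r by rewrite expr2 ler_piMr.
  rewrite /y; have : v * dd%:R * r ^+ 2 <= v * dd%:R * r by rewrite ler_wpM2l// mulr_ge0.
  have : 0 <= v * dd%:R * r ^+ 2 by rewrite !mulr_ge0// exprn_ge0.
  by lra.
rewrite -/v; move: (le_trans It t1) t2 t4.
by lra.
Qed.

End Clt.

(** * From the martingale sum to the cyclic sum *)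

Lemma cvg_divsqrt0 (R : realType) (C : R) :
  C / Num.sqrt n%:R @[n --> \oo] --> (0 : R).
Proof.
apply/cvgrPdist_lt => e e0; near=> n.
have n0 : 0 < n%:R :> R by rewrite ltr0n; near: n; exact: nbhs_infty_gt.
have s0 : 0 < Num.sqrt n%:R :> R by rewrite sqrtr_gt0.
rewrite sub0r normrN normrM normfV (ger0_norm (ltW s0)) ltr_pdivrMr// mulrC.
rewrite -ltr_pdivrMr// (_ : `|C| / e = Num.sqrt ((`|C| / e) ^+ 2)); last first.
  by rewrite sqrtr_sqr [RHS]ger0_norm// divr_ge0// ltW.
rewrite ltr_sqrt//.
by near: n; exact: nbhs_infty_gtr.
Unshelve. all: by end_near. Qed.

(** With the shift s as outer index, the two sums differ only in the last s + 1 <= dd values of i,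
    those for which the second index wraps around. *)
Lemma cyclic_sum_close (R : realType) (beta : nat -> nat -> R) (M : R) n dd :
  (forall i j, `|beta i j| <= M) -> (dd < n)%N ->
  `|\sum_(0 <= i < n) \sum_(i.+1 <= j < (i + dd).+1) beta i (j %% n)%N -
    \sum_(0 <= l < n) \sum_(0 <= s < dd | (s < l)%N) beta (l - s.+1)%N l|
  <= dd%:R * (dd%:R * M).
Proof.
move=> bM dn; have M0 : 0 <= M by exact: le_trans (bM 0%N 0%N).
have -> : \sum_(0 <= i < n) \sum_(i.+1 <= j < (i + dd).+1) beta i (j %% n)%N =
    \sum_(0 <= s < dd) \sum_(0 <= i < n) beta i ((s + i.+1) %% n)%N.
  rewrite exchange_big_nat/=; apply: eq_bigr => i _.
  by rewrite -{1}[i.+1]add0n big_addn subSS addKn.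
have -> : \sum_(0 <= l < n) \sum_(0 <= s < dd | (s < l)%N) beta (l - s.+1)%N l =
    \sum_(0 <= s < dd) \sum_(0 <= i < n - s.+1) beta i (i + s.+1)%N.
  under eq_bigr do rewrite big_mkcond/=.
  rewrite exchange_big_nat/= big_nat [RHS]big_nat; apply: eq_bigr => s /= sd.
  rewrite -big_mkcond/= (big_cat_nat (n := s.+1))//=; last by lia.
  rewrite big_nat_cond big1 ?add0r; last by move=> l; lia.
  rewrite big_nat_cond (eq_bigl (fun l => (s < l < n)%N)); last by move=> l; lia.
  rewrite -big_nat -{1}[s.+1]add0n big_addn; apply: eq_bigr => i _.
  by rewrite addnK.
rewrite -sumrB big_nat; apply: (le_trans (ler_norm_sum _ _ _)).
rewrite mulr_natl -[X in _ *+ X]subn0 -sumr_const_nat [leRHS]big_nat.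
apply: ler_sum => s /= sd.
rewrite (big_cat_nat (n := n - s.+1))//=; last by lia.
rewrite [X in X + _ - _](_ : _ = \sum_(0 <= i < n - s.+1) beta i (i + s.+1)%N); last first.
  rewrite big_nat [RHS]big_nat; apply: eq_bigr => i /= ilt; congr (beta _ _).
  by rewrite modn_small; lia.
rewrite addrAC subrr add0r; apply: (le_trans (ler_norm_sum _ _ _)).
apply: (@le_trans _ _ (\sum_(n - s.+1 <= i < n) M)); first by apply: ler_sum.
by rewrite sumr_const_nat -[leLHS]mulr_natl ler_wpM2r// ler_nat; lia.
Qed.

Section CyclicClt.
Context {d : measure_display} {Omega : measurableType d} {R : realType} {q : nat}.
Variables (Pr : probability Omega R) (X : nat -> Omega -> 'rV[R]_q).
Hypothesis iidX : iid Pr X.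
Variables (g g' : 'rV[R]_q -> R).
Hypotheses (bg : bmf (g : Vb R q -> R)) (bg' : bmf (g' : Vb R q -> R)).
Hypothesis geven' : forall x, g' (- x) = g' x.
Hypothesis gcentered : rint Pr (fun w => g (X 0%N w - X 1%N w)) = 0.
Hypothesis gcentered' : rint Pr (fun w => g' (X 0%N w - X 1%N w)) = 0.
Variable dd : nat.
Hypothesis dd0 : (0 < dd)%N.

(** The Cramer-Wold combination of the two statistics of (iii): g and g' are separate kernels so
    that each statistic can be tested against its own matrix. *)
Definition clt_sum n w : R :=
  (Num.sqrt n%:R)^-1 * \sum_(0 <= i < n) h1 Pr X g (X i w) +
  (Num.sqrt (n * dd)%:R)^-1 * \sum_(0 <= i < n) \sum_(i.+1 <= j < (i + dd).+1)
     h2 Pr X g' (X i w) (X (j %% n)%N w).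

Lemma clt_cyclic th : rint Pr (fun w => cos (clt_sum n w + th)) @[n --> \oo] -->
  expR (- (cltvar Pr X g g' / 2)) * cos th.
Proof.
have [M1 aM1] := (bmf_h1 iidX bg).2; have [M2 bM2] := (bmf_h2 iidX bg').2.
pose M := Num.max M1 M2.
have aM x : `|h1 Pr X g x| <= M by rewrite le_max aM1.
have bM x y : `|h2 Pr X g' x y| <= M by rewrite le_max (bM2 (x, y)) orbT.
have M0 : 0 <= M := le_trans (normr_ge0 _) (aM 0).
pose MD := M * (1 + dd%:R); pose v := cltvar Pr X g g'.
pose C := (2 + dd%:R) * MD ^+ 3 + dd%:R * MD + v ^+ 2 + v * dd%:R + dd%:R * (dd%:R * M).
apply/cvgrPdist_lt => e e0.
have /cvgrPdist_lt/(_ _ e0) cC := cvg_divsqrt0 C.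
near=> n.
have nd : (dd < n)%N by near: n; exact: nbhs_infty_gt.
have n0 : 0 < n%:R :> R by rewrite ltr0n (leq_ltn_trans _ nd).
pose r : R := (Num.sqrt n%:R)^-1.
have r0 : 0 <= r by rewrite invr_ge0 sqrtr_ge0.
have rn : r ^+ 2 * n%:R = 1 by rewrite exprVn sqr_sqrtr ?ltW// mulVf// gt_eqF.
have r1 : r <= 1.
  by rewrite invf_le1 ?sqrtr_gt0// -[leLHS]sqrtr1 ler_sqrt// ler1n (leq_ltn_trans _ nd).
have Hlim := phi_limit iidX bg bg' geven' gcentered gcentered' dd0 aM bM th r0 (ltnW nd) rn r1.
have bT : bmf (fun w => cos (clt_sum n w + th)).
  apply: bmf_cos; apply: measurable_funD => //; apply: measurable_funD.
    apply: measurable_funM => //; apply: measurable_sum => i.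
    by apply: (bmf_h1_comp iidX bg _).1; exact: iidX.1.
  apply: measurable_funM => //; apply: measurable_sum => i; apply: measurable_sum => j.
  by apply: (bmf_h2_comp iidX bg' _ _).1; exact: iidX.1.
have bS : bmf (fun w => cos (r * psum Pr X g g' dd n w + th)).
  apply: bmf_cos; apply: measurable_funD => //; apply: measurable_funM => //.
  apply: (@bmf_past _ _ _ _ _ _ iidX setT _ _).1.
  exact: (bmf_psum iidX bg bg').
have close w : `|cos (clt_sum n w + th) - cos (r * psum Pr X g g' dd n w + th)| <=
    dd%:R * (dd%:R * M) * r.
  rewrite (le_trans (cos_lip _ _))// opprD addrACA subrr addr0.
  have -> : clt_sum n w - r * psum Pr X g g' dd n w = r * (Num.sqrt dd%:R)^-1 *
     (\sum_(0 <= i < n) \sum_(i.+1 <= j < (i + dd).+1)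
        h2 Pr X g' (X i w) (X (j %% n)%N w) -
      \sum_(0 <= l < n) \sum_(0 <= s < dd | (s < l)%N)
        h2 Pr X g' (X (l - s.+1)%N w) (X l w)).
    rewrite /clt_sum /psum /mdiff big_split/= -mulr_sumr natrM sqrtrM ?ler0n//.
    by rewrite invfM -/r; ring.
  rewrite normrM mulrC ler_pM//; last first.
    rewrite ger0_norm ?mulr_ge0 ?invr_ge0 ?sqrtr_ge0// ler_piMr//.
    by rewrite invf_le1 ?sqrtr_gt0 ?ltr0n// -[leLHS]sqrtr1 ler_sqrt// ler1n.
  by apply: (@cyclic_sum_close R (fun i j => h2 Pr X g' (X i w) (X j w))).
have close' : `|rint Pr (fun w => cos (clt_sum n w + th)) -
    rint Pr (fun w => cos (r * psum Pr X g g' dd n w + th))| <= dd%:R * (dd%:R * M) * r.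
  by rewrite -rintB//; apply: rint_norm_le => //; exact: bmfB.
have : `|0 - C / Num.sqrt n%:R| < e by near: n.
rewrite sub0r normrN distrC => /(le_lt_trans (ler_norm _)); apply: le_lt_trans.
rewrite -(subrKA (rint Pr (fun w => cos (r * psum Pr X g g' dd n w + th)))).
rewrite (le_trans (ler_normD _ _))// (le_trans (lerD close' Hlim))//.
by rewrite /C -/v -/r -/MD -mulrDl addrC.
Unshelve. all: by end_near. Qed.

End CyclicClt.

(** * The empirical designs *)

Lemma modn_lt2 m n : (m < n + n)%N -> (m %% n)%N = (if (m < n)%N then m else m - n)%N.
Proof.
move=> mn; case: ltnP => nm; first by rewrite modn_small.
by rewrite -[in LHS](subnK nm) modnDr modn_small; lia.
Qed.

(** A window of d < n consecutive indices meets every residue class at most once; this makes the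
    list of cyclic pairs duplicate-free. *)
Lemma modn_window_inj (n d i j j' : nat) : (d < n)%N -> (i < n)%N ->
  (i < j <= i + d)%N -> (i < j' <= i + d)%N -> j = j' %[mod n] -> j = j'.
Proof.
move=> dn lin hj hj'.
have jn : (j < n + n)%N by lia.
have j'n : (j' < n + n)%N by lia.
by rewrite (modn_lt2 jn) (modn_lt2 j'n); case: ltnP => ?; case: ltnP => ?; lia.
Qed.

(** Two forward moves advance by t + t', and 0 < t + t' <= 2d < n, so they cannot return to the
    start. This is where d <= (n - 1)/2 enters: no pair is listed together with its reversal. *)
Lemma cyclic_no_return (n d a b t t' : nat) : (2 * d < n)%N -> (0 < t <= d)%N ->
  b = (if (a + t < n)%N then a + t else a + t - n)%N -> (0 < t' <= d)%N ->
  a = (if (b + t' < n)%N then b + t' else b + t' - n)%N -> False.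
Proof. by move=> ? ? + ? +; case: ltnP => ? ?; case: ltnP => ? ?; lia. Qed.

Definition pairs_all (n : nat) : seq (nat * nat) :=
  [seq (i, j) | j <- index_iota 0 n, i <- index_iota 0 j].

Definition pairs_cyc (n d : nat) : seq (nat * nat) :=
  [seq (i, (j %% n)%N) | i <- index_iota 0 n, j <- index_iota i.+1 (i + d).+1].

Lemma size_pairs_all n : size (pairs_all n) = 'C(n, 2).
Proof.
rewrite -sum1_size /pairs_all big_allpairs_dep/= -bin2_sum; apply: eq_bigr => j _.
by rewrite sum1_size size_iota subn0.
Qed.

Lemma size_pairs_cyc n d : size (pairs_cyc n d) = (n * d)%N.
Proof.
rewrite -sum1_size /pairs_cyc big_allpairs_dep/= (eq_bigr (fun=> d)); last first.
  by move=> i _; rewrite sum1_size size_iota subSS addKn.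
by rewrite sum_nat_const_nat subn0.
Qed.

Section Designs.
Variable R : realType.

(** Every index belongs to n - 1 pairs; the second sum on the left avoids the subtraction. *)
Lemma sum_pairs_all (u : nat -> R) n :
  \sum_(p <- pairs_all n) (u p.1 + u p.2) + \sum_(0 <= i < n) u i =
  n%:R * \sum_(0 <= i < n) u i.
Proof.
rewrite /pairs_all big_allpairs_dep/=; elim: n => [|n IH].
  by rewrite !big_geq// addr0 mul0r.
rewrite !(big_nat_recr n)//= big_split/= sumr_const_nat subn0 -natr1 mulrDl mul1r.
by rewrite mulrDr -IH -[_ *+ n]mulr_natl; ring.
Qed.

Lemma design_pairs_all n : @design R n (pairs_all n).
Proof.
have memP p : p \in pairs_all n -> (p.1 < p.2)%N.
  by move=> /allpairsPdep[j [i [_ + ->]]]; rewrite mem_index_iota.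
split.
- apply: allpairs_uniq_dep; first exact: iota_uniq.
    by move=> j _; exact: iota_uniq.
  by move=> [j i] [j' i'] _ _ /= [-> ->].
- move=> p ps; have lt := memP _ ps; split; first by rewrite neq_ltn lt.
  by apply: contraL (lt) => /memP/=; rewrite -leqNgt => /ltnW.
(* The constant function 1 counts the pairs: twice their number plus n equals n * n. *)
- move=> u; have E := sum_pairs_all u n; have E1 := sum_pairs_all (fun=> 1) n.
  rewrite big_const_seq iter_addr addr0 count_predT in E1.
  rewrite sumr_const_nat subn0 in E1.
  have -> : \sum_(p <- pairs_all n) (u p.1 + u p.2) = (n%:R - 1) * \sum_(0 <= i < n) u i.
    by rewrite mulrBl mul1r -E addrK.
  rewrite mulrA; congr (_ * _).
  by rewrite mulrBr mulr1 -E1 addrK -[LHS]mulr_natr.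
Qed.

Lemma sum_rot (u : nat -> R) n t : (0 < n)%N ->
  \sum_(0 <= i < n) u ((i + t) %% n)%N = \sum_(0 <= i < n) u i.
Proof.
move=> n0; elim: t => [|t IH].
  by rewrite big_nat [RHS]big_nat; apply: eq_bigr => i /= lin; rewrite addn0 modn_small.
rewrite -IH; case: n n0 {IH} => // n _.
rewrite big_nat_recr//= [RHS]big_nat_recl//= addrC; congr (_ + _).
  by rewrite add0n -[(n + t.+1)%N]addSnnS addnC modnDr.
by apply: eq_bigr => i _; rewrite addnS addSn.
Qed.

Lemma design_pairs_cyc n d : (2 * d < n)%N -> @design R n (pairs_cyc n d).
Proof.
move=> dn.
have memP p : p \in pairs_cyc n d -> exists t, [/\ (0 < t <= d)%N, (p.1 < n)%N &
    p.2 = if (p.1 + t < n)%N then (p.1 + t)%N else (p.1 + t - n)%N].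
  move=> /allpairsPdep[i [j [+ + ->]]]; rewrite !mem_index_iota /= => ilt jlt.
  exists (j - i)%N; split; [lia|lia|].
  by rewrite subnKC ?modn_lt2//; lia.
split.
- apply: allpairs_uniq_dep; first exact: iota_uniq.
    by move=> i _; exact: iota_uniq.
  move=> [i j] [i' j'] /allpairsPdep[i0 [j0 [i0n j0n [-> ->]]]].
  move=> /allpairsPdep[i1 [j1 [i1n j1n [-> ->]]]] /= [e1].
  move: i0n j0n i1n j1n; rewrite !mem_index_iota e1 => *; congr existT.
  by apply: (@modn_window_inj n d i1) => //; lia.
- move=> p ps; have [t [t0 pn pE]] := memP _ ps; split.
    by rewrite pE; case: ltnP; lia.
  apply/negP => /memP[t' [t'0 /= p'n p'E]].
  exact: (cyclic_no_return dn t0 pE t'0 p'E).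
- move=> u; rewrite size_pairs_cyc natrM /pairs_cyc big_allpairs_dep/=.
  rewrite (_ : \sum_(0 <= i < n) _ = 2 * d%:R * \sum_(0 <= i < n) u i); first by ring.
  transitivity (\sum_(0 <= i < n) \sum_(0 <= s < d) (u i + u ((i + s.+1) %% n)%N)).
    apply: eq_bigr => i _; rewrite -{1}[i.+1]add0n big_addn subSS addKn.
    by apply: eq_bigr => s _; rewrite addnC addSnnS.
  under eq_bigr do rewrite big_split/= sumr_const_nat subn0.
  rewrite big_split/= exchange_big_nat/= (eq_bigr (fun i => d%:R * u i)); last first.
    by move=> i _; rewrite mulr_natl.
  rewrite -mulr_sumr [X in _ + X](eq_bigr (fun=> \sum_(0 <= i < n) u i)); last first.
    by move=> s _; apply: sum_rot; lia.
  by rewrite sumr_const_nat subn0 -[_ *+ d]mulr_natl; ring.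
Qed.

End Designs.

(** * Symmetrised empirical measures of a design *)

Section DesignMeasure.
Context {R : realType} {q : nat} {T : Type}.
Variables (X : nat -> T -> 'rV[R]_q).
Implicit Types (s : seq (nat * nat)) (w : T).

(** Common form of [Qhat] and [Qhatd], so that one argument about designs serves both estimators. *)
Definition Qs s w : Dist R q := fun A =>
  (((size s)%:R^-1)%:E * \sum_(p <- s) dsym (X p.2 w - X p.1 w)%R A)%E.

Lemma Qhat_Qs n w : Qhat X n w = Qs (pairs_all n) w.
Proof.
apply/funext => A; rewrite /Qhat /Qs size_pairs_all; congr (_ * _)%E.
by rewrite /pairs_all big_allpairs_dep.
Qed.

Lemma Qhatd_Qs n d w : Qhatd X n d w = Qs (pairs_cyc n d) w.
Proof.
apply/funext => A; rewrite /Qhatd /Qs size_pairs_cyc; congr (_ * _)%E.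
by rewrite /pairs_cyc big_allpairs_dep.
Qed.

Let half_nneg : 0 <= 2^-1 :> R. Proof. by rewrite invr_ge0. Qed.
Let sinv_nneg s : 0 <= (size s)%:R^-1 :> R. Proof. by rewrite invr_ge0. Qed.

Definition dsym_measure (z : 'rV[R]_q) : {measure set (Vb R q) -> \bar R} :=
  mscale (NngNum half_nneg) (measure_add (@dirac _ (Vb R q) z R) (@dirac _ (Vb R q) (- z) R)).

(** The set function [Qs] rebuilt from operations on measures, from which it inherits countable
    additivity. *)
Definition Qs_measure s w : set (Vb R q) -> \bar R :=
  mscale (NngNum (sinv_nneg s))
    (msum (fun k => dsym_measure (X (nth (0, 0)%N s k).2 w - X (nth (0, 0)%N s k).1 w))
       (size s)).

HB.instance Definition _ s w := Measure.copy (Qs_measure s w)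
  (mscale (NngNum (sinv_nneg s))
    (msum (fun k => dsym_measure (X (nth (0, 0)%N s k).2 w - X (nth (0, 0)%N s k).1 w))
       (size s))).

Lemma dsym_measureE z A : dsym_measure z A = dsym z A.
Proof. exact: (congr1 (fun t => (2^-1)%:E * t)%E (measure_addE _ _ A)). Qed.

Lemma Qs_measureE s w A : Qs_measure s w A = Qs s w A.
Proof.
rewrite /Qs /Qs_measure /= /mscale /= /msum; congr (_ * _)%E.
rewrite (big_nth (0, 0)%N) big_mkord; apply: eq_bigr => k _.
exact: dsym_measureE.
Qed.

Lemma Qs_setT s w : (0 < size s)%N -> Qs s w setT = 1%E.
Proof.
move=> s0; rewrite /Qs (eq_bigr (fun=> 1%E)); last first.
  by move=> p _; rewrite /dsym !diracT -EFinD -EFinM mulVf.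
by rewrite sumEFin big_const_seq iter_addr addr0 count_predT -EFinM mulVf// pnatr_eq0 -lt0n.
Qed.

Lemma Qs_prob s w : (0 < size s)%N ->
  {p : probability (Vb R q) R | forall A, p A = Qs s w A}.
Proof.
move=> s0.
have mT : Qs_measure s w setT = 1%E by rewrite Qs_measureE Qs_setT.
pose p : probability (Vb R q) R :=
  HB.pack (Qs_measure s w)
    (Measure_isProbability.Build _ _ _ (Qs_measure s w) mT).
by exists p => A; rewrite -Qs_measureE.
Qed.

Lemma Qs_is_prob s w : (0 < size s)%N -> is_prob (Qs s w).
Proof. by move=> /Qs_prob-/(_ w)[p pE]; exists p. Qed.

Lemma rint_Qs s w (f : Vb R q -> R) : (0 < size s)%N -> bmf f ->
  rint (Qs s w) f = (size s)%:R^-1 *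
    \sum_(p <- s) ((f (X p.2 w - X p.1 w) + f (- (X p.2 w - X p.1 w))) / 2).
Proof.
move=> s0 bf; have [p pE] := Qs_prob w s0.
have ge0 (h : Vb R q -> R) : measurable_fun setT h -> (forall x, 0 <= h x) ->
    rint (Qs s w) h = (size s)%:R^-1 *
    \sum_(p <- s) ((h (X p.2 w - X p.1 w) + h (- (X p.2 w - X p.1 w))) / 2).
  move=> mh h0.
  have mhE : measurable_fun setT (fun x => (h x)%:E) by exact/measurable_EFinP.
  have -> : Qs s w = Qs_measure s w by apply/funext => A; rewrite Qs_measureE.
  rewrite /rint ge0_integral_mscale//=; last by move=> x _; rewrite lee_fin.
  rewrite ge0_integral_measure_sum//; last by move=> x _; rewrite lee_fin.
  pose z (k : nat) := X (nth (0, 0)%N s k).2 w - X (nth (0, 0)%N s k).1 w.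
  rewrite (eq_bigr (fun k : 'I_(size s) => (2^-1 * (h (z k) + h (- z k)))%:E)); last first.
    move=> k _; rewrite ge0_integral_mscale//=; last by move=> x _; rewrite lee_fin.
    rewrite ge0_integral_measure_add//; last by move=> x _; rewrite lee_fin.
    by rewrite !integral_dirac//= !diracT !mul1e -EFinD -EFinM.
  rewrite sumEFin -EFinM/= (big_nth (0, 0)%N) big_mkord; congr (_ * _).
  by apply: eq_bigr => k _; rewrite mulrC.
have [M fM] := bf.2.
have -> : Qs s w = p by apply/funext => A; rewrite pE.
(* Adding the bound M reduces the claim to a non-negative integrand, for which [ge0] splits the
   integral over the point masses. *)
have -> : rint p f = rint p (fun x => f x + M) - M.
  by rewrite rintD//; [rewrite rint_cst addrK|exact: bmf_cst].
have -> : (p : set _ -> \bar R) = Qs s w by apply/funext => A; rewrite pE.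
rewrite ge0; last 2 first.
- by apply: measurable_funD => //; exact: bf.1.
- by move=> x; have := fM x; rewrite ler_norml => /andP[]; lra.
have sR : (size s)%:R != 0 :> R by rewrite pnatr_eq0 -lt0n.
rewrite (eq_bigr (fun p => (f (X p.2 w - X p.1 w) + f (- (X p.2 w - X p.1 w))) / 2 + M)); last first.
  by move=> p' _; field.
rewrite big_split/= big_const_seq iter_addr addr0 count_predT mulrDr -[M *+ _]mulr_natl.
by rewrite mulrA mulVf// mul1r addrK.
Qed.

End DesignMeasure.

(** * Weak consistency of the empirical measures *)

Section WeakConsistency.
Context {d : measure_display} {Omega : measurableType d} {R : realType} {q : nat}.
Variables (Pr : probability Omega R) (X : nat -> Omega -> 'rV[R]_q).
Hypothesis iidX : iid Pr X.
Local Notation Q := (law Pr (fun w => X 0%N w - X 1%N w)).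

Lemma measurable_XB i j : measurable_fun setT ((fun w => X i w - X j w) : Omega -> Vb R q).
Proof. by apply: measurable_mxB; exact: iidX.1. Qed.

Lemma rint_Q (f : Vb R q -> R) : bmf f ->
  rint Q f = rint Pr (fun w => f (X 0%N w - X 1%N w)).
Proof. by move=> bf; exact: (rint_pushforward Pr (measurable_XB 0 1) bf). Qed.

Lemma rint_swap (f : Vb R q -> R) : bmf f ->
  rint Pr (fun w => f (X 1%N w - X 0%N w)) = rint Pr (fun w => f (X 0%N w - X 1%N w)).
Proof.
move=> bf; have bF : bmf (fun z : Vb R q * Vb R q => f (z.1 - z.2)) by exact: bmf_kernelB.
by rewrite (@rint_pair _ _ _ _ _ _ iidX (fun z => f (z.1 - z.2)) 1%N 0%N)//
  (@rint_pair _ _ _ _ _ _ iidX (fun z => f (z.1 - z.2)) 0%N 1%N).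
Qed.

Variable s : nat -> seq (nat * nat).
Hypothesis ds : \forall n \near \oo, @design R n (s n) /\ (n <= size (s n))%N.

Lemma design_mean_vanishing (g : 'rV[R]_q -> R) (e : R) : 0 < e ->
  bmf (g : Vb R q -> R) -> (forall x, g (- x) = g x) ->
  rint Pr (fun w => g (X 0%N w - X 1%N w)) = 0 ->
  vanishing Pr (fun n => [set w | e <=
    `|(size (s n))%:R^-1 * \sum_(p <- s n) g (X p.2 w - X p.1 w)|]).
Proof.
move=> e0 bg geven gc.
pose C := 8 * rint Pr (fun w => h1 Pr X g (X 0%N w) ^+ 2) +
  2 * rint Pr (fun w => h2 Pr X g (X 0%N w) (X 1%N w) ^+ 2).
have E0 (f : Omega -> R) : 0 <= rint Pr (fun w => f w ^+ 2).
  by apply: rint_ge0 => w; exact: sqr_ge0.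
apply: (@vanishing_markov _ _ _ Pr _ (fun n w => ((size (s n))%:R^-1 *
    \sum_(p <- s n) g (X p.2 w - X p.1 w)) ^+ 2) (e ^+ 2) (fun n => C / n%:R)).
- by rewrite exprn_gt0.
- near=> n.
  have n0 : (0 < n)%N by near: n; exact: nbhs_infty_gt.
  have [dsn nsn] : @design R n (s n) /\ (n <= size (s n))%N by near: n.
  have sn0 : (0 < size (s n))%N by exact: leq_trans nsn.
  split.
  + apply: bmfX; apply: bmfZ; apply: bmf_sum => p _.
    exact: (bmf_comp (measurable_XB p.2 p.1) bg).
  + by move=> w; exact: sqr_ge0.
  + move=> w /= ew; rewrite -[leRHS](real_normK (num_real _)).
    by rewrite lerXn2r ?nnegrE// ltW.
  + rewrite (le_trans (rint_sqr_design iidX bg geven gc n0 sn0 dsn))//.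
    rewrite [leRHS]mulrDl lerD2l ler_wpM2l ?mulr_ge0//.
    by rewrite lef_pV2 ?posrE ?ltr0n// ler_nat.
- exact: cvg_divn0.
Unshelve. all: by end_near. Qed.

Lemma Qs_weak_vanishing (N : set (Dist R q)) : weak_nbhs Q N ->
  vanishing Pr (fun n => [set w | ~ N (Qs X (s n) w)]).
Proof.
move=> [m [f [e [e0 [cf HN]]]]].
have bf k : bmf (f k : Vb R q -> R).
  by split; [apply: (@continuous_borel_measurable R 'rV[R]_q); exact: (cf k).1|exact: (cf k).2].
(* The symmetrised and centred test function: its average over the design is the integral of [f k]
   against the empirical measure minus the one against Q, and as an even kernel it admits the
   Hoeffding decomposition. *)
pose g k x := (f k x + f k (- x)) / 2 - rint Q (f k).
have mN : measurable_fun setT ((fun x => - x) : Vb R q -> Vb R q).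
  apply: measurable_fun_mx => i j; under eq_fun do rewrite mxE.
  by apply: (measurableT_comp _ (measurable_coord i j)).
have bfN k : bmf ((fun x => f k (- x)) : Vb R q -> R) by exact: (bmf_comp mN (bf k)).
have bg k : bmf (g k : Vb R q -> R).
  by apply: bmfB; [apply: bmfM; [exact: bmfD|exact: bmf_cst]|exact: bmf_cst].
have geven k x : g k (- x) = g k x by rewrite /g opprK addrC [f k x + _]addrC addrC.
have gc k : rint Pr (fun w => g k (X 0%N w - X 1%N w)) = 0.
  have b1 := bmf_comp (measurable_XB 0 1) (bf k).
  have b2 := bmf_comp (measurable_XB 0 1) (bfN k).
  rewrite rintB; [|by apply: bmfM; [exact: bmfD|exact: bmf_cst]|exact: bmf_cst].
  under eq_fun do rewrite mulrC.
  rewrite rintZ; last exact: bmfD.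
  rewrite rintD// rint_cst rint_Q//.
  under [X in _ + rint Pr X]eq_fun do rewrite opprB.
  by rewrite rint_swap//; field.
have van := @vanishing_bigU _ _ _ Pr _ (enum 'I_m) (fun k n => [set w | e <=
    `|(size (s n))%:R^-1 * \sum_(p <- s n) g k (X p.2 w - X p.1 w)|])
    (fun k => design_mean_vanishing e0 (bg k) (geven k) (gc k)).
apply: vanishingS van; near=> n.
have n0 : (0 < n)%N by near: n; exact: nbhs_infty_gt.
have [dsn nsn] : @design R n (s n) /\ (n <= size (s n))%N by near: n.
have sn0 : (0 < size (s n))%N by exact: leq_trans nsn.
have sR : (size (s n))%:R != 0 :> R by rewrite pnatr_eq0 -lt0n.
move=> w /= nN; apply: contrapT => H; apply: nN; apply: HN.
  exact: Qs_is_prob.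
move=> k; rewrite ltNge; apply/negP => ek; apply: H; exists k.
  by rewrite mem_enum.
rewrite /= (_ : _ * _ = rint (Qs X (s n) w) (f k) - rint Q (f k))//.
rewrite rint_Qs// /g sumrB big_const_seq iter_addr addr0 count_predT mulrBr.
by congr (_ - _); rewrite -[rint _ _ *+ _]mulr_natl mulKf.
Unshelve. all: by end_near. Qed.

End WeakConsistency.

(** * Weak openness of the domain of Tyler's functional *)

Lemma ler_sum2_term (R : realType) (I K : finType) (f : I -> K -> R) i k :
  (forall i k, 0 <= f i k) -> f i k <= \sum_i \sum_k f i k.
Proof.
move=> f0; rewrite (bigD1 i)//= (bigD1 k)//= -addrA lerDl addr_ge0// sumr_ge0// => j _.
exact: sumr_ge0.
Qed.

Section Projections.
Context {R : realType} {q : nat}.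
Implicit Types (P W : 'M[R]_q) (y : 'rV[R]_q).

Lemma mxdot_eq0 (n : nat) (y : 'rV[R]_n) : y *m y^T = 0 -> y = 0.
Proof.
move=> /matrixP/(_ 0 0); rewrite !mxE => /psumr_eq0P e.
apply/rowP => i; rewrite mxE; apply/eqP; rewrite -sqrf_eq0 expr2; apply/eqP.
have := e _ i isT; rewrite mxE; apply => j _.
by rewrite mxE -expr2 sqr_ge0.
Qed.

(** A full-rank factorisation P = C R of an idempotent has R C = 1, and tr(C R) = tr(R C). Unlike
    the rank, the trace is continuous, so prescribing it is a closed condition. *)
Lemma idempotent_rank_trace P : P *m P = P -> \tr P = (\rank P)%:R.
Proof.
move=> PP.
have E : row_base P *m col_base P = 1%:M.
  have e : col_base P *m (row_base P *m col_base P) *m row_base P =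
      col_base P *m 1%:M *m row_base P.
    by rewrite mulmx1 mulmxA -mulmxA mulmx_base PP.
  have e1 := row_free_inj (row_base_free P) e.
  exact: (row_full_inj (col_base_full P) e1).
by rewrite -{1}(mulmx_base P) mxtrace_mulC E mxtrace1.
Qed.

(** The witness is N^T (N N^T)^-1 N; the Gram matrix is invertible because v N N^T = 0 forces v N =
    0. *)
Lemma gram_projection k (N : 'M[R]_(k, q)) : row_free N -> exists P,
  [/\ P^T = P, P *m P = P & (P :=: N)%MS].
Proof.
move=> fN; pose G := N *m N^T.
have Gu : G \in unitmx.
  rewrite -row_free_unit -kermx_eq0; apply/rowV0P => v /sub_kermxP vG.
  have : (v *m N) *m (v *m N)^T = 0.
    by rewrite trmx_mul mulmxA -(mulmxA v) -/G vG mul0mx.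
  by move=> /mxdot_eq0 vN; apply: (row_free_inj fN); rewrite vN mul0mx.
have GT : G^T = G by rewrite /G trmx_mul trmxK.
exists (N^T *m invmx G *m N).
have NP : N *m (N^T *m invmx G *m N) = N by rewrite !mulmxA -/G mulmxV// mul1mx.
split.
- by rewrite trmx_mul trmx_mul trmxK trmx_inv GT -[RHS]mulmxA.
- by rewrite -{1}mulmxA NP.
- by apply/eqmxP/andP; split; rewrite ?submxMl// -{1}NP submxMl.
Qed.

Lemma orthogonal_projection W : exists P, [/\ P^T = P, P *m P = P & (P :=: W)%MS].
Proof.
have [P [PT PP PW]] := gram_projection (row_base_free W).
by exists P; split => //; exact: eqmx_trans PW (eq_row_base W).
Qed.

(** The trace of a symmetric idempotent is the sum of the squares of its entries; hence the
    projections of given rank form a bounded set. *)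
Lemma projection_norm P i j : P^T = P -> P *m P = P -> `|P i j| <= Num.sqrt (\tr P).
Proof.
move=> PT PP.
have tr : \tr P = \sum_i \sum_j P i j ^+ 2.
  rewrite -{1}PP /mxtrace; apply: eq_bigr => k _; rewrite mxE; apply: eq_bigr => l _.
  by rewrite expr2 -{2}PT mxE.
rewrite -sqrtr_sqr ler_sqrt; last first.
  by rewrite tr sumr_ge0// => k _; rewrite sumr_ge0// => l _; exact: sqr_ge0.
by rewrite tr; apply: (ler_sum2_term (f := fun i j => P i j ^+ 2)) => k l; exact: sqr_ge0.
Qed.

End Projections.

Section WeakFilter.
Context {R : realType} {q : nat}.
Variable Q : Dist R q.

Lemma weak_nbhsI N N' : weak_nbhs Q N -> weak_nbhs Q N' -> weak_nbhs Q (N `&` N').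
Proof.
move=> [m [f [e [e0 [cf H]]]]] [m' [f' [e' [e'0 [cf' H']]]]].
exists (m + m')%N, (fun k => match fintype.split k with inl i => f i | inr i => f' i end).
exists (Num.min e e'); split; first by rewrite lt_min e0.
split; first by move=> k; case: fintype.split.
move=> mu pmu hmu; split.
- apply: H => // k; have := hmu (lshift m' k).
  by rewrite (unsplitK (inl k)) lt_min => /andP[].
- apply: H' => // k; have := hmu (rshift m k).
  by rewrite (unsplitK (inr k)) lt_min => /andP[].
Qed.

Global Instance weak_nbhs_filter : Filter (weak_nbhs Q).
Proof.
split; last 2 first.
- exact: weak_nbhsI.
- move=> N N' NN' [m [f [e [e0 [cf H]]]]]; exists m, f, e; split => //; split => //.
  by move=> mu pmu hmu; apply: NN'; exact: H.
- by exists 0%N, (fun=> cst 0), 1; split => //; split => //; case.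
Qed.

Lemma weak_nbhs_prob : weak_nbhs Q (@is_prob R q).
Proof. by exists 0%N, (fun=> cst 0), 1; split => //; split => //; case. Qed.

Lemma weak_nbhs_lt (f : 'rV[R]_q -> R) c : continuous f -> Defs.bounded_fun f ->
  rint Q f < c -> weak_nbhs Q [set mu : Dist R q | rint mu f < c].
Proof.
move=> cf bf fc; exists 1%N, (fun=> f), (c - rint Q f); split; first by rewrite subr_gt0.
split => // mu _ /(_ ord0); rewrite ltr_norml => /andP[_] /= h; lra.
Qed.

End WeakFilter.

Lemma rint_cvg_bounded d (T : measurableType d) (R : realType) (mu : probability T R)
    (f : nat -> T -> R) (g : T -> R) (M : R) :
  (forall n, measurable_fun setT (f n)) -> bmf g -> (forall n x, `|f n x| <= M) ->
  (forall x, f ^~ x @ \oo --> g x) -> rint mu (f n) @[n --> \oo] --> rint mu g.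
Proof.
move=> mf bg fM fg.
have bf n : bmf (f n) by split => //; exists M.
apply: fine_cvg; rewrite -integral_bmf//.
have := @dominated_cvg _ _ _ mu setT measurableT (fun n x => (f n x)%:E)
  (fun x => (g x)%:E) (fun=> M%:E).
apply => //.
- by move=> n; exact/measurable_EFinP.
- by move=> x _; apply: cvg_EFin; [exact: nearW|exact: fg].
- exact: (bmf_integrable mu (bmf_cst M)).
- by move=> n x _; rewrite lee_fin.
Qed.

Section ContinuousReal.
Context {R : realType} {T : topologicalType}.
Implicit Types f g : T -> R.

Lemma continuous_add f g : continuous f -> continuous g -> continuous (fun x => f x + g x).
Proof. by move=> cf cg x; apply: cvgD; [exact: cf|exact: cg]. Qed.

Lemma continuous_sub f g : continuous f -> continuous g -> continuous (fun x => f x - g x).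
Proof. by move=> cf cg x; apply: cvgB; [exact: cf|exact: cg]. Qed.

Lemma continuous_mul f g : continuous f -> continuous g -> continuous (fun x => f x * g x).
Proof. by move=> cf cg x; apply: cvgM; [exact: cf|exact: cg]. Qed.

Lemma continuous_inv f : (forall x, f x != 0) -> continuous f ->
  continuous (fun x => (f x)^-1).
Proof. by move=> f0 cf x; apply: cvgV; [exact: f0|exact: cf]. Qed.

Lemma continuous_max0 f : continuous f -> continuous (fun x => Num.max 0 (f x)).
Proof.
move=> cf; under eq_fun do rewrite maxr_absE.
apply: continuous_mul; last exact: cst_continuous.
have c0 : continuous (fun _ : T => 0 : R) by exact: cst_continuous.
apply: continuous_add; first exact: continuous_add.
by move=> x; apply: cvg_norm; exact: (continuous_sub c0 cf).
Qed.

Lemma continuous_sum (I : Type) (s : seq I) (F : I -> T -> R) :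
  (forall i, continuous (F i)) -> continuous (fun x => \sum_(i <- s) F i x).
Proof.
move=> cF; elim: s => [|i s IH].
  by under eq_fun do rewrite big_nil; exact: cst_continuous.
by under eq_fun do rewrite big_cons; exact: continuous_add.
Qed.

Lemma closed_continuous_eq0 f : continuous f -> closed [set x | f x = 0].
Proof.
move=> cf; apply: (@preimage_closed _ _ f [set x | x = 0]) => [x _|]; first exact: cf.
exact: closed_eq.
Qed.

End ContinuousReal.

Section BumpFunction.
Context {R : realType} {q : nat}.
Implicit Types (P W : 'M[R]_q) (y : 'rV[R]_q).

Definition l1 y : R := \sum_j `|y 0 j|.

(* Equals 1 on the cone of the y with m * |y - yP| <= |y|, which contains the
   range of every projection close to P. *)
Definition bump P (m : nat) y : R :=
  (1 + m%:R * Num.max 0 (m%:R * l1 (y - y *m P) - l1 y))^-1.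

Lemma l1_ge0 y : 0 <= l1 y. Proof. by rewrite sumr_ge0. Qed.

Lemma l1_eq0 y : (l1 y == 0) = (y == 0).
Proof.
rewrite psumr_eq0//; apply/allP/eqP => [H|-> j _]; last by rewrite mxE/= normr0.
by apply/rowP => j; apply/eqP; have := H j; rewrite mem_index_enum normr_eq0 mxE; apply.
Qed.

Lemma bump_den P m y :
  1 <= 1 + m%:R * Num.max 0 (m%:R * l1 (y - y *m P) - l1 y).
Proof. by rewrite lerDl mulr_ge0// le_max lexx. Qed.

Lemma bump_ge0 P m y : 0 <= bump P m y.
Proof. by rewrite invr_ge0 (le_trans ler01)// bump_den. Qed.

Lemma bump_norm P m y : `|bump P m y| <= 1.
Proof.
rewrite ger0_norm ?bump_ge0// invf_le1 ?bump_den//.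
by rewrite (lt_le_trans ltr01)// bump_den.
Qed.

Lemma continuous_l1 (T : topologicalType) (F : T -> 'rV[R]_q) :
  (forall j, continuous (fun x => F x 0 j)) -> continuous (fun x => l1 (F x)).
Proof.
by move=> cF; apply: continuous_sum => j x; apply: cvg_norm; exact: cF.
Qed.

Lemma continuous_bump P m : continuous (bump P m).
Proof.
apply: continuous_inv => [y|]; first by rewrite gt_eqF// (lt_le_trans ltr01)// bump_den.
apply: continuous_add; first exact: cst_continuous.
apply: continuous_mul; first exact: cst_continuous.
have cc i : continuous (fun x : 'rV[R]_q => x 0 i) by exact: coord_continuous.
apply: continuous_max0.
apply: continuous_sub; last exact: continuous_l1.
apply: continuous_mul; first exact: cst_continuous.
apply: (@continuous_l1 _ (fun y => y - y *m P)) => j.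
under eq_fun do rewrite !mxE.
apply: continuous_sub => //; apply: continuous_sum => i.
by apply: continuous_mul => //; exact: cst_continuous.
Qed.

(** Off the fixed space, c = l1(y - yP) is positive, and once m c >= 1 + l1(y) the denominator is at
    least m. *)
Lemma bump_cvg P y : bump P m y @[m --> \oo] --> (\1_[set v | v = v *m P] y : R).
Proof.
rewrite indicE; case: (pselect (y = y *m P)) => [yP|yP].
  rewrite mem_set//=; apply: cvg_near_cst; apply: nearW => m.
  rewrite /bump -yP subrr (_ : l1 0 = 0); last by apply/eqP; rewrite l1_eq0.
  by rewrite mulr0 sub0r (max_idPl _) ?oppr_le0 ?l1_ge0// mulr0 addr0 invr1.
rewrite memNset//=.
have c0 : 0 < l1 (y - y *m P).
  by rewrite lt_neqAle l1_ge0 andbT eq_sym l1_eq0 subr_eq0; apply/eqP.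
set c := l1 (y - _) in c0 *.
have cv : (fun m : nat => (m%:R : R)^-1) @ \oo --> 0.
  by apply/gtr0_cvgV0; [near=> m; rewrite ltr0n; near: m; exact: nbhs_infty_gt|exact: cvgr_idn].
apply: (@squeeze_cvgr _ _ _ _ (fun=> 0) (fun m : nat => m%:R^-1)); last 2 first.
- exact: cvg_cst.
- exact: cv.
near=> m.
have m0 : 0 < m%:R :> R by rewrite ltr0n; near: m; exact: nbhs_infty_gt.
rewrite bump_ge0/= lef_pV2 ?posrE//; last by rewrite (lt_le_trans ltr01)// bump_den.
have mb : (1 + l1 y) / c <= m%:R by near: m; exact: nbhs_infty_ger.
rewrite ler_pdivrMr// in mb.
have h : 1 <= Num.max 0 (m%:R * c - l1 y) by rewrite le_max; apply/orP; right; lra.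
by rewrite -/c (le_trans (_ : _ <= m%:R * Num.max 0 (m%:R * c - l1 y)))// ?lerDr// ler_peMr// ltW.
Unshelve. all: by end_near. Qed.

(** If y = yP', then y - yP = y(P' - P) has l1 norm at most q e l1(y), which puts y into the cone
    where the bump equals 1. *)
Lemma bump_eq1 P P' m y (e : R) : 0 <= e -> q%:R * m%:R * e <= 1 ->
  (forall i j, `|P' i j - P i j| <= e) -> y = y *m P' -> bump P m y = 1.
Proof.
move=> e0 eq PP' yP.
suff h : m%:R * l1 (y - y *m P) <= l1 y.
  by rewrite /bump (max_idPl _) ?subr_le0// mulr0 addr0 invr1.
have h : l1 (y - y *m P) <= q%:R * e * l1 y.
  rewrite {1}yP -mulmxBr /l1 (le_trans (_ : _ <= \sum_(j < q) (e * \sum_i `|y 0 i|)))//.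
    apply: ler_sum => j _; rewrite mxE (le_trans (ler_norm_sum _ _ _))// mulr_sumr.
    by apply: ler_sum => i _; rewrite normrM mulrC !mxE ler_wpM2r.
  by rewrite sumr_const card_ord -[_ *+ q]mulr_natl mulrA.
apply: (le_trans (ler_wpM2l _ h)) => //.
by rewrite mulrA -[leRHS]mul1r ler_wpM2r ?l1_ge0// (le_trans _ eq)// mulrA [_ * q%:R]mulrC.
Qed.

End BumpFunction.

(** * Subspace conditions of Tyler's functional near Q *)

Section TylerDomain.
Context {R : realType} {q : nat}.
Implicit Types (P W : 'M[R]_q) (y : 'rV[R]_q).

(** Matrices are coded as row vectors, for which bounded closed sets are compact; the trace stands
    for the rank because it is continuous. *)
Definition projections (k : nat) : set 'rV[R]_(q * q) :=
  [set r | [/\ (vec_mx r)^T = vec_mx r, vec_mx r *m vec_mx r = vec_mx r &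
    \tr (vec_mx r) = k%:R]].

Lemma continuous_vec_mx_coord i j :
  continuous (fun r : 'rV[R]_(q * q) => (vec_mx r : 'M[R]_q) i j).
Proof. by under eq_fun do rewrite mxE; exact: coord_continuous. Qed.

Lemma compact_projections k : compact (projections k).
Proof.
apply: bounded_closed_compact.
  exists (Num.sqrt k%:R); split; first exact: num_real.
  move=> x kx r [rT rr rk] /=; apply: (le_trans _ (ltW kx)).
  rewrite -rk [leLHS]/Num.Def.normr/= mx_normrE; apply: bigmax_le.
    exact: sqrtr_ge0.
  move=> [i0 j0] _ /=; rewrite ord1 -{1}[r]vec_mxK.
  by case/mxvec_indexP: j0 => i j; rewrite mxvecE; exact: projection_norm.
have -> : projections k =
    (\bigcap_(p in [set: 'I_q * 'I_q]) ([set r | vec_mx r p.2 p.1 - vec_mx r p.1 p.2 = 0] `&`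
      [set r | \sum_l vec_mx r p.1 l * vec_mx r l p.2 - vec_mx r p.1 p.2 = 0])) `&`
    [set r | \sum_i (vec_mx r : 'M[R]_q) i i - k%:R = 0].
  apply/seteqP; split=> r.
    move=> [rT rr rk]; split; last by rewrite /= -/(\tr _) rk subrr.
    move=> [i j] _ /=; split; first by rewrite -{1}rT mxE subrr.
    by rewrite /= -{3}rr mxE subrr.
  move=> [H /subr0_eq rk]; split => //.
    by apply/matrixP => i j; rewrite [LHS]mxE; have [/subr0_eq e _] := H (i, j) I; exact: e.
  by apply/matrixP => i j; rewrite [LHS]mxE; have [_ /subr0_eq e] := H (i, j) I; exact: e.
apply: closedI.
  apply: closed_bigI => -[i j] _; apply: closedI; apply: closed_continuous_eq0.
    by apply: continuous_sub; exact: continuous_vec_mx_coord.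
  apply: continuous_sub; last exact: continuous_vec_mx_coord.
  by apply: continuous_sum => l; apply: continuous_mul; exact: continuous_vec_mx_coord.
apply: closed_continuous_eq0; apply: continuous_sub; last exact: cst_continuous.
by apply: continuous_sum => l; exact: continuous_vec_mx_coord.
Qed.

Lemma measurable_fixed P : measurable ([set v | v = v *m P] : set (Vb R q)).
Proof.
have -> : [set v : 'rV[R]_q | v = v *m P] =
    \bigcap_(j in [set: 'I_q]) [set v : 'rV[R]_q | v 0 j - \sum_i v 0 i * P i j = 0].
  apply/seteqP; split=> v; first by move=> /= e j _ /=; rewrite {1}e mxE subrr.
  by move=> H; apply/rowP => j; rewrite mxE; apply/subr0_eq/H.
have -> : \bigcap_(j in [set: 'I_q]) [set v : 'rV[R]_q | v 0 j - \sum_i v 0 i * P i j = 0] =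
   ~` (~` \bigcap_(j in [set: 'I_q]) [set v : 'rV[R]_q | v 0 j - \sum_i v 0 i * P i j = 0]).
  by rewrite setCK.
apply: (@measurableC _ (Vb R q)); apply: sub_sigma_algebra; apply: closed_openC.
apply: closed_bigI => j _; apply: closed_continuous_eq0.
have cc i : continuous (fun x : 'rV[R]_q => x 0 i) by exact: coord_continuous.
apply: continuous_sub => //; apply: continuous_sum => i.
by apply: continuous_mul => //; exact: cst_continuous.
Qed.

(* Compactness of the set of projections of rank k, used as a near-covering
   property indexed by the filter of weak neighbourhoods of Q. *)
Lemma weak_nbhs_fixed (Q : Dist R q) (k : nat) (c : R) : is_prob Q ->
  (forall P, P^T = P -> P *m P = P -> \tr P = k%:R -> (Q [set v | v = v *m P] < c%:E)%E) ->
  weak_nbhs Q [set mu | forall P, P^T = P -> P *m P = P -> \tr P = k%:R ->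
    (mu [set v | v = v *m P] < c%:E)%E].
Proof.
move=> [p pQ] HQ.
have bb P m : bmf (bump P m : Vb R q -> R).
  split; last by exists 1 => x; exact: bump_norm.
  by apply: (@continuous_borel_measurable R 'rV[R]_q); exact: continuous_bump.
have := (compact_near_coveringP _).1 (@compact_projections k) _ (weak_nbhs Q)
  (fun mu r => (mu [set v : 'rV[R]_q | v = v *m (vec_mx r : 'M[R]_q)] < c%:E)%E)
  (weak_nbhs_filter Q).
move=> H; apply: filterS (H _).
  move=> mu Hmu P PT PP Pk; have := Hmu (mxvec P); rewrite mxvecK; apply.
  by split; rewrite mxvecK.
move=> r [rT rr rk]; pose P : 'M[R]_q := vec_mx r.
have lt : rint Q (\1_[set v | v = v *m P] : Vb R q -> R) < c.
  have -> : Q = p by apply/funext => A; rewrite pQ.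
  rewrite rint_indic; last exact: measurable_fixed.
  rewrite -lte_fin fineK ?pQ; first exact: HQ.
  by rewrite -pQ fin_num_measure//; exact: measurable_fixed.
(* The bumps converge boundedly to the indicator, so one of them has Q-integral below c; being
   continuous, it keeps this bound in a weak neighbourhood of Q. *)
have [m _ /(_ m (leqnn m)) ltm] : \forall m \near \oo, rint Q (bump P m) < c.
  have -> : Q = p by apply/funext => A; rewrite pQ.
  have cv : rint p (bump P m) @[m --> \oo] --> rint p (\1_[set v | v = v *m P] : Vb R q -> R).
    apply: (@rint_cvg_bounded _ (Vb R q) _ p (bump P) _ 1).
    - by move=> m; exact: (bb P m).1.
    - by apply: bmf_indic; exact: measurable_fixed.
    - by move=> m x; exact: bump_norm.
    - exact: bump_cvg.
  apply: (cvgr_lt _ cv).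
  by rewrite (_ : (p : set _ -> _) = Q)//; apply/funext => A; rewrite pQ.
(* This radius satisfies q m e <= 1, as [bump_eq1] requires, so the same bump dominates the
   indicators for all projections in the ball. *)
have e0 : 0 < (1 + q%:R * m%:R)^-1 :> R by rewrite invr_gt0 ltr_pwDl// mulr_ge0.
set e := _^-1 in e0.
exists (ball r e, [set mu : Dist R q | is_prob mu /\ rint mu (bump P m) < c]) => /=.
  split; first exact: nbhsx_ballx.
  apply: filterI; first exact: weak_nbhs_prob.
  apply: weak_nbhs_lt => //; first exact: continuous_bump.
  by exists 1 => x; exact: bump_norm.
move=> [r' mu] /= [rr' [[p' p'mu] mult]].
have mf := measurable_fixed (vec_mx r').
rewrite -p'mu -(@fineK _ (p' _)) ?fin_num_measure// lte_fin -rint_indic//.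
apply: le_lt_trans mult; have -> : mu = p' by apply/funext => A; rewrite p'mu.
apply: rint_le; [exact: bmf_indic|exact: bb|] => v; rewrite indicE.
case: (pselect (v = v *m vec_mx r')) => [vr'|vr']; last by rewrite memNset//= bump_ge0.
rewrite mem_set//= (@bump_eq1 _ _ P (vec_mx r') m v e) ?(ltW e0)//.
  by rewrite /e ler_pdivrMr ?mul1r ?lerDr// ltr_pwDl// mulr_ge0.
move=> i j; rewrite !mxE distrC; apply: ltW; exact: rr'.2.
Qed.

(** The subspaces of dimension k are the fixed spaces of the orthogonal projections of trace k, and
    finitely many neighbourhoods, one for each k with 0 < k < q, are intersected. *)
Lemma weak_nbhs_tyler (Q : Dist R q) : is_prob Q ->
  (forall W, (1 <= \rank W < q)%N ->
    (Q [set v | (v <= W)%MS] < ((\rank W)%:R / q%:R)%:E)%E) ->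
  weak_nbhs Q [set mu | forall W, (1 <= \rank W < q)%N ->
    (mu [set v | (v <= W)%MS] < ((\rank W)%:R / q%:R)%:E)%E].
Proof.
move=> pQ HQ.
have fixE W P : P *m P = P -> (P :=: W)%MS -> [set v : 'rV[R]_q | (v <= W)%MS] = [set v | v = v *m P].
  move=> PP PW; apply/seteqP; split => v /=.
    by rewrite -PW => /submxP[u ->]; rewrite -mulmxA PP.
  by move=> ->; rewrite -PW submxMl.
have rk P W : P *m P = P -> (P :=: W)%MS -> \tr P = (\rank W)%:R.
  by move=> PP PW; rewrite idempotent_rank_trace// PW.
have : weak_nbhs Q [set mu | forall k : 'I_q, (0 < k)%N -> forall P, P^T = P ->
    P *m P = P -> \tr P = k%:R -> (mu [set v | v = v *m P] < (k%:R / q%:R)%:E)%E].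
  apply: (@filter_forall _ _ (fun k : 'I_q => [set mu | (0 < k)%N -> forall P, P^T = P ->
    P *m P = P -> \tr P = k%:R -> (mu [set v | v = v *m P] < (k%:R / q%:R)%:E)%E])
    (weak_nbhs Q) (weak_nbhs_filter Q)) => k.
  case: (posnP k) => [->|k0]; first by apply: filterS filterT.
  apply: filterS (@weak_nbhs_fixed Q k (k%:R / q%:R) pQ _); first by move=> mu + _.
  move=> P PT PP Pk; rewrite -(@fixE P P)//.
  have rkP : \rank P = k by apply/eqP; rewrite -(eqr_nat R) -Pk idempotent_rank_trace.
  by rewrite -rkP; apply: HQ; rewrite rkP k0 ltn_ord.
apply: filterS => mu H W /andP[W0 Wq].
have [P [PT PP PW]] := orthogonal_projection W.
rewrite (fixE _ _ PP PW); apply: (H (Ordinal Wq)) => //.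
exact: rk.
Qed.

End TylerDomain.

Section TylerVanishing.
Context {d : measure_display} {Omega : measurableType d} {R : realType} {q : nat}.
Variables (Pr : probability Omega R) (X : nat -> Omega -> 'rV[R]_q).
Hypothesis iidX : iid Pr X.
Local Notation Q := (law Pr (fun w => X 0%N w - X 1%N w)).
Variable s : nat -> seq (nat * nat).
Hypothesis ds : \forall n \near \oo, @design R n (s n) /\ (n <= size (s n))%N.

(** Absence of mass at 0 is not weakly open, hence the separate argument: for distinct indices the
    difference has law Q, so every tie has probability 0. *)
Lemma ties_vanishing : Q [set 0] = 0%E ->
  vanishing Pr (fun n => [set w | exists2 p, p \in s n & X p.2 w - X p.1 w = 0]).
Proof.
move=> Q00.
have m0 : measurable ([set 0] : set (Vb R q)).
  have -> : [set 0] = [set v : 'rV[R]_q | v = v *m 0].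
    by apply/seteqP; split => v /=; rewrite mulmx0.
  exact: measurable_fixed.
have bI : bmf (\1_[set 0] : Vb R q -> R) by exact: bmf_indic.
have bXI i j : bmf (fun w => (\1_[set 0] : Vb R q -> R) (X i w - X j w)).
  exact: (bmf_comp (measurable_XB iidX i j) bI).
have E0 i j : i != j -> rint Pr (fun w => (\1_[set 0] : Vb R q -> R) (X i w - X j w)) = 0.
  move=> ij; have bF := bmf_kernelB bI.
  rewrite (@rint_pair _ _ _ _ _ _ iidX (fun z => \1_[set 0] (z.1 - z.2)) i j)//.
  rewrite -(@rint_pair _ _ _ _ _ _ iidX (fun z => \1_[set 0] (z.1 - z.2)) 0%N 1%N)//=.
  rewrite -(rint_law_prob Pr (measurable_XB iidX 0 1) bI) rint_indic//.
  by rewrite (law_probE Pr (measurable_XB iidX 0 1)) [Pr _]Q00.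
apply: (@vanishing_markov _ _ _ Pr _ (fun n w => \sum_(p <- s n)
    (\1_[set 0] : Vb R q -> R) (X p.2 w - X p.1 w)) 1 (fun=> 0)) => //; last exact: cvg_cst.
near=> n.
have [[_ dsn _] _] : @design R n (s n) /\ (n <= size (s n))%N by near: n.
split.
- by apply: bmf_sum => p _; exact: bXI.
- by move=> w; apply: sumr_ge0 => p _; rewrite indicE.
- move=> w /= [p ps e]; rewrite (big_rem p)//= e indicE mem_set//= lerDl.
  by apply: sumr_ge0 => p' _; rewrite indicE.
- rewrite rint_sum => [|p _]; last exact: bXI.
  rewrite big_seq big1// => p ps; apply: E0; rewrite eq_sym.
  by have [] := dsn p ps.
Unshelve. all: by end_near. Qed.

Lemma Q0_vanishing : @Q0 R q Q ->
  vanishing Pr (fun n => [set w | ~ @Q0 R q (Qs X (s n) w)]).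
Proof.
move=> [pQ [Q00 HQ]].
have van := vanishingU (Qs_weak_vanishing iidX ds (weak_nbhs_tyler pQ HQ)) (ties_vanishing Q00).
apply: vanishingS van; near=> n => w /= nQ.
have n0 : (0 < n)%N by near: n; exact: nbhs_infty_gt.
have [dsn nsn] : @design R n (s n) /\ (n <= size (s n))%N by near: n.
have sn0 : (0 < size (s n))%N by exact: leq_trans nsn.
apply: contrapT => /not_orP[/contrapT H nt]; apply: nQ; split; first exact: Qs_is_prob.
split => //; rewrite /Qs big_seq big1 ?mule0// => p ps.
have z0 : X p.2 w - X p.1 w != 0 by apply/eqP => z; apply: nt; exists p.
by rewrite /dsym !diracE !memNset ?adde0 ?mule0// => /eqP; rewrite ?oppr_eq0 (negbTE z0).
Unshelve. all: by end_near. Qed.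

End TylerVanishing.

(** * Gaussian matrices *)

Section FrobeniusNorm.
Context {R : realType} {q : nat}.
Implicit Types A B : 'M[R]_q.

Lemma mx_innerE A B : mx_inner A B = \sum_i \sum_j A i j * B i j.
Proof.
rewrite /mx_inner /mxtrace exchange_big/=; apply: eq_bigr => j _.
by rewrite mxE; apply: eq_bigr => i _; rewrite mxE.
Qed.

(** A symmetric B sees only the symmetric part of A. This extends the variance identities, given for
    symmetric A, to all test matrices. *)
Lemma mx_inner_sym A B : symmx B -> mx_inner A B = mx_inner (2^-1 *: (A + A^T)) B.
Proof.
move=> sB.
have -> : mx_inner (2^-1 *: (A + A^T)) B = 2^-1 * (mx_inner A B + mx_inner A^T B).
  rewrite !mx_innerE -big_split/= mulr_sumr; apply: eq_bigr => i _.
  rewrite -big_split/= mulr_sumr; apply: eq_bigr => j _.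
  by rewrite !mxE; ring.
have -> : mx_inner A^T B = mx_inner A B.
  by rewrite /mx_inner trmxK -mxtrace_tr trmx_mul sB mxtrace_mulC.
by field.
Qed.

Lemma symmx_sym A : symmx (2^-1 *: (A + A^T)).
Proof. by rewrite /symmx linearZ/= linearD/= trmxK addrC. Qed.

Lemma mx_inner_ge0 A : 0 <= mx_inner A A.
Proof.
rewrite mx_innerE sumr_ge0// => i _; rewrite sumr_ge0// => j _.
by rewrite -expr2 sqr_ge0.
Qed.

Lemma sqr_frob A : frob A ^+ 2 = \sum_i \sum_j A i j ^+ 2.
Proof. by rewrite sqr_sqrtr ?mx_inner_ge0// mx_innerE. Qed.

Lemma frob_ge0 A : 0 <= frob A. Proof. exact: sqrtr_ge0. Qed.

Lemma entry_le_frob A i j : `|A i j| <= frob A.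
Proof.
rewrite -(@ler_pXn2r _ 2) ?nnegrE ?frob_ge0// sqr_frob real_normK ?num_real//.
by apply: (ler_sum2_term (f := fun i j => A i j ^+ 2)) => k l; exact: sqr_ge0.
Qed.

Lemma frob_le A (e : R) : 0 <= e -> (forall i j, `|A i j| <= e) -> frob A <= q%:R * e.
Proof.
move=> e0 Ae; rewrite -(@ler_pXn2r _ 2) ?nnegrE ?frob_ge0 ?mulr_ge0// sqr_frob exprMn.
apply: (@le_trans _ _ (\sum_(i < q) \sum_(j < q) e ^+ 2)).
  apply: ler_sum => i _; apply: ler_sum => j _.
  by rewrite -(real_normK (num_real (A i j))) lerXn2r ?nnegrE.
rewrite !(sumr_const, card_ord) -mulrnA -[leLHS]mulr_natl natrM.
by rewrite expr2.
Qed.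

End FrobeniusNorm.

Section GaussianScalar.
Context {d : measure_display} {Omega : measurableType d} {R : realType}.
Variable Pr : probability Omega R.

Lemma rint_same_law d' (T : measurableType d') (mu : probability T R)
    (Y : Omega -> T) (f : T -> R) : measurable_fun setT Y -> bmf f ->
  (forall B, measurable B -> Pr (Y @^-1` B) = mu B) ->
  rint Pr (fun w => f (Y w)) = rint mu f.
Proof.
move=> mY bf law; rewrite -(rint_law_prob Pr mY bf) /rint; congr fine.
by apply: eq_measure_integral => A mA _; exact: law.
Qed.

Lemma ge0_integral_same_law d' (T : measurableType d') (mu : probability T R)
    (Y : Omega -> T) (f : T -> R) : measurable_fun setT Y -> measurable_fun setT f ->
  (forall x, 0 <= f x) -> (forall B, measurable B -> Pr (Y @^-1` B) = mu B) ->
  (\int[Pr]_w (f (Y w))%:E = \int[mu]_x (f x)%:E)%E.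
Proof.
move=> mY mf f0 law.
transitivity (\int[law_prob Pr mY]_x (f x)%:E)%E; last first.
  by apply: eq_measure_integral => A mA _; exact: law.
rewrite [RHS](@ge0_integral_pushforward _ _ _ _ _ _ mY Pr setT (fun x => (f x)%:E))//.
- exact/measurable_EFinP.
- by move=> x _; rewrite lee_fin.
Qed.

(** Comparing second moments identifies the unspecified variance v; the degenerate case v = 0 is the
    point mass at 0. *)
Lemma cnormal_var (Y : Omega -> R) (v c : R) : measurable_fun setT Y -> 0 <= v ->
  (forall B, measurable B -> Pr (Y @^-1` B) = cnormal v B) ->
  (\int[Pr]_w (Y w ^+ 2)%:E = c%:E)%E -> v = c /\ rint Pr (fun w => cos (Y w)) = expR (- (c / 2)).
Proof.
move=> mY v0 law Yc; rewrite /cnormal in law.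
have mcos : measurable_fun setT (fun x : R => x) by [].
have bc := bmf_cos mcos.
have msq : measurable_fun setT (fun x : R => x ^+ 2) by exact: measurable_funX.
have sq0 (x : R) : 0 <= x ^+ 2 by exact: sqr_ge0.
case: eqVneq law => [-> law|vn0 law].
  have := @ge0_integral_same_law _ _ (\d_(0 : R)) Y _ mY msq sq0 law.
  rewrite Yc integral_dirac//=; last exact/measurable_EFinP.
  rewrite diracT mul1e expr0n/= => -[->]; split => //.
  rewrite (rint_same_law mY bc law) /rint integral_dirac//=; last by apply/measurable_EFinP; exact: bc.1.
  by rewrite indicE in_setT mul1r cos0 mul0r oppr0 expR0.
have s0 : Num.sqrt v != 0 by rewrite sqrtr_eq0 -ltNge lt_neqAle eq_sym vn0.
have E := @ge0_integral_same_law _ _ (normal_prob 0 (Num.sqrt v)) Y _ mY msq sq0 law.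
have int2 : (normal_prob 0 (Num.sqrt v)).-integrable setT (EFin \o (fun x : R => x ^+ 2)).
  apply/integrableP; split; first exact/measurable_EFinP.
  under eq_integral do rewrite /= ger0_norm ?sqr_ge0//.
  by rewrite -E Yc ltry.
have vc : v = c.
  have := normal_second_moment s0 int2; rewrite /rint -E Yc sqr_sqrtr//.
split => //.
rewrite (@rint_same_law _ _ (normal_prob 0 (Num.sqrt v)) Y _ mY bc law).
have := normal_cos s0 int2 1; under eq_fun do rewrite mul1r.
by move=> ->; rewrite sqr_sqrtr// expr1n mulr1 vc.
Qed.

End GaussianScalar.

Section GaussianMatrix.
Context {d : measure_display} {Omega : measurableType d} {R : realType} {q : nat}.
Variable Pr : probability Omega R.
Implicit Types (G : Omega -> 'M[R]_q) (A : 'M[R]_q).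

Lemma measurable_mx_inner A : measurable_fun setT (mx_inner A : Mb R q -> R).
Proof.
have -> : mx_inner A = fun B : 'M[R]_q => \sum_i \sum_j A i j * B i j.
  by apply/funext => B; exact: mx_innerE.
apply: measurable_sum => i; apply: measurable_sum => j.
by apply: measurable_funM => //; exact: measurable_coord.
Qed.

Lemma mx_innerNl A B : mx_inner (- A) B = - mx_inner A B.
Proof. by rewrite /mx_inner linearN/= mulNmx linearN. Qed.

(** The sine integral vanishes by symmetry: the inner products with A and -A are centred normal with
    equal variances, hence equal in law, while the sine changes sign. *)
Lemma gauss_trig G (c : 'M[R]_q -> R) : cgauss_mx Pr G ->
  (forall A, (\int[Pr]_w (mx_inner A (G w) ^+ 2)%:E = (c A)%:E)%E) ->
  forall A, rint Pr (fun w => cos (mx_inner A (G w))) = expR (- (c A / 2)) /\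
    rint Pr (fun w => sin (mx_inner A (G w))) = 0.
Proof.
move=> [mG gG] cG A.
have mAG B : measurable_fun setT (fun w => mx_inner B (G w)).
  exact: (measurableT_comp (measurable_mx_inner B) mG).
have [v [v0 lawv]] := gG A; have [u [u0 lawu]] := gG (- A).
have [vc ->] := cnormal_var (mAG A) v0 lawv (cG A); split => //.
have [uc _] := cnormal_var (mAG (- A)) u0 lawu (cG (- A)).
have cN : c (- A) = c A.
  have := cG (- A); under eq_integral do rewrite mx_innerNl sqrrN.
  by rewrite cG => -[].
have mid : measurable_fun setT (fun x : R => x) by [].
have bs := bmf_sin mid.
have E : rint Pr (fun w => sin (mx_inner (- A) (G w))) = rint Pr (fun w => sin (mx_inner A (G w))).
  rewrite -(rint_law_prob Pr (mAG (- A)) bs) -(rint_law_prob Pr (mAG A) bs) /rint.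
  congr fine; apply: eq_measure_integral => B mB _.
  transitivity (cnormal u B); first exact: lawu.
  by rewrite uc cN -vc; exact: esym (lawv _ mB).
move: E; under eq_fun do rewrite mx_innerNl sinN.
rewrite rintN; last exact: bmf_sin.
by lra.
Qed.

Lemma gauss_pair_trig G1 G2 (c1 c2 : 'M[R]_q -> R) :
  cgauss_mx Pr G1 -> cgauss_mx Pr G2 -> indep_mx Pr G1 G2 ->
  (forall A, (\int[Pr]_w (mx_inner A (G1 w) ^+ 2)%:E = (c1 A)%:E)%E) ->
  (forall A, (\int[Pr]_w (mx_inner A (G2 w) ^+ 2)%:E = (c2 A)%:E)%E) ->
  forall A B th, rint Pr (fun w => cos (mx_inner A (G1 w) + mx_inner B (G2 w) + th)) =
    expR (- ((c1 A + c2 B) / 2)) * cos th.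
Proof.
move=> gG1 gG2 ind cG1 cG2 A B th.
have [C1 S1] := gauss_trig gG1 cG1 A; have [C2 S2] := gauss_trig gG2 cG2 B.
have mA := measurable_mx_inner A; have mB := measurable_mx_inner B.
have m1 : measurable_fun setT (fun w => mx_inner A (G1 w)).
  exact: (measurableT_comp mA gG1.1).
have m2 : measurable_fun setT (fun w => mx_inner B (G2 w)).
  exact: (measurableT_comp mB gG2.1).
have prodE (f g : Mb R q -> R) : bmf f -> bmf g ->
    rint Pr (fun w => f (G1 w) * g (G2 w)) =
    rint Pr (fun w => f (G1 w)) * rint Pr (fun w => g (G2 w)).
  move=> bf bg.
  have bF : bmf (fun z : Mb R q * Mb R q => f z.1 * g z.2).
    by apply: bmfM; [exact: (bmf_comp measurable_fst bf)|exact: (bmf_comp measurable_snd bg)].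
  rewrite (rint_indep gG1.1 gG2.1 ind bF)/=.
  have bgG := bmf_comp gG2.1 bg; have bfG := bmf_comp gG1.1 bf.
  under eq_fun do rewrite rintZ// mulrC.
  by rewrite rintZ// mulrC.
have bc1 := bmf_cos mA; have bc2 := bmf_cos mB; have bs1 := bmf_sin mA; have bs2 := bmf_sin mB.
have bc1' := bmf_cos m1; have bc2' := bmf_cos m2; have bs1' := bmf_sin m1; have bs2' := bmf_sin m2.
have -> : (fun w => cos (mx_inner A (G1 w) + mx_inner B (G2 w) + th)) = fun w =>
    cos th * (cos (mx_inner A (G1 w)) * cos (mx_inner B (G2 w))
      - sin (mx_inner A (G1 w)) * sin (mx_inner B (G2 w))) -
    sin th * (sin (mx_inner A (G1 w)) * cos (mx_inner B (G2 w))
      + cos (mx_inner A (G1 w)) * sin (mx_inner B (G2 w))).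
  by apply/funext => w; rewrite cosD cosD sinD; ring.
have bb1 := bmfB (bmfM bc1' bc2') (bmfM bs1' bs2').
have bb2 := bmfD (bmfM bs1' bc2') (bmfM bc1' bs2').
rewrite (rintB Pr (bmfZ (cos th) bb1) (bmfZ (sin th) bb2)).
rewrite (rintZ Pr (cos th) bb1) (rintZ Pr (sin th) bb2).
rewrite (rintB Pr (bmfM bc1' bc2') (bmfM bs1' bs2')).
rewrite (rintD Pr (bmfM bs1' bc2') (bmfM bc1' bs2')).
rewrite (prodE _ _ bc1 bc2) (prodE _ _ bs1 bs2) (prodE _ _ bs1 bc2) (prodE _ _ bc1 bs2).
rewrite C1 C2 S1 S2 !(mul0r, mulr0) subr0 addr0 mulr0 subr0 mulrC -expRD; congr (expR _ * _).
by field.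
Qed.

End GaussianMatrix.

(** * First-order expansion *)

Section NegligibleSqrt.
Context {d : measure_display} {Omega : measurableType d} {R : realType}.
Variable Pr : probability Omega R.
Implicit Types r : nat -> Omega -> R.

Definition ops r := forall e : R, 0 < e ->
  vanishing Pr (fun n => [set w | e < Num.sqrt n%:R * `|r n w|]).

Lemma ops_near r r' : (\forall n \near \oo, forall w, r n w = r' n w) -> ops r' -> ops r.
Proof.
move=> rr' r'0 e e0; apply: vanishingS (r'0 e e0); near=> n => w /=.
suff -> : r n w = r' n w by []; by move: w; near: n.
Unshelve. all: by end_near. Qed.

Lemma opsN r : ops r -> ops (fun n w => - r n w).
Proof. by move=> r0 e e0; under eq_fun do under eq_set do rewrite normrN; exact: r0. Qed.

Lemma opsD r r' : ops r -> ops r' -> ops (fun n w => r n w + r' n w).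
Proof.
move=> r0 r'0 e e0.
have e2 : 0 < e / 2 by rewrite divr_gt0.
apply: (vanishingS _ (vanishingU (r0 _ e2) (r'0 _ e2))); apply: nearW => n w /= ew.
case: (ltP (e / 2) (Num.sqrt n%:R * `|r n w|)) => h1; first by left.
right; rewrite ltNge; apply/negP => h2; move: ew; apply/negP; rewrite -leNgt.
apply: (le_trans (ler_wpM2l (sqrtr_ge0 _) (ler_normD _ _))).
by rewrite mulrDr [leRHS]splitr lerD.
Qed.

Lemma op_sqrt_entries q (r : nat -> Omega -> 'M[R]_q) :
  (forall i j, ops (fun n w => r n w i j)) -> op_sqrt Pr r.
Proof.
move=> r0 e e0; have e1 : 0 < e / (1 + q%:R) by rewrite divr_gt0// ltr_pwDl.
have van := @vanishing_bigU _ _ _ Pr _ (enum (('I_q * 'I_q)%type : finType)) (fun p n =>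
  [set w | e / (1 + q%:R) < Num.sqrt n%:R * `|r n w p.1 p.2|]) (fun p => r0 p.1 p.2 _ e1).
apply: vanishingS van; apply: nearW => n w /= ew; apply: contrapT => H.
move: ew; apply/negP; rewrite -leNgt.
have le p1 p2 : `|Num.sqrt n%:R * r n w p1 p2| <= e / (1 + q%:R).
  rewrite normrM ger0_norm ?sqrtr_ge0// leNgt; apply/negP => h; apply: H.
  by exists (p1, p2) => //; rewrite mem_enum.
have -> : Num.sqrt n%:R * frob (r n w) = frob (Num.sqrt n%:R *: r n w).
  apply/eqP; rewrite -(@eqrXn2 _ 2) ?mulr_ge0 ?sqrtr_ge0 ?frob_ge0// exprMn !sqr_frob.
  rewrite mulr_sumr; apply/eqP/eq_bigr => i _; rewrite mulr_sumr; apply: eq_bigr => j _.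
  by rewrite mxE exprMn.
rewrite (le_trans (@frob_le _ _ _ (e / (1 + q%:R)) (ltW e1) _))//.
  by move=> i j; rewrite mxE.
by rewrite mulrC -mulrA ler_piMr ?(ltW e0)// mulrC ler_pdivrMr ?mul1r ?lerDr// ltr_pwDl.
Qed.

End NegligibleSqrt.

Section Expansion.
Context {d : measure_display} {Omega : measurableType d} {R : realType} {q : nat}.
Variables (Pr : probability Omega R) (X : nat -> Omega -> 'rV[R]_q).
Hypothesis iidX : iid Pr X.
Local Notation Q := (law Pr (fun w => X 0%N w - X 1%N w)).
Variable J : 'rV[R]_q -> 'M[R]_q.
Hypothesis bJ : forall i j, bmf ((fun x => J x i j) : Vb R q -> R).
Hypothesis Jeven : forall x, J (- x) = J x.
Hypothesis Jcent : forall i j, rint Pr (fun w => J (X 0%N w - X 1%N w) i j) = 0.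

Let Jeven' i j x : J (- x) i j = J x i j. Proof. by rewrite Jeven. Qed.

Lemma H1_entry x i j : H1 Pr X J x i j = h1 Pr X (fun y => J y i j) x.
Proof. by rewrite mxE. Qed.

Lemma H2_entry x y i j : H2 Pr X J x y i j = h2 Pr X (fun y => J y i j) x y.
Proof. by rewrite /h2 -!H1_entry !mxE. Qed.

Lemma H1bar_entry n w i j : H1bar Pr X J n w i j = avg_h1 Pr X (fun y => J y i j) n w.
Proof.
by rewrite mxE summxE; congr (_ * _); apply: eq_bigr => k _; rewrite H1_entry.
Qed.

Lemma Mnd_entry n dd w i j :
  Mnd Pr X J n dd w i j = avg_h2 Pr X (fun y => J y i j) (pairs_cyc n dd) w.
Proof.
rewrite mxE summxE /avg_h2 size_pairs_cyc /pairs_cyc big_allpairs_dep; congr (_ * _).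
apply: eq_bigr => k _; rewrite summxE; apply: eq_bigr => l _; exact: H2_entry.
Qed.

Lemma mint_Qs_entry s w i j : (0 < size s)%N ->
  mint (Qs X s w) J i j = (size s)%:R^-1 * \sum_(p <- s) J (X p.2 w - X p.1 w) i j.
Proof.
move=> s0; rewrite mxE (rint_Qs X w s0 (bJ i j)); congr (_ * _).
by apply: eq_bigr => p _; rewrite Jeven; field.
Qed.

Variable s : nat -> seq (nat * nat).
Hypothesis ds : \forall n \near \oo, @design R n (s n) /\ (n <= size (s n))%N.

(** By orthogonality, n times the second moment is a constant times n / size, so the degenerate part
    is negligible once the number of pairs outgrows n. *)
Lemma ops_avg_h2 i j : n%:R / (size (s n))%:R @[n --> \oo] --> (0 : R) ->
  ops Pr (fun n w => avg_h2 Pr X (fun y => J y i j) (s n) w).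
Proof.
move=> ns0 e e0.
pose b := rint Pr (fun w => h2 Pr X (fun y => J y i j) (X 0%N w) (X 1%N w) ^+ 2).
apply: (@vanishing_markov _ _ _ Pr _
  (fun n w => n%:R * avg_h2 Pr X (fun y => J y i j) (s n) w ^+ 2) (e ^+ 2)
  (fun n => n%:R / (size (s n))%:R * b)).
- by rewrite exprn_gt0.
- near=> n.
  have n0 : (0 < n)%N by near: n; exact: nbhs_infty_gt.
  have [dsn nsn] : @design R n (s n) /\ (n <= size (s n))%N by near: n.
  have sn0 : (0 < size (s n))%N by exact: leq_trans nsn.
  have bavg := bmf_avg_h2 iidX (bJ i j) (s n).
  split.
  + exact: (bmfZ _ (bmfX 2 bavg)).
  + by move=> w; rewrite mulr_ge0// sqr_ge0.
  + move=> w /= ew; rewrite -[X in X * _](@sqr_sqrtr _ n%:R)// -exprMn.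
    rewrite -[leRHS](real_normK (num_real _)) lerXn2r ?nnegrE// ?(ltW e0)//.
    by rewrite normrM (ger0_norm (sqrtr_ge0 _)) ltW.
  + rewrite rintZ; last exact: bmfX.
    by rewrite (rint_sqr_avg_h2 iidX (bJ i j) (Jeven' i j) (Jcent i j) sn0 dsn) mulrA.
- by rewrite -[X in _ --> X](mul0r b); apply: cvgM => //; exact: cvg_cst.
Unshelve. all: by end_near. Qed.

Variables (S : set (Dist R q)) (Sig : Dist R q -> 'M[R]_q).
Hypothesis diffS : diff_at S Sig Q J.
Hypothesis vanS : vanishing Pr (fun n => [set w | ~ S (Qs X (s n) w)]).

(** Unless the empirical measure leaves S or the neighbourhood N, the remainder is at most eta times
    the norm of the integral of J, and n times the squared norm has bounded expectation. *)
Lemma ops_remainder i j : ops Pr (fun n w =>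
  (Sig (Qs X (s n) w) - Sig Q - mint (Qs X (s n) w) J) i j).
Proof.
move=> e e0; apply/vanishingP => dl dl0.
pose a k l := 8 * rint Pr (fun w => h1 Pr X (fun y => J y k l) (X 0%N w) ^+ 2) +
  2 * rint Pr (fun w => h2 Pr X (fun y => J y k l) (X 0%N w) (X 1%N w) ^+ 2).
have a0 k l : 0 <= a k l.
  by rewrite addr_ge0// mulr_ge0//; apply: rint_ge0 => w; exact: sqr_ge0.
pose B := 1 + \sum_k \sum_l a k l.
have B0 : 0 < B by rewrite ltr_pwDl// sumr_ge0// => k _; rewrite sumr_ge0.
have dB : 0 < dl / (2 * B) by rewrite divr_gt0// mulr_gt0.
(* Chosen so that Markov's bound eta^2 B / e^2 equals dl / 2; the other half of dl is left for the
   two exceptional events. *)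
pose eta := e * Num.sqrt (dl / (2 * B)).
have eta0 : 0 < eta by rewrite mulr_gt0// sqrtr_gt0.
have eta2 : eta ^+ 2 = e ^+ 2 * (dl / (2 * B)) by rewrite exprMn sqr_sqrtr// ltW.
have [N [NQ HN]] := diffS eta0.
have dl2 : 0 < dl / 2 by rewrite divr_gt0.
have vanD := (vanishingP _ _).1 (vanishingU vanS (Qs_weak_vanishing iidX ds NQ)) _ dl2.
pose M n k l w := (size (s n))%:R^-1 * \sum_(p <- s n) J (X p.2 w - X p.1 w) k l.
pose T n w := eta ^+ 2 * \sum_k \sum_l n%:R * M n k l w ^+ 2.
near=> n.
have n0 : (0 < n)%N by near: n; exact: nbhs_infty_gt.
have [dsn nsn] : @design R n (s n) /\ (n <= size (s n))%N by near: n.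
have sn0 : (0 < size (s n))%N by exact: leq_trans nsn.
have nR : 0 < n%:R :> R by rewrite ltr0n.
have bM k l : bmf (M n k l).
  apply: bmfZ; apply: bmf_sum => p _.
  exact: (bmf_comp (measurable_XB iidX p.2 p.1) (bJ k l)).
have bT : bmf (T n).
  by apply: bmfZ; apply: bmf_sum => k _; apply: bmf_sum => l _; apply: bmfZ; exact: bmfX.
have T0 w : 0 <= T n w.
  rewrite mulr_ge0 ?sqr_ge0// sumr_ge0// => k _; rewrite sumr_ge0// => l _.
  by rewrite mulr_ge0// sqr_ge0.
have rT : rint Pr (T n) <= eta ^+ 2 * B.
  rewrite rintZ; last by apply: bmf_sum => k _; apply: bmf_sum => l _; apply: bmfZ; exact: bmfX.
  rewrite ler_wpM2l ?sqr_ge0// (rint_sum Pr); last first.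
    by move=> k _; apply: bmf_sum => l _; apply: bmfZ; exact: bmfX.
  apply: ler_wpDl => //; apply: ler_sum => k _; rewrite rint_sum; last first.
    by move=> l _; apply: bmfZ; exact: bmfX.
  apply: ler_sum => l _; rewrite rintZ; last exact: bmfX.
  rewrite -ler_pdivlMl//.
  apply: (le_trans (rint_sqr_design iidX (bJ k l) (Jeven' k l) (Jcent k l) n0 sn0 dsn)).
  rewrite /a mulrDr mulrC lerD2l mulrC ler_wpM2r//.
    by rewrite mulr_ge0//; apply: rint_ge0 => w; exact: sqr_ge0.
  by rewrite lef_pV2 ?posrE ?ltr0n// ler_nat.
have e20 : 0 < e ^+ 2 by rewrite exprn_gt0.
have mT := bmf_measurable_ge (e ^+ 2) bT.
have sub : [set w | e < Num.sqrt n%:R *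
    `|(Sig (Qs X (s n) w) - Sig Q - mint (Qs X (s n) w) J) i j|] `<=`
    ([set w | ~ S (Qs X (s n) w)] `|` [set w | ~ N (Qs X (s n) w)]) `|` [set w | e ^+ 2 <= T n w].
  move=> w /= ew; case: (pselect (S (Qs X (s n) w))) => [Sw|]; last by left; left.
  case: (pselect (N (Qs X (s n) w))) => [Nw|]; last by left; right.
  right; have h := le_trans (entry_le_frob _ i j) (HN _ Sw Nw).
  have := lt_le_trans ew (ler_wpM2l (sqrtr_ge0 _) h) => {}h.
  have -> : T n w = (Num.sqrt n%:R * (eta * frob (mint (Qs X (s n) w) J))) ^+ 2.
    rewrite /T [RHS]exprMn sqr_sqrtr// [(eta * _) ^+ 2]exprMn sqr_frob mulrCA.
    congr (_ * _); rewrite mulr_sumr.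
    apply: eq_bigr => k _; rewrite mulr_sumr; apply: eq_bigr => l _.
    by rewrite mint_Qs_entry.
  by rewrite lerXn2r ?nnegrE ?(ltW e0) ?(ltW h)// (le_trans (ltW e0))// ltW.
apply: (le_lt_trans (outer_probS _ sub)); apply: (le_lt_trans (outer_probU _ _ _)).
have hT : (outer_prob Pr [set w | (e ^+ 2 <= T n w)%R] <= (dl / 2)%:E)%E.
  apply: (le_trans (outer_prob_le Pr mT (@subset_refl _ _))).
  apply: (le_trans (markov_rint Pr e20 bT T0)).
  rewrite lee_fin ler_pdivrMr// (le_trans rT)// eta2.
  rewrite -subr_ge0 (_ : _ - _ = 0)//; field.
  by rewrite gt_eqF.
rewrite (splitr dl) EFinD; apply: lte_leD => //; last by near: n.
by rewrite ge0_fin_numE ?outer_prob_ge0// (le_lt_trans hT)// ltry.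
Unshelve. all: by end_near. Qed.

Lemma ops_expansion i j : ops Pr (fun n w => (Sig (Qs X (s n) w) - Sig Q) i j -
  2 * H1bar Pr X J n w i j - avg_h2 Pr X (fun y => J y i j) (s n) w).
Proof.
apply: ops_near (ops_remainder i j); near=> n => w.
have n0 : (0 < n)%N by near: n; exact: nbhs_infty_gt.
have [dsn nsn] : @design R n (s n) /\ (n <= size (s n))%N by near: n.
have sn0 : (0 < size (s n))%N by exact: leq_trans nsn.
rewrite [RHS]mxE [(- mint _ _) _ _]mxE mint_Qs_entry// H1bar_entry.
by rewrite (design_decomp Pr X (Jeven' i j) w n0 sn0 dsn) opprD addrA.
Unshelve. all: by end_near. Qed.

End Expansion.

(** * Joint limit *)

Lemma continuous_mx (R : realType) (T : topologicalType) m n (f : T -> 'M[R]_(m, n)) :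
  (forall i j, continuous (fun x => f x i j)) -> continuous f.
Proof.
move=> cf x A [P /= HP PA].
apply: (@filterS _ (nbhs x) _ [set y | forall i, forall j, P i j (f y i j)]).
  by move=> y H; exact: PA.
apply: (@filter_forall _ _ (fun i => [set y | forall j, P i j (f y i j)])) => i.
apply: (@filter_forall _ _ (fun j => [set y | P i j (f y i j)])) => j.
exact: (cf i j x _ (HP i j)).
Qed.

Section PairCoding.
Context {R : realType} {q : nat}.
Implicit Types A B : 'M[R]_q.

(** Codes a pair of matrices as one row vector, the setting of [cvg_dist_trig]. *)
Definition pair_row A B : 'rV[R]_(q * q + q * q) := row_mx (mxvec A) (mxvec B).

Definition row_pair (r : 'rV[R]_(q * q + q * q)) : 'M[R]_q * 'M[R]_q :=
  (vec_mx (lsubmx r), vec_mx (rsubmx r)).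

Lemma pair_rowK A B : row_pair (pair_row A B) = (A, B).
Proof. by rewrite /row_pair row_mxKl row_mxKr !mxvecK. Qed.

Lemma pair_row_ind (P : 'I_(q * q + q * q) -> Prop) :
  (forall i j, P (lshift _ (mxvec_index i j))) ->
  (forall i j, P (rshift _ (mxvec_index i j))) -> forall k, P k.
Proof.
by move=> Pl Pr k; case: (split_ordP k) => l ->; case/mxvec_indexP: l => i j.
Qed.

Lemma pair_rowEl A B i j : pair_row A B 0 (lshift _ (mxvec_index i j)) = A i j.
Proof. by rewrite row_mxEl mxvecE. Qed.

Lemma pair_rowEr A B i j : pair_row A B 0 (rshift _ (mxvec_index i j)) = B i j.
Proof. by rewrite row_mxEr mxvecE. Qed.

Lemma continuous_row_pair : continuous row_pair.
Proof.
have cl : continuous (fun r : 'rV[R]_(q * q + q * q) => vec_mx (lsubmx r) : 'M[R]_q).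
  by apply: continuous_mx => i j; under eq_fun do rewrite !mxE; exact: coord_continuous.
have cr : continuous (fun r : 'rV[R]_(q * q + q * q) => vec_mx (rsubmx r) : 'M[R]_q).
  by apply: continuous_mx => i j; under eq_fun do rewrite !mxE; exact: coord_continuous.
by move=> r; exact: (cvg_pair (cl r) (cr r)).
Qed.

Lemma dotr_pair_row a A B : dotr a (pair_row A B) =
  mx_inner (vec_mx (lsubmx a)) A + mx_inner (vec_mx (rsubmx a)) B.
Proof.
rewrite /dotr big_split_ord/= !mx_innerE !pair_bigA/=; congr (_ + _).
  rewrite (reindex _ (curry_mxvec_bij q q))/=; apply: eq_bigr => -[i j] _ /=.
  by rewrite pair_rowEl !mxE.
rewrite (reindex _ (curry_mxvec_bij q q))/=; apply: eq_bigr => -[i j] _ /=.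
by rewrite pair_rowEr !mxE.
Qed.

End PairCoding.

Section JointCLT.
Context {d : measure_display} {Omega : measurableType d} {R : realType} {q : nat}.
Variables (Pr : probability Omega R) (X : nat -> Omega -> 'rV[R]_q).
Hypothesis iidX : iid Pr X.
Variable J : 'rV[R]_q -> 'M[R]_q.
Hypothesis bJ : forall i j, bmf ((fun x => J x i j) : Vb R q -> R).
Hypothesis Jeven : forall x, J (- x) = J x.
Hypothesis Jcent : forall i j, rint Pr (fun w => J (X 0%N w - X 1%N w) i j) = 0.
Hypothesis Jsym : forall x, symmx (J x).

Let JA (A : 'M[R]_q) : 'rV[R]_q -> R := fun x => mx_inner A (J x).

Let bmf_JA A : bmf (JA A : Vb R q -> R).
Proof.
rewrite /JA; under eq_fun do rewrite mx_innerE.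
by apply: bmf_sum => i _; apply: bmf_sum => j _; exact: bmfZ.
Qed.

Let rint_JA A (Y : Omega -> Vb R q) : measurable_fun setT Y ->
  rint Pr (fun w => JA A (Y w)) = mx_inner A (mint Pr (fun w => J (Y w))).
Proof.
move=> mY; have bJY i j := bmf_comp mY (bJ i j).
rewrite /JA mx_innerE; under eq_fun do rewrite mx_innerE.
rewrite rint_sum; last by move=> i _; apply: bmf_sum => j _; exact: bmfZ.
apply: eq_bigr => i _; rewrite rint_sum; last by move=> j _; exact: bmfZ.
by apply: eq_bigr => j _; rewrite rintZ// mxE.
Qed.

Let JA_cent A : rint Pr (fun w => JA A (X 0%N w - X 1%N w)) = 0.
Proof.
rewrite (rint_JA A (measurable_XB iidX 0 1)) (_ : mint _ _ = 0).
  by rewrite /mx_inner mulmx0 mxtrace0.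
by apply/matrixP => i j; rewrite !mxE.
Qed.

Lemma h1_inner A x : h1 Pr X (JA A) x = mx_inner A (H1 Pr X J x).
Proof.
apply: rint_JA; apply: measurable_mxB; last exact: iidX.1.
exact: measurable_cst.
Qed.

Lemma h2_inner A x y : h2 Pr X (JA A) x y = mx_inner A (H2 Pr X J x y).
Proof.
have innerB (C M N : 'M[R]_q) : mx_inner C (M - N) = mx_inner C M - mx_inner C N.
  by rewrite /mx_inner mulmxBr linearB.
by rewrite /h2 !h1_inner /H2 !innerB.
Qed.

Lemma symmx_H1 x : symmx (H1 Pr X J x).
Proof.
apply/matrixP => i j; rewrite !mxE; congr (rint Pr); apply/funext => w.
by rewrite -{1}Jsym mxE.
Qed.

Lemma symmx_H2 x y : symmx (H2 Pr X J x y).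
Proof. by rewrite /symmx /H2 !linearB/= Jsym !symmx_H1. Qed.

Lemma clt_sum_inner A B dd n w : clt_sum Pr X (JA A) (JA B) dd n w =
  mx_inner A (Num.sqrt n%:R *: H1bar Pr X J n w) +
  mx_inner B (Num.sqrt (n * dd)%:R *: Mnd Pr X J n dd w).
Proof.
have sqrtV (x : R) : 0 <= x -> Num.sqrt x * x^-1 = (Num.sqrt x)^-1.
  move=> x0; case: (eqVneq x 0) => [->|xn0]; first by rewrite sqrtr0 mul0r invr0.
  have s0 : Num.sqrt x != 0 by rewrite sqrtr_eq0 -ltNge lt_neqAle eq_sym xn0.
  by rewrite -{2}(sqr_sqrtr x0) expr2 invfM mulrA divff// mul1r.
have innerZ (C M : 'M[R]_q) c : mx_inner C (c *: M) = c * mx_inner C M.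
  by rewrite /mx_inner -scalemxAr linearZ.
have innerS (C : 'M[R]_q) m k (F : nat -> 'M[R]_q) :
    mx_inner C (\sum_(m <= i < k) F i) = \sum_(m <= i < k) mx_inner C (F i).
  by rewrite /mx_inner mulmx_sumr linear_sum.
rewrite /clt_sum /H1bar /Mnd !scalerA !sqrtV// !innerZ !innerS; congr (_ * _ + _ * _).
  by apply: eq_bigr => i _; exact: h1_inner.
by apply: eq_bigr => i _; rewrite innerS; apply: eq_bigr => j _; exact: h2_inner.
Qed.

Context {d' : measure_display} {Omega' : measurableType d'}.
Variables (Pr' : probability Omega' R) (G1 G2 : Omega' -> 'M[R]_q).
Hypotheses (sG1 : forall w, symmx (G1 w)) (sG2 : forall w, symmx (G2 w)).
Hypotheses (gG1 : cgauss_mx Pr' G1) (gG2 : cgauss_mx Pr' G2).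
Hypothesis indG : indep_mx Pr' G1 G2.
Hypothesis varG1 : forall A : 'M[R]_q, symmx A ->
  (\int[Pr']_w ((mx_inner A (G1 w)) ^+ 2)%:E)%E =
  (\int[Pr]_w ((mx_inner A (H1 Pr X J (X 0%N w))) ^+ 2)%:E)%E.
Hypothesis varG2 : forall A : 'M[R]_q, symmx A ->
  (\int[Pr']_w ((mx_inner A (G2 w)) ^+ 2)%:E)%E =
  (\int[Pr]_w ((mx_inner A (H2 Pr X J (X 0%N w) (X 1%N w))) ^+ 2)%:E)%E.

Let var1 A : (\int[Pr']_w ((mx_inner A (G1 w)) ^+ 2)%:E =
  (rint Pr (fun w => h1 Pr X (JA A) (X 0%N w) ^+ 2))%:E)%E.
Proof.
under eq_integral do rewrite mx_inner_sym//.
rewrite varG1; last exact: symmx_sym.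
under eq_integral do rewrite -(mx_inner_sym A (symmx_H1 _)) -h1_inner.
by rewrite integral_bmf//; apply: bmfX; apply: bmf_h1_comp => //; exact: iidX.1.
Qed.

Let var2 A : (\int[Pr']_w ((mx_inner A (G2 w)) ^+ 2)%:E =
  (rint Pr (fun w => h2 Pr X (JA A) (X 0%N w) (X 1%N w) ^+ 2))%:E)%E.
Proof.
under eq_integral do rewrite mx_inner_sym//.
rewrite varG2; last exact: symmx_sym.
under eq_integral do rewrite -(mx_inner_sym A (symmx_H2 _ _)) -h2_inner.
by rewrite integral_bmf//; apply: bmfX; apply: bmf_h2_comp => //; exact: iidX.1.
Qed.

(** The perturbation r, possibly non-measurable, is zero for (iii) and carries the remainder of the
    estimators for (iv). *)
Lemma joint_clt dd (r : nat -> Omega -> 'M[R]_q) : (0 < dd)%N ->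
  (forall i j e, 0 < e -> vanishing Pr (fun n => [set w | e < `|r n w i j|])) ->
  cvg_dist Pr (fun n w => (Num.sqrt n%:R *: H1bar Pr X J n w + r n w,
    Num.sqrt (n * dd)%:R *: Mnd Pr X J n dd w)) Pr' (fun w => (G1 w, G2 w)).
Proof.
move=> dd0 r0.
pose Z n w := pair_row (Num.sqrt n%:R *: H1bar Pr X J n w)
  (Num.sqrt (n * dd)%:R *: Mnd Pr X J n dd w).
pose Z' n w := pair_row (Num.sqrt n%:R *: H1bar Pr X J n w + r n w)
  (Num.sqrt (n * dd)%:R *: Mnd Pr X J n dd w).
apply: (@cvg_dist_comp _ _ _ _ _ _ _ Pr Pr' row_pair Z' (fun w => pair_row (G1 w) (G2 w))).
- exact: continuous_row_pair.
- by move=> n w; rewrite pair_rowK.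
- by move=> w; rewrite pair_rowK.
pose a i j := rint Pr (fun w => h1 Pr X (fun y => J y i j) (X 0%N w) ^+ 2).
pose b i j := rint Pr (fun w => h2 Pr X (fun y => J y i j) (X 0%N w) (X 1%N w) ^+ 2).
have a0 i j : 0 <= a i j by apply: rint_ge0 => w; exact: sqr_ge0.
have b0 i j : 0 <= b i j by apply: rint_ge0 => w; exact: sqr_ge0.
pose B := \sum_i \sum_j (a i j + b i j).
have aB i j : a i j <= B.
  rewrite (le_trans _ (ler_sum2_term i j _))// ?lerDl// => k l; exact: addr_ge0.
have bB i j : b i j <= B.
  rewrite (le_trans _ (ler_sum2_term i j _))// ?lerDr// => k l; exact: addr_ge0.
have bh1 n i j := bmf_avg_h1 iidX (bJ i j) n.
have bh2 s i j := bmf_avg_h2 iidX (bJ i j) s.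
apply: (@cvg_dist_trig _ _ _ _ _ _ _ _ Z _ _ B).
- move=> n; apply: pair_row_ind => i j.
    under eq_fun do rewrite pair_rowEl mxE H1bar_entry; exact: bmfZ.
  under eq_fun do rewrite pair_rowEr mxE Mnd_entry; exact: bmfZ.
- apply: pair_row_ind => i j.
    under eq_fun do rewrite pair_rowEl.
    exact: (measurableT_comp (measurable_coord i j) gG1.1).
  under eq_fun do rewrite pair_rowEr.
  exact: (measurableT_comp (measurable_coord i j) gG2.1).
- near=> n.
  have nd : (2 * dd < n)%N by near: n; exact: nbhs_infty_gt.
  have n0 : (0 < n)%N by exact: leq_ltn_trans nd.
  have s0 : (0 < size (pairs_cyc n dd))%N by rewrite size_pairs_cyc muln_gt0 n0.
  apply: pair_row_ind => i j.
    under eq_fun do rewrite pair_rowEl mxE H1bar_entry exprMn sqr_sqrtr//.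
    rewrite rintZ; last exact: bmfX.
    rewrite (rint_sqr_avg_h1 iidX (bJ i j) (Jcent i j) n0) mulrA divff ?pnatr_eq0 -?lt0n//.
    by rewrite mul1r; exact: aB.
  under eq_fun do rewrite pair_rowEr mxE Mnd_entry exprMn sqr_sqrtr//.
  rewrite rintZ; last exact: bmfX.
  have Je x : J (- x) i j = J x i j by rewrite Jeven.
  rewrite (rint_sqr_avg_h2 iidX (bJ i j) Je (Jcent i j) s0 (design_pairs_cyc R nd)).
  rewrite -size_pairs_cyc mulrA divff ?pnatr_eq0 -?lt0n//.
  by rewrite mul1r; exact: bB.
- move=> c th.
  have -> : rint Pr' (fun w => cos (dotr c (pair_row (G1 w) (G2 w)) + th)) =
      expR (- (cltvar Pr X (JA (vec_mx (lsubmx c))) (JA (vec_mx (rsubmx c))) / 2)) * cos th.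
    under eq_fun do rewrite dotr_pair_row.
    exact: (gauss_pair_trig gG1 gG2 indG var1 var2).
  under eq_fun do under eq_fun do rewrite dotr_pair_row -clt_sum_inner.
  apply: clt_cyclic => //; first by move=> x; rewrite /JA Jeven.
- move=> e e0.
  have van := @vanishing_bigU _ _ _ Pr _ (enum (('I_q * 'I_q)%type : finType))
    (fun p n => [set w | e < `|r n w p.1 p.2|]) (fun p => r0 p.1 p.2 e e0).
  apply: vanishingS van; apply: nearW => n w /= [].
  apply: pair_row_ind => i j.
    rewrite !pair_rowEl [(_ + r n w) _ _]mxE addrAC subrr add0r => h.
    by exists (i, j); rewrite ?mem_enum.
  by rewrite !pair_rowEr subrr normr0 => /(lt_trans e0); rewrite ltxx.
Unshelve. all: by end_near. Qed.

(** A continuous linear image of the joint limit; c = 1 serves fixed d, and c = 0 the estimators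
    whose degenerate part is negligible. *)
Lemma expansion_clt dd (Y : nat -> Omega -> 'M[R]_q) (c : R) : (0 < dd)%N ->
  (forall i j, ops Pr (fun n w =>
    Y n w i j - 2 * H1bar Pr X J n w i j - c * Mnd Pr X J n dd w i j)) ->
  cvg_dist Pr (fun n w => Num.sqrt n%:R *: Y n w)
    Pr' (fun w => 2 *: G1 w + (c / Num.sqrt dd%:R) *: G2 w).
Proof.
move=> dd0 Y0.
(* The factor 1/2 offsets the doubling of the first coordinate by [phi], so that the image is
   exactly sqrt(n) Y. *)
pose r n w := (2^-1 * Num.sqrt n%:R) *:
  (Y n w - 2 *: H1bar Pr X J n w - c *: Mnd Pr X J n dd w).
have r0 i j e : 0 < e -> vanishing Pr (fun n => [set w | e < `|r n w i j|]).
  move=> e0; have e2 : 0 < 2 * e by rewrite mulr_gt0.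
  apply: vanishingS (Y0 i j _ e2); apply: nearW => n w /=.
  rewrite !mxE normrM ger0_norm ?mulr_ge0 ?invr_ge0 ?sqrtr_ge0//.
  by rewrite -mulrA ltr_pdivlMl.
pose phi (p : 'M[R]_q * 'M[R]_q) := 2 *: p.1 + (c / Num.sqrt dd%:R) *: p.2.
apply: (@cvg_dist_comp _ _ _ _ _ _ _ Pr Pr' phi _ (fun w => (G1 w, G2 w)) _ _ _ _ _
  (joint_clt dd0 r0)) => //.
- have c1 i j : continuous (fun p : 'M[R]_q * 'M[R]_q => p.1 i j).
    move=> p; apply: (@continuous_comp _ _ _ fst (fun A : 'M[R]_q => A i j)).
      exact: cvg_fst.
    exact: coord_continuous.
  have c2 i j : continuous (fun p : 'M[R]_q * 'M[R]_q => p.2 i j).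
    move=> p; apply: (@continuous_comp _ _ _ snd (fun A : 'M[R]_q => A i j)).
      exact: cvg_snd.
    exact: coord_continuous.
  apply: continuous_mx => i j; under eq_fun do rewrite !mxE.
  by apply: continuous_add; apply: continuous_mul => //; exact: cst_continuous.
- move=> n w; rewrite /phi /r /=.
  have s0 : Num.sqrt dd%:R != 0 :> R by rewrite sqrtr_eq0 -ltNge ltr0n.
  rewrite natrM sqrtrM//; move: (Mnd Pr X J n dd w) (H1bar Pr X J n w) => M H.
  by apply/matrixP => i j; rewrite !mxE; field.
Qed.

End JointCLT.

(** * Reduction of cases (a) and (b) to common properties *)

Section CaseProperties.
Context {d : measure_display} {Omega : measurableType d} {R : realType} {q : nat}.
Variables (Pr : probability Omega R) (X : nat -> Omega -> 'rV[R]_q).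
Hypothesis iidX : iid Pr X.
Local Notation Q := (law Pr (fun w => X 0%N w - X 1%N w)).
Variables (S : set (Dist R q)) (Sig : Dist R q -> 'M[R]_q) (J : 'rV[R]_q -> 'M[R]_q).

(** Split at the origin: on the singleton every function is measurable, and on its open complement
    continuity suffices. *)
Lemma measurable_continuous_off0 (f : 'rV[R]_q -> R) :
  (forall x, x != 0 -> {for x, continuous f}) ->
  measurable_fun setT (f : Vb R q -> R).
Proof.
move=> cf.
have o0 : open (~` [set 0] : set 'rV[R]_q).
  by apply: closed_openC; apply: accessible_closed_set1; apply: hausdorff_accessible.
have m0 : measurable (~` [set 0] : set (Vb R q)) by exact: sub_sigma_algebra.
have m1 : measurable ([set 0] : set (Vb R q)).
  by rewrite -[[set 0]]setCK; exact: measurableC.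
rewrite -(setvU [set 0]); apply/measurable_funU => //; split; last exact: measurable_fun_set1.
apply: (@measurability _ _ (Vb R q) _ (~` [set 0]) f _ (RGenOpens.measurableE R)).
move=> _ [_ [a [b ->]] <-]; apply: sub_sigma_algebra.
rewrite openE => x [/= x0 fx]; apply: filterI; first exact: open_nbhs_nbhs.
have /cf : x != 0 by apply/eqP.
apply; apply: open_nbhs_nbhs; split => //; exact: interval_open.
Qed.

Lemma case_kernel :
  (case_a S Sig /\ J_props_a Q J /\ diff_at S Sig Q J) \/
  (case_b (law Pr (X 0%N)) S Sig /\ J_props_b Q J /\ diff_at S Sig Q J) ->
  [/\ forall i j, bmf ((fun x => J x i j) : Vb R q -> R), forall x, J (- x) = J x,
    forall i j, rint Pr (fun w => J (X 0%N w - X 1%N w) i j) = 0,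
    forall x, symmx (J x) & diff_at S Sig Q J].
Proof.
have cent : (forall i j, bmf ((fun x => J x i j) : Vb R q -> R)) -> mint Q J = 0 ->
    forall i j, rint Pr (fun w => J (X 0%N w - X 1%N w) i j) = 0.
  by move=> bJ /matrixP J0 i j; have := J0 i j; rewrite !mxE (rint_Q iidX (bJ i j)).
case=> [[_ [[[M JM] [mJ [Je [Js J0]]]] dS]]|[_ [[[M JM] [cJ [Je [Js [_ J0]]]]] dS]]].
  have bJ i j : bmf ((fun x => J x i j) : Vb R q -> R) by split => //; exists M.
  by split => //; exact: cent.
have bJ i j : bmf ((fun x => J x i j) : Vb R q -> R).
  split; last by exists M.
  apply: measurable_continuous_off0 => x x0.
  apply: (@continuous_comp _ _ _ J (fun A : 'M[R]_q => A i j)); last exact: coord_continuous.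
  move: cJ; rewrite continuous_open_subspace; last first.
    by apply: closed_openC; apply: accessible_closed_set1; apply: hausdorff_accessible.
  by apply; rewrite inE /=; apply/eqP.
by split => //; exact: cent.
Qed.

Lemma case_vanishing (s : nat -> seq (nat * nat)) : S Q ->
  case_a S Sig \/ case_b (law Pr (X 0%N)) S Sig ->
  (\forall n \near \oo, @design R n (s n) /\ (n <= size (s n))%N) ->
  vanishing Pr (fun n => [set w | ~ S (Qs X (s n) w)]).
Proof.
move=> SQ [[[_ oS] _]|[_ [SE _]]] ds; first exact: (Qs_weak_vanishing iidX ds (oS _ SQ)).
by rewrite SE in SQ *; exact: Q0_vanishing.
Qed.

End CaseProperties.

Lemma leq_bin2 n : (3 <= n)%N -> (n <= 'C(n, 2))%N.
Proof.
move=> n3; have := mul_bin_diag n 1; rewrite bin1.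
by case: n n3 => // n n3 /=; nia.
Qed.

Lemma leq_sqr_bin2 n : (3 <= n)%N -> (n * n <= 4 * 'C(n, 2))%N.
Proof.
move=> n3; have := mul_bin_diag n 1; rewrite bin1.
by case: n n3 => // n n3 /=; nia.
Qed.

Section DesignRates.
Variable R : realType.

Lemma pairs_all_near : \forall n \near \oo,
  @design R n (pairs_all n) /\ (n <= size (pairs_all n))%N.
Proof.
near=> n; split; first exact: design_pairs_all.
by rewrite size_pairs_all leq_bin2//; near: n; exact: nbhs_infty_ge.
Unshelve. all: by end_near. Qed.

Lemma pairs_all_rate : n%:R / (size (pairs_all n))%:R @[n --> \oo] --> (0 : R).
Proof.
apply: (squeeze_cvgr _ (cvg_cst 0) (cvg_divn0 4)); near=> n.
have n3 : (3 <= n)%N by near: n; exact: nbhs_infty_ge.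
have n0 : 0 < n%:R :> R by rewrite ltr0n (leq_trans _ n3).
have C0 : 0 < ('C(n, 2))%:R :> R by rewrite ltr0n bin_gt0 (leq_trans _ n3).
rewrite size_pairs_all divr_ge0//= ler_pdivrMr// mulrAC ler_pdivlMr//.
by rewrite -!natrM ler_nat leq_sqr_bin2.
Unshelve. all: by end_near. Qed.

Variable dn : nat -> nat.
Hypothesis dnP : forall n, (3 <= n)%N -> (1 <= dn n)%N /\ (2 * dn n <= n - 1)%N.

Lemma pairs_cyc_near : \forall n \near \oo,
  @design R n (pairs_cyc n (dn n)) /\ (n <= size (pairs_cyc n (dn n)))%N.
Proof.
near=> n; have n3 : (3 <= n)%N by near: n; exact: nbhs_infty_ge.
have [d1 d2] := dnP n3; split; last by rewrite size_pairs_cyc leq_pmulr.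
by apply: design_pairs_cyc; lia.
Unshelve. all: by end_near. Qed.

Lemma pairs_cyc_rate : (forall M : nat, \forall n \near \oo, (M <= dn n)%N) ->
  n%:R / (size (pairs_cyc n (dn n)))%:R @[n --> \oo] --> (0 : R).
Proof.
move=> dnoo.
have cv : dn n @[n --> \oo] --> \oo.
  move=> A [N _ NA]; apply: filterS (dnoo N) => n; exact: NA.
apply: (@cvg_trans _ (1 / (dn n)%:R @[n --> \oo])).
  apply: near_eq_cvg; near=> n.
  have n0 : (0 < n)%N by near: n; exact: nbhs_infty_gt.
  by rewrite size_pairs_cyc natrM invfM mulrA divff// pnatr_eq0 -lt0n.
exact: (@cvg_comp _ _ _ dn (fun m => 1 / m%:R : R) _ _ _ cv (cvg_divn0 1)).
Unshelve. all: by end_near. Qed.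

End DesignRates.

Theorem theorem1
  (R : realType) (q : nat)
  (dO : measure_display) (Omega : measurableType dO) (Pr : probability Omega R)
  (X : nat -> Omega -> 'rV[R]_q)
  (S : set (Dist R q)) (Sig : Dist R q -> 'M[R]_q)
  (J : 'rV[R]_q -> 'M[R]_q)
  (dO' : measure_display) (Omega' : measurableType dO')
  (Pr' : probability Omega' R) (G1 G2 : Omega' -> 'M[R]_q) :
  iid Pr X ->
  let P := law Pr (X 0%N) in
  let Q := law Pr (fun w => X 0%N w - X 1%N w) in
  S Q ->
  (case_a S Sig /\ J_props_a Q J /\ diff_at S Sig Q J) \/
  (case_b P S Sig /\ J_props_b Q J /\ diff_at S Sig Q J) ->
  (forall w, symmx (G1 w)) -> (forall w, symmx (G2 w)) ->
  cgauss_mx Pr' G1 -> cgauss_mx Pr' G2 -> indep_mx Pr' G1 G2 ->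
  (forall A : 'M[R]_q, symmx A ->
     (\int[Pr']_w ((mx_inner A (G1 w)) ^+ 2)%:E)%E =
     (\int[Pr]_w ((mx_inner A (H1 Pr X J (X 0%N w))) ^+ 2)%:E)%E) ->
  (forall A : 'M[R]_q, symmx A ->
     (\int[Pr']_w ((mx_inner A (G2 w)) ^+ 2)%:E)%E =
     (\int[Pr]_w ((mx_inner A (H2 Pr X J (X 0%N w) (X 1%N w))) ^+ 2)%:E)%E) ->
  (* (i) *)
  (forall dn : nat -> nat,
     (forall n, (3 <= n)%N -> (1 <= dn n)%N /\ (2 * dn n <= n - 1)%N) ->
     (forall M : nat, \forall n \near \oo, (M <= dn n)%N) ->
     op_sqrt Pr (fun n w => Sig (Qhat X n w) - Sig Q
                            - 2%:R *: H1bar Pr X J n w) /\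
     op_sqrt Pr (fun n w => Sig (Qhatd X n (dn n) w) - Sig Q
                            - 2%:R *: H1bar Pr X J n w)) /\
  (* (ii) *)
  (forall d : nat, (1 <= d)%N ->
     op_sqrt Pr (fun n w => Sig (Qhatd X n d w) - Sig (Qhat X n w)
                            - Mnd Pr X J n d w)) /\
  (* (iii) *)
  (forall d : nat, (1 <= d)%N ->
     cvg_dist Pr
       (fun n w => (Num.sqrt (n%:R) *: H1bar Pr X J n w,
                    Num.sqrt ((n * d)%N%:R) *: Mnd Pr X J n d w))
       Pr' (fun w => (G1 w, G2 w))) /\
  (* (iv) *)
  (forall dn : nat -> nat,
     (forall n, (3 <= n)%N -> (1 <= dn n)%N /\ (2 * dn n <= n - 1)%N) ->
     (forall M : nat, \forall n \near \oo, (M <= dn n)%N) ->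
     cvg_dist Pr (fun n w => Num.sqrt (n%:R) *: (Sig (Qhat X n w) - Sig Q))
       Pr' (fun w => 2%:R *: G1 w) /\
     cvg_dist Pr (fun n w => Num.sqrt (n%:R) *: (Sig (Qhatd X n (dn n) w) - Sig Q))
       Pr' (fun w => 2%:R *: G1 w)) /\
  (forall d : nat, (1 <= d)%N ->
     cvg_dist Pr (fun n w => Num.sqrt (n%:R) *: (Sig (Qhatd X n d w) - Sig Q))
       Pr' (fun w => 2%:R *: G1 w + (Num.sqrt (d%:R))^-1 *: G2 w)).

Proof.
move=> iidX P Q SQ cases sG1 sG2 gG1 gG2 indG v1 v2.
have [bJ Je Jc Js dS] := case_kernel iidX cases.
have cab : case_a S Sig \/ case_b P S Sig by case: cases => -[? _]; [left|right].
have expand s i j (ds : \forall n \near \oo, @design R n (s n) /\ (n <= size (s n))%N) :=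
  ops_expansion iidX bJ Je Jc ds dS (case_vanishing iidX SQ cab ds) i j.
have linear s i j (ds : \forall n \near \oo, @design R n (s n) /\ (n <= size (s n))%N)
    (rs : n%:R / (size (s n))%:R @[n --> \oo] --> (0 : R)) :
    ops Pr (fun n w => (Sig (Qs X (s n) w) - Sig Q) i j - 2 * H1bar Pr X J n w i j).
  apply: ops_near (opsD (expand s i j ds) (ops_avg_h2 iidX bJ Je Jc ds i j rs)).
  by apply: nearW => n w; rewrite subrK.
have linQ i j : ops Pr (fun n w => (Sig (Qhat X n w) - Sig Q) i j - 2 * H1bar Pr X J n w i j).
  apply: ops_near (linear pairs_all i j (pairs_all_near R) (@pairs_all_rate R)).
  by apply: nearW => n w; rewrite Qhat_Qs.
have linQd dn : (forall n, (3 <= n)%N -> (1 <= dn n)%N /\ (2 * dn n <= n - 1)%N) ->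
    (forall M : nat, \forall n \near \oo, (M <= dn n)%N) ->
    forall i j, ops Pr (fun n w =>
      (Sig (Qhatd X n (dn n) w) - Sig Q) i j - 2 * H1bar Pr X J n w i j).
  move=> dnP dnoo i j.
  apply: ops_near (linear _ i j (pairs_cyc_near R dnP) (@pairs_cyc_rate R dn dnoo)).
  by apply: nearW => n w; rewrite Qhatd_Qs.
have expd dd i j : (1 <= dd)%N -> ops Pr (fun n w =>
    (Sig (Qhatd X n dd w) - Sig Q) i j - 2 * H1bar Pr X J n w i j - 1 * Mnd Pr X J n dd w i j).
  move=> d1; have ds : \forall n \near \oo,
      @design R n (pairs_cyc n dd) /\ (n <= size (pairs_cyc n dd))%N.
    near=> n; split; last by rewrite size_pairs_cyc leq_pmulr.
    by apply: design_pairs_cyc; near: n; exact: nbhs_infty_gt.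
  apply: ops_near (expand _ i j ds).
  by apply: nearW => n w; rewrite Qhatd_Qs mul1r Mnd_entry.
have clt Y c dd d0 := expansion_clt iidX bJ Je Jc Js sG1 sG2 gG1 gG2 indG v1 v2
  (dd := dd) (Y := Y) (c := c) d0.
(* With c = 0 the degenerate coordinate is multiplied by 0; dd = 1 is an arbitrary choice. *)
have clt0 (Y : nat -> Omega -> 'M[R]_q) :
    (forall i j, ops Pr (fun n w => Y n w i j - 2 * H1bar Pr X J n w i j)) ->
    cvg_dist Pr (fun n w => Num.sqrt n%:R *: Y n w) Pr' (fun w => 2%:R *: G1 w).
  move=> Y0; have -> : (fun w => 2%:R *: G1 w) =
      fun w => 2 *: G1 w + (0 / Num.sqrt 1%:R) *: G2 w.
    by apply/funext => w; rewrite mul0r scale0r addr0.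
  apply: clt => // i j; apply: ops_near (Y0 i j).
  by apply: nearW => n w; rewrite mul0r subr0.
split; last split; last split; last split.
- move=> dn dnP dnoo; split; apply: op_sqrt_entries => i j.
    by apply: ops_near (linQ i j); apply: nearW => n w; rewrite !mxE.
  by apply: ops_near (linQd dn dnP dnoo i j); apply: nearW => n w; rewrite !mxE.
- move=> dd d1; apply: op_sqrt_entries => i j.
  (* Subtracting the two expansions cancels both [Sig Q] and the linear term. *)
  apply: ops_near (opsD (expd dd i j d1) (opsN (linQ i j))); apply: nearW => n w.
  move: (Mnd _ _ _ _ _ _) (H1bar _ _ _ _ _) => M H; rewrite !mxE.
  by ring.
- move=> dd d1.
  have r0 (i j : 'I_q) (e : R) : 0 < e ->
      vanishing Pr (fun n => [set w : Omega | e < `|(0 : 'M[R]_q) i j|]).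
    move=> e0; apply: vanishingS (vanishing0 Pr); apply: nearW => n w /=.
    by rewrite mxE normr0 => /(lt_trans e0); rewrite ltxx.
  have := joint_clt iidX bJ Je Jc Js sG1 sG2 gG1 gG2 indG v1 v2 d1 r0.
  by under eq_fun do under eq_fun do rewrite addr0.
- move=> dn dnP dnoo; split; first exact: clt0.
  by apply: clt0 => i j; exact: linQd.
- move=> dd d1; have := clt _ 1 dd d1 (fun i j => expd dd i j d1).
  by rewrite div1r.
Unshelve. all: by end_near. Qed.
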